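(* Let $\mathbf{i}_0=(i_1,\dots,i_N)$ be a reduced word of the longest element $w_0\in W$ of the Weyl group of a simple Lie algebra, let $a_1,\dots,a_N$ be the quantum Lusztig coordinates attached to $\mathbf{i}_0$ (with respect to an orientation $\mathbf{H}$ of the Dynkin diagram), and let $a_1',\dots,a_N'$ be the elements obtained from them by a sequence of Coxeter moves $\mathbf{i}_0\mapsto\cdots\mapsto\mathbf{i}_0$ returning to the same word $\mathbf{i}_0$ (written formally as $\mathbf{x}_{i_1}(a_1)\cdots\mathbf{x}_{i_N}(a_N)=\mathbf{x}_{i_1}(a_1')\cdots\mathbf{x}_{i_N}(a_N')$). Then $$a_k'=a_k,\qquad k=1,\dots,N,$$ as elements in the noncommutative field of fractions generated by the coordinates $a_1,\dots,a_N$.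
   Context: **Lie data.** $\mathfrak{g}$ is a simple complex Lie algebra, $I$ the index set of its simple roots $\alpha_i$, $W=\langle s_i\rangle_{i\in I}$ its Weyl group, $N=l(w_0)$. With respect to a $W$-invariant inner product, $a_{ij}=2(\alpha_i,\alpha_j)/(\alpha_i,\alpha_i)$ is the Cartan matrix, and the multipliers are $d_i=\frac12(\alpha_i,\alpha_i)$, normalized so that $d_i=1$ for long roots (and for all roots in simply-laced types), $d_i=\frac12$ for short roots in types $B,C,F$, $d_i=\frac13$ for short roots in type $G$. Thus $d_ia_{ij}=d_ja_{ji}$. **Coxeter moves.** A Coxeter move replaces, at some position of a reduced word, a consecutive subword as follows, leaving the other letters fixed (in both directions): (0) $(i,j)\leftrightarrow(j,i)$ if $a_{ij}a_{ji}=0$; (1) $(i,j,i)\leftrightarrow(j,i,j)$ if $a_{ij}a_{ji}=1$; (2) $(i,j,i,j)\leftrightarrow(j,i,j,i)$ if $a_{ij}a_{ji}=2$. (The length-six move is not considered.) **Seeds and quantum tori.** A cluster seed $\mathbf{Q}$ consists of a finite vertex set $Q$, a frozen subset $Q_0\subset Q$, multipliers $d_v>0$, and a skew-symmetric matrix $(w_{uv})$; put $b_{uv}=w_{uv}/d_u$ (integral unless both $u,v$ are frozen). Let $\Lambda_{\mathbf{Q}}$ be the lattice with basis $\{\vec e_v\}_{v\in Q}$ and form $(\vec e_u,\vec e_v)=w_{uv}$. With $q$ a formal parameter (scalars contain the needed fractional powers of $q$), the quantum torus algebra $\mathcal{X}_q^{\mathbf{Q}}$ is generated by $X_\lambda$,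 $\lambda\in\Lambda_{\mathbf{Q}}$, with $X_0=1$ and $q^{(\lambda,\mu)}X_\lambda X_\mu=X_{\lambda+\mu}$; put $X_v=X_{\vec e_v}$, so $X_uX_v=q^{-2w_{uv}}X_vX_u$. $\mathbf{T}_q^{\mathbf{Q}}$ is its noncommutative field of fractions. **Quantum mutation.** For a non-frozen vertex $k$, $\mu_k:\mathbf{Q}\to\mathbf{Q}'$ keeps vertices, frozen vertices and multipliers, and sets $b'_{uv}=-b_{uv}$ if $u=k$ or $v=k$, and $b'_{uv}=b_{uv}+\frac{b_{uk}|b_{kv}|+|b_{uk}|b_{kv}}{2}$ otherwise. With $q_k=q^{d_k}$ it induces $\mu_k^q:\mathbf{T}_q^{\mathbf{Q}'}\to\mathbf{T}_q^{\mathbf{Q}}$ by $\mu_k^q(X_k')=X_k^{-1}$, and for $u\ne k$: $\mu_k^q(X_u')=X_u\prod_{r=1}^{|b_{ku}|}(1+q_k^{2r-1}X_k)$ if $b_{ku}\le0$, and $\mu_k^q(X_u')=X_u\prod_{r=1}^{b_{ku}}(1+q_k^{2r-1}X_k^{-1})^{-1}$ if $b_{ku}\ge0$. **Quivers.** For $i\in I$ the elementary quiver $\mathbf{J}(i)$ has vertices $(I\setminus\{i\})\cup\{i_l,i_r\}$; vertex $j\neq i$ is at level $j$ with multiplier $d_j$, and $i_l,i_r$ are at level $i$ (left and right) with multiplier $d_i$. Its nonzero weights are $w_{i_l,i_r}=d_i$ and $w_{i_l,j}=w_{j,i_r}=\frac12d_ia_{ij}$ for $j\ne i$ (and their negatives).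 For a reduced word $\mathbf{i}=(i_1,\dots,i_N)$ of $w_0$, the basic quiver $\mathbf{Q}(\mathbf{i})=\mathbf{J}(i_1)*\cdots*\mathbf{J}(i_N)$ is obtained by successively gluing on each level the rightmost vertex of $\mathbf{J}(i_{k-1})$ to the leftmost vertex of $\mathbf{J}(i_k)$ (on levels $j\ne i$ of $\mathbf{J}(i)$ these coincide), adding weights. Vertices on level $i$ are labeled from left to right $f_i^0,\dots,f_i^{n_i}$, with $n_i$ the number of occurrences of $i$ in $\mathbf{i}$; the frozen vertices are $f_i^0,f_i^{n_i}$. Given an orientation $\mathbf{H}$ of the Dynkin diagram, $\widetilde{\mathbf{Q}}(\mathbf{i})$ is obtained from $\mathbf{Q}(\mathbf{i})$ by adding, for each oriented edge $i\to j$ of $\mathbf{H}$, the amount $\frac12d_i|a_{ij}|$ to $w_{f_i^{n_i},f_j^{n_j}}$ (and its negative to the transposed entry), so that each half-weight arrow between rightmost frozen vertices is cancelled or doubled. **Mutations attached to Coxeter moves.** Each Coxeter move $C:\mathbf{i}\mapsto\mathbf{i}'$ gives an isomorphism $\mu_C^q:\mathbf{T}_q^{\widetilde{\mathbf{Q}}(\mathbf{i}')}\to\mathbf{T}_q^{\widetilde{\mathbf{Q}}(\mathbf{i})}$. Let $u$ (resp. $v$) be the number of letters $i$ (resp. $j$) of $\mathbf{i}$ to the left of the changed subword. * Move (0): identity in the labels $f_i^l$. * Move (1), $(i,j,i)\mapsto(j,i,j)$: quantum mutation at $f_i^{u+1}$ followed by the relabeling: the mutated vertex becomes $f_j^{v+1}$;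 $f_i^l$ becomes $f_i^{l-1}$ for $l\ge u+2$; $f_j^l$ becomes $f_j^{l+1}$ for $l\ge v+1$; other labels unchanged. * Move (2) with $i$ short, $(i,j,i,j)\mapsto(j,i,j,i)$ or its inverse: $\mu^q_{f_i^{u+1}}\circ\mu^q_{f_j^{v+1}}\circ\mu^q_{f_i^{u+1}}$, labels unchanged. For a sequence $\mathcal{C}=\{C_1,\dots,C_r\}$ of moves from $\mathbf{i}_0$ to $\mathbf{i}_r$, $\mu^q_{\mathcal{C}}=\mu^q_{C_1}\circ\cdots\circ\mu^q_{C_r}:\mathbf{T}_q^{\widetilde{\mathbf{Q}}(\mathbf{i}_r)}\to\mathbf{T}_q^{\widetilde{\mathbf{Q}}(\mathbf{i}_0)}$. **Quantum Lusztig coordinates.** For a reduced word $\mathbf{i}=(i_1,\dots,i_N)$ of $w_0$ and $1\le k\le N$ with $i_k=i$, let $v_k$ be such that $i_k$ is the $v_k$-th occurrence of $i$ in $\mathbf{i}$ from the left. The $k$-th coordinate attached to $\mathbf{i}$ is $$a_k:=X_{\sum_{j=v_k+1}^{n_i}\vec e_{f_i^j}}\in\mathcal{X}_q^{\widetilde{\mathbf{Q}}(\mathbf{i})}\quad(\text{with }a_k=X_{\vec e_{f_i^{n_i}}}\text{ for the last occurrence of } i,\text{ where the convention is that the sum runs over the vertices of level } i \text{ to the right of the } k\text{-th letter}).$$ Here the vertices to the right of the $v_k$-th occurrence of $i$ are $f_i^{v_k},\dots,f_i^{n_i}$, so the sum is over exactly these $n_i-v_k+1$ vertices. For a sequence $\mathcal{C}$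 of Coxeter moves from $\mathbf{i}_0$ to $\mathbf{i}$, the coordinates obtained from those of $\mathbf{i}_0$ by $\mathcal{C}$ are the images under $\mu^q_{\mathcal{C}}$, in $\mathbf{T}_q^{\widetilde{\mathbf{Q}}(\mathbf{i}_0)}$, of the coordinates attached to $\mathbf{i}$. *)

(* Defs.v *)
From HB Require Import structures.
From mathcomp Require Import all_boot all_order all_algebra.
From mathcomp Require Import ring.

Set Implicit Arguments.
Unset Strict Implicit.
Unset Printing Implicit Defensive.

Import Order.TTheory GRing.Theory Num.Theory.
Local Open Scope ring_scope.

(** A simple complex Lie algebra, given by its simple roots: [ip i j] is the
    inner product of the simple roots [i] and [j], scaled so that the long
    roots have square length 2 (all its values are then rational).  By the
    Cartan-Killing classification and Serre's theorem, these data are the same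
    as a simple complex Lie algebra with a choice of simple roots. *)
Record simple_type := SimpleType {
  simple_root :> finType;
  ip : simple_root -> simple_root -> rat;
  cartan : simple_root -> simple_root -> int;
  ip_sym : forall i j, ip i j = ip j i;
  ip_pos : forall x : simple_root -> rat,
    (exists i, x i != 0) -> 0 < \sum_i \sum_j x i * x j * ip i j;
  cartanE : forall i j, (cartan i j)%:~R = 2 * ip i j / ip i i;
  cartan_le0 : forall i j, i != j -> cartan i j <= 0;
  cartan_connected : forall J : {set simple_root},
    J != set0 -> J != setT -> exists2 i, i \in J & exists2 j, j \notin J & cartan i j != 0;
  ip_long : (forall i, ip i i <= 2) /\ (exists i, ip i i = 2)
}.

Definition rmult (g : simple_type) (i : g) : rat := ip i i / 2.

Lemma rmult_gt0 (g : simple_type) (i : g) : 0 < rmult i.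
Proof.
suff: 0 < ip i i by move=> h; rewrite divr_gt0.
have := @ip_pos g (fun j => (j == i)%:R); rewrite (bigD1 i) //= addrC big1.
  rewrite add0r (bigD1 i) //= addrC big1 => [|j /negPf ->].
    by rewrite add0r eqxx !mul1r; apply; exists i; rewrite eqxx oner_eq0.
  by rewrite mulr0 mul0r.
by move=> j /negPf ->; rewrite big1 // => k _; rewrite !mul0r.
Qed.

(** The Weyl group acts on the root lattice, with basis the simple roots:
    s_i(alpha_j) = alpha_j - a_ij alpha_i. *)
Definition reflection (g : simple_type) (i : g) (x : {ffun g -> int}) :
    {ffun g -> int} :=
  [ffun j => x j - (\sum_k cartan i k * x k) *+ (j == i)].

Definition weyl_elt (g : simple_type) (w : seq g) (x : {ffun g -> int}) :=
  foldr (@reflection g) x w.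

Definition reduced (g : simple_type) (w : seq g) :=
  forall w' : seq g, weyl_elt w' =1 weyl_elt w -> (size w <= size w')%N.

Definition reduced_longest (g : simple_type) (w : seq g) :=
  reduced w /\ forall w' : seq g, reduced w' -> (size w' <= size w)%N.

Definition dynkin_orientation (g : simple_type) (H : rel g) :=
  (forall i j, H i j -> i != j /\ cartan i j != 0) /\
  (forall i j, i != j -> cartan i j != 0 -> H i j (+) H j i).

(** The numbers [exch Q u v] are not required to be integral, although in all
    the seeds reached below they are, unless both [u] and [v] are frozen. *)
Record seed := Seed {
  vertex : finType;
  frozen : {set vertex};
  mult : vertex -> rat;
  weight : vertex -> vertex -> rat;
  mult_gt0 : forall v, 0 < mult v;
  weight_skew : forall u v, weight u v = - weight v u
}.

Definition exch (Q : seed) (u v : vertex Q) : rat := weight u v / mult u.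

Definition mutated_weight (Q : seed) (k u v : vertex Q) : rat :=
  mult u *
  (if (u == k) || (v == k) then - exch u v
   else exch u v + (exch u k * `|exch k v| + `|exch u k| * exch k v) / 2).

Lemma mutated_weight_skew (Q : seed) (k u v : vertex Q) :
  mutated_weight k u v = - mutated_weight k v u.
Proof.
have d0 x : mult x != 0 :> rat by rewrite gt_eqF ?mult_gt0.
rewrite /mutated_weight orbC /exch !normrM !normfV !(gtr0_norm (mult_gt0 _)).
rewrite (weight_skew v u) (weight_skew u k) (weight_skew k v) !normrN.
by case: ifP => _; field; rewrite ?d0.
Qed.

Definition mutate (Q : seed) (k : vertex Q) : seed :=
  {| vertex := vertex Q; frozen := frozen Q; mult := @mult Q;
     weight := mutated_weight k; mult_gt0 := @mult_gt0 Q;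
     weight_skew := @mutated_weight_skew Q k |}.

Definition basis_vec (Q : seed) (v : vertex Q) : {ffun vertex Q -> int} :=
  [ffun u => (u == v)%:R].

Definition lattice_form (Q : seed) (x y : {ffun vertex Q -> int}) : rat :=
  \sum_u \sum_v (x u)%:~R * (y v)%:~R * weight u v.

(** [qpow r] is q^r: the scalars contain all the rational powers of q, and q is
    transcendental (which also makes [K] a field of characteristic 0). *)
Definition formal_parameter (K : fieldType) (qpow : rat -> K) :=
  [/\ qpow 0 = 1,
      forall r s, qpow (r + s) = qpow r * qpow s &
      forall p : {poly int}, p != 0 -> (map_poly intr p).[qpow 1] != 0].

Definition in_torus (K : fieldType) (L : Type) (T : algType K) (X : L -> T)
    (a : T) :=
  exists (s : seq L) (c : L -> K), a = \sum_(x <- s) c x *: X x.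

(** A noncommutative field of fractions of the quantum torus algebra of [Q]: a
    division algebra over [K], with elements [qX x] that are a [K]-basis of a
    subalgebra in which they multiply as in the quantum torus algebra (the
    presentation of this algebra makes the X_x a [K]-basis of it), such that
    every element is a fraction of elements of this subalgebra.  It is unique
    up to a unique isomorphism that preserves the [qX x]. *)
Record quantum_field (K : fieldType) (qpow : rat -> K) (Q : seed) :=
  QuantumField {
  qsort :> unitAlgType K;
  qX : {ffun vertex Q -> int} -> qsort;
  qX0 : qX 0 = 1;
  qXM : forall x y, qpow (lattice_form x y) *: (qX x * qX y) = qX (x + y);
  qX_free : forall (s : seq {ffun vertex Q -> int}) (c : {ffun vertex Q -> int} -> K),
    uniq s -> \sum_(x <- s) c x *: qX x = 0 -> {in s, forall x, c x = 0};
  q_unit : forall a : qsort, a != 0 -> a \is a GRing.unit;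
  q_frac : forall a : qsort, exists b c : qsort,
    [/\ in_torus qX b, in_torus qX c, c != 0 & a = b / c]
}.

Definition qXv (K : fieldType) (qpow : rat -> K) (Q : seed)
    (T : quantum_field qpow Q) (v : vertex Q) : T := qX T (basis_vec v).

(** [numq (exch k u)] is [exch k u] when the latter is integral, as it is for
    every non-frozen [k] in the seeds considered here. *)
Definition is_quantum_mutation (K : fieldType) (qpow : rat -> K) (Q : seed)
    (k : vertex Q) (T : quantum_field qpow Q) (T' : quantum_field qpow (mutate k))
    (f : {lrmorphism T' -> T}) :=
  let b u := exch k u in
  let qk (r : nat) := qpow (mult k * (2 * r%:R - 1)) in
  [/\ k \notin frozen Q,
      f (qXv T' k) = (qXv T k)^-1,
      forall u, u != k -> b u <= 0 ->
        f (qXv T' u) = qXv T u *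
          \prod_(1 <= r < `|numq (b u)|.+1) (1 + qk r *: qXv T k) &
      forall u, u != k -> 0 <= b u ->
        f (qXv T' u) = qXv T u *
          \prod_(1 <= r < `|numq (b u)|.+1) (1 + qk r *: (qXv T k)^-1)^-1].

(** The isomorphism induced by a bijection [sigma] of vertices from [Q] to [Q']
    preserving all the data of the seeds. *)
Definition is_relabeling (K : fieldType) (qpow : rat -> K) (Q Q' : seed)
    (sigma : vertex Q -> vertex Q') (T : quantum_field qpow Q)
    (T' : quantum_field qpow Q') (f : {lrmorphism T' -> T}) :=
  forall v, f (qXv T' (sigma v)) = qXv T v.

(** The vertices of J(i) are encoded by [option g]: [Some i] is i_l, [None] is
    i_r, and [Some j] is the vertex at level j for j <> i. *)
Definition half_elem_weight (g : simple_type) (i : g) (a b : option g) : rat :=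
  match a, b with
  | Some j, None => if j == i then rmult i else rmult i * (cartan i j)%:~R / 2
  | Some j, Some k =>
      if (j == i) && (k != i) then rmult i * (cartan i k)%:~R / 2 else 0
  | None, _ => 0
  end.

Definition elem_weight (g : simple_type) (i : g) (a b : option g) : rat :=
  half_elem_weight i a b - half_elem_weight i b a.

(** [node w i l] is f_i^l (a junk vertex when [l > n_i]). *)
Definition wvertex (g : simple_type) (w : seq g) : finType :=
  {i : g & 'I_(count_mem i w).+1}.

Definition node (g : simple_type) (w : seq g) (i : g) (l : nat) : wvertex w :=
  Tagged (fun i => 'I_(count_mem i w).+1) (inord l : 'I_(count_mem i w).+1).

Definition wfrozen (g : simple_type) (w : seq g) : {set wvertex w} :=
  [set v | (tagged v == ord0) || (tagged v == ord_max)].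

(** The vertex of the glued quiver that comes from the vertex [a] of the [k]-th
    elementary quiver (counted from 0). *)
Definition glue (g : simple_type) (w : seq g) (k : 'I_(size w)) (a : option g) :
    wvertex w :=
  match a with
  | Some j => node w j (count_mem j (take k w))
  | None => let i := tnth (in_tuple w) k in node w i (count_mem i (take k w)).+1
  end.

Definition basic_weight (g : simple_type) (w : seq g) (u v : wvertex w) : rat :=
  \sum_(k < size w) \sum_(a | glue k a == u) \sum_(b | glue k b == v)
    elem_weight (tnth (in_tuple w) k) a b.

Definition wmult (g : simple_type) (w : seq g) (v : wvertex w) : rat :=
  rmult (tag v).

Lemma wmult_gt0 (g : simple_type) (w : seq g) (v : wvertex w) : 0 < wmult v.
Proof. exact: rmult_gt0. Qed.

Lemma basic_weight_skew (g : simple_type) (w : seq g) (u v : wvertex w) :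
  basic_weight u v = - basic_weight v u.
Proof.
rewrite /basic_weight -sumrN; apply: eq_bigr => k _.
rewrite exchange_big -sumrN; apply: eq_bigr => a _.
by rewrite -sumrN; apply: eq_bigr => b _; rewrite opprB.
Qed.

Definition basic_quiver (g : simple_type) (w : seq g) : seed :=
  {| vertex := wvertex w; frozen := wfrozen w; mult := @wmult g w;
     weight := @basic_weight g w; mult_gt0 := @wmult_gt0 g w;
     weight_skew := @basic_weight_skew g w |}.

Definition half_right_weight (g : simple_type) (H : rel g) (w : seq g)
    (u v : wvertex w) : rat :=
  if [&& tagged u == ord_max, tagged v == ord_max & H (tag u) (tag v)]
  then rmult (tag u) * `|(cartan (tag u) (tag v))%:~R| / 2 else 0.

Definition tilde_weight (g : simple_type) (H : rel g) (w : seq g)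
    (u v : wvertex w) : rat :=
  @weight (basic_quiver w) u v +
  (half_right_weight H u v - half_right_weight H v u).

Lemma tilde_weight_skew (g : simple_type) (H : rel g) (w : seq g)
    (u v : wvertex w) : tilde_weight H u v = - tilde_weight H v u.
Proof. by rewrite /tilde_weight opprD opprB -weight_skew. Qed.

Definition tilde_quiver (g : simple_type) (H : rel g) (w : seq g) : seed :=
  {| vertex := wvertex w; frozen := frozen (basic_quiver w);
     mult := @mult (basic_quiver w);
     weight := @tilde_weight g H w; mult_gt0 := @mult_gt0 (basic_quiver w);
     weight_skew := @tilde_weight_skew g H w |}.

(** In the last two constructors, [i] is the short root of the pair. *)
Inductive coxeter_move (g : simple_type) : seq g -> seq g -> Type :=
| Move0 (p : seq g) (i j : g) (s : seq g) :
    cartan i j * cartan j i = 0 ->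
    coxeter_move (p ++ [:: i; j] ++ s) (p ++ [:: j; i] ++ s)
| Move1 (p : seq g) (i j : g) (s : seq g) :
    cartan i j * cartan j i = 1 ->
    coxeter_move (p ++ [:: i; j; i] ++ s) (p ++ [:: j; i; j] ++ s)
| Move2 (p : seq g) (i j : g) (s : seq g) :
    cartan i j * cartan j i = 2 -> rmult i < rmult j ->
    coxeter_move (p ++ [:: i; j; i; j] ++ s) (p ++ [:: j; i; j; i] ++ s)
| Move2inv (p : seq g) (i j : g) (s : seq g) :
    cartan i j * cartan j i = 2 -> rmult i < rmult j ->
    coxeter_move (p ++ [:: j; i; j; i] ++ s) (p ++ [:: i; j; i; j] ++ s).

Inductive move_sequence (g : simple_type) : seq g -> seq g -> Type :=
| NoMove (w : seq g) : move_sequence w w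
| ConsMove (w w1 w2 : seq g) :
    coxeter_move w w1 -> move_sequence w1 w2 -> move_sequence w w2.

Definition same_label (g : simple_type) (w w' : seq g) (x : wvertex w) :
    wvertex w' := node w' (tag x) (tagged x).

Definition braid_label (g : simple_type) (w w' p : seq g) (i j : g)
    (x : wvertex w) : wvertex w' :=
  let u := count_mem i p in
  let v := count_mem j p in
  let l := nat_of_ord (tagged x) in
  if tag x == i then
    if l == u.+1 then node w' j v.+1
    else if (u.+2 <= l)%N then node w' i l.-1
    else node w' i l
  else if tag x == j then
    if (v.+1 <= l)%N then node w' j l.+1 else node w' j l
  else node w' (tag x) l.

(** [T] is a choice of the field T_q^Q for every seed [Q]. *)
Definition move0_morphism (g : simple_type) (H : rel g) (K : fieldType)
    (qpow : rat -> K) (T : forall Q, quantum_field qpow Q) (w w' : seq g)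
    (f : {lrmorphism T (tilde_quiver H w') -> T (tilde_quiver H w)}) : Prop :=
  @is_relabeling K qpow (tilde_quiver H w) (tilde_quiver H w')
    (@same_label g w w') _ _ f.

Definition move1_morphism (g : simple_type) (H : rel g) (K : fieldType)
    (qpow : rat -> K) (T : forall Q, quantum_field qpow Q) (w w' : seq g)
    (p : seq g) (i j : g)
    (f : {lrmorphism T (tilde_quiver H w') -> T (tilde_quiver H w)}) : Prop :=
  let k : vertex (tilde_quiver H w) := node w i (count_mem i p).+1 in
  exists (m : {lrmorphism T (mutate k) -> T (tilde_quiver H w)})
         (r : {lrmorphism T (tilde_quiver H w') -> T (mutate k)}),
  [/\ is_quantum_mutation m,
      @is_relabeling K qpow (mutate k) (tilde_quiver H w')
        (@braid_label g w w' p i j) _ _ r &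
      f =1 m \o r].

(** Here [i] is the short root of the pair. *)
Definition move2_morphism (g : simple_type) (H : rel g) (K : fieldType)
    (qpow : rat -> K) (T : forall Q, quantum_field qpow Q) (w w' : seq g)
    (p : seq g) (i j : g)
    (f : {lrmorphism T (tilde_quiver H w') -> T (tilde_quiver H w)}) : Prop :=
  let Q := tilde_quiver H w in
  let ki : wvertex w := node w i (count_mem i p).+1 in
  let kj : wvertex w := node w j (count_mem j p).+1 in
  let Q1 := @mutate Q ki in
  let Q2 := @mutate Q1 kj in
  let Q3 := @mutate Q2 ki in
  exists (m1 : {lrmorphism T Q1 -> T Q}) (m2 : {lrmorphism T Q2 -> T Q1})
         (m3 : {lrmorphism T Q3 -> T Q2})
         (r : {lrmorphism T (tilde_quiver H w') -> T Q3}),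
  [/\ is_quantum_mutation m1, is_quantum_mutation m2, is_quantum_mutation m3,
      @is_relabeling K qpow Q3 (tilde_quiver H w') (@same_label g w w') _ _ r &
      f =1 m1 \o (m2 \o (m3 \o r))].

Definition is_move_morphism (g : simple_type) (H : rel g) (K : fieldType)
    (qpow : rat -> K) (T : forall Q, quantum_field qpow Q) (w w' : seq g)
    (C : coxeter_move w w') :
    {lrmorphism T (tilde_quiver H w') -> T (tilde_quiver H w)} -> Prop :=
  match C in coxeter_move w w'
  return {lrmorphism T (tilde_quiver H w') -> T (tilde_quiver H w)} -> Prop with
  | Move0 p i j s _ => @move0_morphism g H K qpow T _ _
  | Move1 p i j s _ => @move1_morphism g H K qpow T _ _ p i j
  | Move2 p i j s _ _ => @move2_morphism g H K qpow T _ _ p i j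
  | Move2inv p i j s _ _ => @move2_morphism g H K qpow T _ _ p i j
  end.

Fixpoint is_sequence_morphism (g : simple_type) (H : rel g) (K : fieldType)
    (qpow : rat -> K) (T : forall Q, quantum_field qpow Q) (w w' : seq g)
    (C : move_sequence w w') {struct C} :
    {lrmorphism T (tilde_quiver H w') -> T (tilde_quiver H w)} -> Prop :=
  match C in move_sequence w w'
  return {lrmorphism T (tilde_quiver H w') -> T (tilde_quiver H w)} -> Prop with
  | NoMove w => fun f => f =1 id
  | ConsMove w w1 w2 C1 C2 => fun f =>
      exists (f1 : {lrmorphism T (tilde_quiver H w1) -> T (tilde_quiver H w)})
             (f2 : {lrmorphism T (tilde_quiver H w2) -> T (tilde_quiver H w1)}),
      [/\ is_move_morphism C1 f1, is_sequence_morphism C2 f2 & f =1 f1 \o f2]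
  end.

(** The coordinate of the [k]-th letter (counted from 0) sums over all the
    vertices to the right of this letter on its level. *)
Definition lusztig_coord (g : simple_type) (H : rel g) (K : fieldType)
    (qpow : rat -> K) (T : forall Q, quantum_field qpow Q) (w : seq g)
    (k : 'I_(size w)) : T (tilde_quiver H w) :=
  let i := tnth (in_tuple w) k in
  let v := count_mem i (take k.+1 w) in
  qX (T (tilde_quiver H w))
    (\sum_(v <= l < (count_mem i w).+1)
       @basis_vec (tilde_quiver H w) (node w i l)).

(* Main.v *)
(** The inverses alpha_1, ..., alpha_N of the Lusztig coordinates q-commute as in
    Feigin's homomorphism from a quantum nilpotent algebra to a quantum torus, so
    that the sums e_j of the alpha_p over the positions p of the letter j behave
    like the Chevalley generators.  Every Coxeter move preserves the sums e_j:
    mutating and relabeling only splits or merges some of their terms.  Hence mu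
    fixes e_j for all j, and it remains to reconstruct every alpha_p from the e_j.

    To do this, let the lowering operators of the simple module L of highest
    weight rho act by x |-> x e_j - (scalar) e_j x, starting from 1 at the highest
    weight vector.  Induction on the number of letters, by Taylor expansion in the
    last alpha_p, shows that this is well defined on L and that a vector killed by
    E_l has an image that does not depend on a last alpha_p whose letter is l.  The
    image of an extremal vector is then, up to a nonzero scalar, a monomial in the
    alpha_p.  The monomials before and after the p-th letter l differ by
    alpha_p^m with m > 0, since the word is reduced.  So mu fixes alpha_p^m, and
    then alpha_p, a combination of alpha_p^m e_l and e_l alpha_p^m divided by
    alpha_p^m; the last letter is removed and the argument is repeated. *)
Require Import Defs.
From mathcomp Require Import all_boot all_order all_algebra.
From mathcomp Require Import ring lra zify.
From Stdlib Require Import Classical.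

Set Implicit Arguments.
Unset Strict Implicit.
Unset Printing Implicit Defensive.

Import Order.TTheory GRing.Theory Num.Theory.
Local Open Scope ring_scope.

(** * Root lattice and quantum highest weight modules *)

(** Each move is treated alone; the loop enters only because [mu] is then an endomorphism fixing
    every e_j. Fixing alpha_p^m alone would leave a root of unity undetermined. It is removed by
    noncommutativity: passing alpha_p^m through e_l rescales the earlier terms of e_l but not
    alpha_p itself. The weight rho is regular, which makes every exponent m positive. The
    orientation [H] enters through a nonsymmetric form c with c_ij + c_ji = 2 (alpha_i, alpha_j),
    and the module L is built for every such c. A vector of L is the family of its coefficients
    under words in the raising operators. A vector with no nonzero coefficient is zero, so
    simplicity is built in, and relations between lowering operators are checked by applying raising
    operators. The facts on reduced words come from the same modules: their weights are stable under
    reflections and bounded by the highest one, which gives the signs of the roots and then the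
    exchange condition. *)

Section RootLattice.

Variable g : simple_type.
Implicit Types (i j l : g) (x y n : {ffun g -> int}) (w : seq g).

Lemma ip_gt0 i : 0 < ip i i.
Proof. by have := rmult_gt0 i; rewrite /rmult; lra. Qed.

Lemma ip_neq0 i : ip i i != 0.
Proof. by rewrite gt_eqF ?ip_gt0. Qed.

Lemma ip_cartan i j : ip i j = (cartan i j)%:~R * ip i i / 2.
Proof. by rewrite cartanE; field; rewrite ip_neq0. Qed.

Lemma cartan_diag i : cartan i i = 2.
Proof.
apply: (@intr_inj rat); rewrite cartanE mulfK ?ip_neq0 //.
Qed.

Definition sroot i : {ffun g -> int} := [ffun j => (j == i)%:R].

Definition lform x y : rat := \sum_i \sum_j (x i)%:~R * (y j)%:~R * ip i j.

Definition copair i x : int := \sum_k cartan i k * x k.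

Lemma reflectionE i x : reflection i x = x - sroot i *~ copair i x.
Proof.
apply/ffunP => j; rewrite !ffunE ffunMzE !ffunE.
by case: eqP => _; rewrite ?mulr1n ?mulr0n ?mul0rz // intz.
Qed.

Lemma lform_sym x y : lform x y = lform y x.
Proof.
rewrite /lform exchange_big; apply: eq_bigr => i _; apply: eq_bigr => j _.
by rewrite ip_sym; ring.
Qed.

Lemma lformDMl x y z m : lform (x + y *~ m) z = lform x z + m%:~R * lform y z.
Proof.
rewrite /lform mulr_sumr -big_split; apply: eq_bigr => i _ /=.
rewrite mulr_sumr -big_split; apply: eq_bigr => j _ /=.
by rewrite !ffunE ffunMzE mulrzz intrD intrM; ring.
Qed.

Lemma lformDMr x y z m : lform z (x + y *~ m) = lform z x + m%:~R * lform z y.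
Proof. by rewrite lform_sym lformDMl ![lform z _]lform_sym. Qed.

Lemma lform0l x : lform 0 x = 0.
Proof.
by rewrite /lform big1 // => i _; rewrite big1 // => j _; rewrite ffunE !mul0r.
Qed.

Lemma lform0r x : lform x 0 = 0.
Proof. by rewrite lform_sym lform0l. Qed.

Lemma lform_srootl i x : lform (sroot i) x = \sum_j (x j)%:~R * ip i j.
Proof.
rewrite /lform (bigD1 i) //= [X in _ + X]big1 ?addr0 => [|k /negPf ki].
  by apply: eq_bigr => j _; rewrite ffunE eqxx mul1r.
by rewrite big1 // => j _; rewrite ffunE ki !mul0r.
Qed.

Lemma lform_sroot2 i j : lform (sroot i) (sroot j) = ip i j.
Proof.
rewrite lform_srootl (bigD1 j) //= big1 ?addr0 => [|k /negPf kj].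
  by rewrite ffunE eqxx mul1r.
by rewrite ffunE kj mul0r.
Qed.

Lemma copairE i x : lform (sroot i) x = (copair i x)%:~R * ip i i / 2.
Proof.
rewrite lform_srootl /copair rmorph_sum !mulr_suml; apply: eq_bigr => k _ /=.
by rewrite intrM ip_cartan; ring.
Qed.

Lemma copairDM i x y m : copair i (x + y *~ m) = copair i x + m * copair i y.
Proof.
rewrite /copair mulr_sumr -big_split; apply: eq_bigr => k _ /=.
by rewrite ffunE ffunMzE mulrzz; ring.
Qed.

Lemma copairM i x m : copair i (x *~ m) = m * copair i x.
Proof.
by rewrite -[x *~ m]add0r copairDM /copair big1 ?add0r // => k _; rewrite ffunE mulr0.
Qed.

Lemma copair_sroot i : copair i (sroot i) = 2.
Proof.
rewrite /copair (bigD1 i) //= big1 ?addr0 => [|k /negPf ki].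
  by rewrite ffunE eqxx mulr1 cartan_diag.
by rewrite ffunE ki mulr0.
Qed.

Lemma reflection_additive i x y m :
  reflection i (x + y *~ m) = reflection i x + reflection i y *~ m.
Proof.
rewrite !reflectionE copairDM mulrzDr mulrzBl opprD addrACA; congr (_ + (_ - _)).
by rewrite mulrC mulrzA.
Qed.

Lemma lform_reflection i x y : lform (reflection i x) (reflection i y) = lform x y.
Proof.
rewrite !reflectionE -!mulrNz lformDMl !lformDMr lform_sroot2.
by rewrite [lform x (sroot i)]lform_sym !copairE !mulrNz; field.
Qed.

Lemma lform_weyl w x y : lform (weyl_elt w x) (weyl_elt w y) = lform x y.
Proof. by elim: w => [//|i w IH] /=; rewrite lform_reflection. Qed.

Lemma weyl_eltD w x y m :
  weyl_elt w (x + y *~ m) = weyl_elt w x + weyl_elt w y *~ m.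
Proof. by elim: w => [//|i w IH] /=; rewrite IH reflection_additive. Qed.

Lemma weyl_elt_cat w v x : weyl_elt (w ++ v) x = weyl_elt w (weyl_elt v x).
Proof. by rewrite /weyl_elt foldr_cat. Qed.

Lemma weyl_sroot_neq0 w i : weyl_elt w (sroot i) != 0.
Proof.
apply/eqP => h; have := lform_weyl w (sroot i) (sroot i).
by rewrite h lform0l lform_sroot2 => /esym/eqP; rewrite (negPf (ip_neq0 i)).
Qed.

End RootLattice.

(** * Twisted quantum highest weight modules as functions on words *)

Section QuantumModule.

Variables (g : simple_type) (K : fieldType) (qp : rat -> K).
Hypothesis qp0 : qp 0 = 1.
Hypothesis qpD : forall r s, qp (r + s) = qp r * qp s.
Hypothesis qp_eq1 : forall r, qp r = 1 -> r = 0.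
Variable c : g -> g -> rat.
Hypothesis cP : forall i j, c i j + c j i = 2 * ip i j.
Variable lam : g -> nat.

Implicit Types (i j l : g) (n : {ffun g -> int}) (w v u : seq g).
Implicit Types (f h : seq g -> K).

Lemma qp_neq0 r : qp r != 0.
Proof.
apply/eqP => h; have := qpD r (- r).
by rewrite subrr qp0 h mul0r => /eqP; rewrite oner_eq0.
Qed.

Lemma qpN r : qp (- r) = (qp r)^-1.
Proof.
apply: (mulfI (qp_neq0 r)); rewrite -qpD subrr qp0 divff //; exact: qp_neq0.
Qed.

Lemma qpX r k : qp (r *+ k) = qp r ^+ k.
Proof. by elim: k => [|k IH]; rewrite ?mulr0n ?qp0 // mulrS exprS qpD IH. Qed.

Lemma c_diag i : c i i = ip i i.
Proof. by have := cP i i; lra. Qed.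

(** The inner product of the weight [lam - n] with the simple root [i], where [lam i] is the value
    of [lam] on the simple coroot. Weights are recorded throughout by their distance [n] to the
    highest one. *)
Definition wt n i : rat := (lam i)%:R * ip i i / 2 - \sum_k (n k)%:~R * ip k i.

Definition deg w : {ffun g -> int} := \sum_(i <- w) sroot i.

Lemma deg_cons i w : deg (i :: w) = sroot i + deg w.
Proof. by rewrite /deg big_cons. Qed.

Lemma deg_ge0 w i : 0 <= deg w i.
Proof. by rewrite /deg sum_ffunE sumr_ge0 // => l _; rewrite ffunE. Qed.

Lemma wtD n j i : wt (n + sroot j) i = wt n i - ip j i.
Proof.
rewrite /wt -addrA -opprD; congr (_ - _).
rewrite -[ip j i]mul1r -[1 * _]addr0.
rewrite [RHS](_ : _ = \sum_k (n k)%:~R * ip k i + \sum_k (k == j)%:R * ip k i).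
  by rewrite -big_split; apply: eq_bigr => k _; rewrite !ffunE intrD mulrDl; case: eqP.
congr (_ + _); rewrite (bigD1 j) //= eqxx mul1r big1 ?addr0 //; last first.
by move=> k /negPf->; rewrite mul0r.
Qed.

Lemma wtB n j i : wt (n - sroot j) i = wt n i + ip j i.
Proof. by rewrite -{2}[n](subrK (sroot j)) wtD subrK. Qed.

Definition E l f : seq g -> K := fun w => f (l :: w).

(* A vector is encoded by the function that sends the word [w] to the coefficient
   of the highest weight vector in the image of this vector under the raising
   operators of the letters of [w]; the recursion is the commutation relation of
   the raising operator [E l] with the lowering operator [F j]. *)
Fixpoint F j f w : K :=
  if w is l :: w' then
    qp (- c j l) * F j (E l f) w' +
    (if j == l then (1 - qp (2 * wt (deg w') l)) * f w' else 0)
  else 0.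

Lemma F_ext j f h : f =1 h -> F j f =1 F j h.
Proof.
move=> fh w; elim: w f h fh => [//|l w IH] f h fh /=.
by rewrite (IH (E l f) (E l h)) ?fh // => v; rewrite /E fh.
Qed.

Lemma F_lin j a f h w : F j (fun v => a * f v + h v) w = a * F j f w + F j h w.
Proof.
elim: w f h => [|l w IH] f h /=; first by ring.
rewrite (IH (E l f) (E l h)); case: eqP => _; ring.
Qed.

Lemma F_zero j f : f =1 (fun _ => 0) -> F j f =1 (fun _ => 0).
Proof.
move=> f0 w; elim: w f f0 => [//|l w IH] f f0 /=.
by rewrite (IH (E l f)) ?f0 ?mulr0 ?add0r ?if_same // => v; rewrite /E f0.
Qed.

Lemma F_scale j a f w : F j (fun v => a * f v) w = a * F j f w.
Proof.
rewrite -[RHS]addr0 -(@F_zero j (fun _ => 0) _ w) // -F_lin.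
by apply: F_ext => v; rewrite addr0.
Qed.

(** The torus element that occurs in the commutator of [E i] and [F i]. Reading the degree off the
    word defines it on inhomogeneous functions too. *)
Definition Kop i f : seq g -> K := fun w => qp (2 * wt (deg w) i) * f w.

Lemma E_F l j f w :
  E l (F j f) w = qp (- c j l) * F j (E l f) w +
    (if j == l then f w - Kop l f w else 0).
Proof. by rewrite {1}/E /=; case: eqP => _ //; rewrite /Kop; ring. Qed.

Lemma E_K l i f w : E l (Kop i f) w = qp (- (2 * ip l i)) * Kop i (E l f) w.
Proof.
rewrite /E /Kop deg_cons addrC wtD mulrBr qpD; ring.
Qed.

Lemma K_F i j f w : Kop i (F j f) w = qp (- (2 * ip j i)) * F j (Kop i f) w.
Proof.
elim: w f => [|l w IH] f; first by rewrite /Kop /= !mulr0.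
have -> : Kop i (F j f) (l :: w) =
  qp (- (2 * ip l i)) * Kop i (E l (F j f)) w by rewrite -E_K.
have -> : Kop i (E l (F j f)) w = qp (- c j l) * Kop i (F j (E l f)) w +
    (if j == l then Kop i f w - Kop i (Kop l f) w else 0).
  by rewrite /Kop E_F; case: eqP => _; rewrite /Kop; ring.
rewrite IH [F j _ (l :: w)]/=.
rewrite (@F_ext j (E l (Kop i f)) (fun v => qp (- (2 * ip l i)) * Kop i (E l f) v));
  last by move=> v; rewrite E_K.
rewrite F_scale; set X := F _ _ w.
by case: eqP => [<-|_]; rewrite /Kop; ring.
Qed.

(* [slco x N k] is [k]_x (1 - N x^(k-1)), the coefficient by which E_i and F_i
   descend along a string; the recursion avoids the denominator of [k]_x. *)
Fixpoint slco (x N : K) k : K :=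
  if k is k'.+1 then x * slco x N k' + 1 - N * x ^+ k' ^+ 2 else 0.

Lemma slcoE x N k : (1 - x) * slco x N k.+1 = (1 - x ^+ k.+1) * (1 - N * x ^+ k).
Proof.
elim: k => [|k IH]; first by rewrite /= expr1n; ring.
rewrite [slco _ _ k.+2]/= -/(slco x N k.+1) -addrA mulrDr mulrCA IH !exprS; ring.
Qed.

Lemma qp_exp_neq1 r k : r != 0 -> qp r ^+ k.+1 != 1.
Proof.
move=> r0; rewrite -qpX; apply/eqP => /qp_eq1 /eqP.
by rewrite mulrn_eq0 /= (negPf r0).
Qed.

Lemma slco_eq0 r N k : r != 0 -> (slco (qp r) N k.+1 == 0) = (N * qp r ^+ k == 1).
Proof.
move=> r0; have n0 m : 1 - qp r ^+ m.+1 != 0 by rewrite subr_eq0 eq_sym qp_exp_neq1.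
have := slcoE (qp r) N k; rewrite -{1}[qp r]expr1 => h.
rewrite -(mulrI_eq0 _ (mulfI (n0 0%N))) h (mulrI_eq0 _ (mulfI (n0 k))) subr_eq0.
by rewrite eq_sym.
Qed.

Lemma F_iter_ext i k f h : f =1 h -> iter k (F i) f =1 iter k (F i) h.
Proof. by move=> fh; elim: k => [|k IH] //=; apply: F_ext. Qed.

Lemma F_iter_scale i k a f w :
  iter k (F i) (fun v => a * f v) w = a * iter k (F i) f w.
Proof.
elim: k w => [|k IH] w //=; rewrite -F_scale; exact: F_ext.
Qed.

Lemma F_iter_zero i k f : f =1 (fun _ => 0) -> iter k (F i) f =1 (fun _ => 0).
Proof. by move=> f0; elim: k => [|k IH] //=; apply: F_zero. Qed.

(* The quantum adjoint action of [F i], iterated [s] times on [F j]: the quantum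
   Serre relation is the vanishing of [G i j (1 - a_ij)]. *)
Fixpoint G i j s f : seq g -> K :=
  if s is s'.+1 then
    fun w => F i (G i j s' f) w - qp (- (c i j + ip i i *+ s')) * G i j s' (F i f) w
  else F j f.

Lemma G_S i j s f w : G i j s.+1 f w =
  F i (G i j s f) w - qp (- (c i j + ip i i *+ s)) * G i j s (F i f) w.
Proof. by []. Qed.

Lemma G_ext i j s f h : f =1 h -> G i j s f =1 G i j s h.
Proof.
elim: s f h => [|s IH] f h fh w /=; first exact: F_ext.
by rewrite (F_ext _ (IH _ _ fh)) (IH _ _ (F_ext _ fh)).
Qed.

Lemma G_lin i j s a f h w :
  G i j s (fun v => a * f v + h v) w = a * G i j s f w + G i j s h w.
Proof.
elim: s f h w => [|s IH] f h w /=; first exact: F_lin.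
rewrite (F_ext _ (IH f h)) F_lin (G_ext _ _ _ (F_lin i a f h)) IH; ring.
Qed.

Lemma G_zero i j s f : f =1 (fun _ => 0) -> G i j s f =1 (fun _ => 0).
Proof.
elim: s f => [|s IH] f f0 w /=; first exact: F_zero.
by rewrite (F_zero _ (IH _ f0)) (IH _ (F_zero _ f0)) mulr0 subr0.
Qed.

Lemma G_scale i j s a f w : G i j s (fun v => a * f v) w = a * G i j s f w.
Proof.
rewrite -[RHS]addr0 -(@G_zero i j s (fun _ => 0) _ w) // -G_lin.
by apply: G_ext => v; rewrite addr0.
Qed.

Lemma K_G k i j s f w :
  Kop k (G i j s f) w =
    qp (- (2 * ip j k)) * qp (- (2 * ip i k)) ^+ s * G i j s (Kop k f) w.
Proof.
elim: s f w => [|s IH] f w; first by rewrite expr0 mulr1 K_F.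
have -> : Kop k (G i j s.+1 f) w = Kop k (F i (G i j s f)) w -
    qp (- (c i j + ip i i *+ s)) * Kop k (G i j s (F i f)) w.
  by rewrite /Kop /=; ring.
rewrite K_F (F_ext _ (IH f)) F_scale IH (G_ext _ _ _ (K_F k i f)) G_scale exprS /=.
ring.
Qed.

Lemma E_G_other l i j s f w : l != i -> l != j ->
  E l (G i j s f) w = qp (- c j l) * qp (- c i l) ^+ s * G i j s (E l f) w.
Proof.
move=> /negPf li /negPf lj; elim: s f w => [|s IH] f w.
  by rewrite [LHS]E_F eq_sym lj addr0 expr0 mulr1.
have -> : E l (G i j s.+1 f) w = E l (F i (G i j s f)) w -
  qp (- (c i j + ip i i *+ s)) * E l (G i j s (F i f)) w by [].
rewrite E_F eq_sym li addr0 (F_ext _ (IH f)) F_scale IH.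
rewrite (@G_ext i j s (E l (F i f)) (fun v => qp (- c i l) * F i (E l f) v)).
  by rewrite G_scale exprS /=; ring.
by move=> v; rewrite E_F eq_sym li addr0.
Qed.

(** [E i] commutes with [F j] up to a scalar, so the operators [G i j s] form an sl2-string for the
    adjoint action, starting at the weight of [F j]. The coefficient is that of a string, with torus
    eigenvalue [qp (- (2 * ip i j))]. *)
Lemma E_G_i i j s f w : i != j ->
  E i (G i j s f) w =
    qp (- ip i i) ^+ s * qp (- c j i) * G i j s (E i f) w +
    slco (qp (- ip i i)) (qp (- (2 * ip i j))) s * G i j s.-1 f w.
Proof.
move=> /negPf ij; elim: s f w => [|s IH] f w.
  by rewrite [LHS]E_F eq_sym ij expr0 /=; ring.
set x := qp (- ip i i) in IH *; set N := qp (- (2 * ip i j)) in IH *.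
set t := qp (- c j i) in IH *.
have kE : qp (- (c i j + ip i i *+ s)) = qp (- c i j) * x ^+ s.
  by rewrite opprD qpD -mulNrn qpX.
have rtE : qp (- c i j) * t = N.
  by rewrite -qpD -opprD cP.
have -> : E i (G i j s.+1 f) w = E i (F i (G i j s f)) w -
  qp (- (c i j + ip i i *+ s)) * E i (G i j s (F i f)) w by [].
rewrite E_F eqxx c_diag -/x (F_ext _ (IH f)).
rewrite (F_lin i _ (G i j s (E i f)) (fun v => _ * _ v)) F_scale K_G IH.
rewrite (@G_ext i j s (E i (F i f))
  (fun v => x * F i (E i f) v + (- 1 * Kop i f v + f v))); last first.
  by move=> v; rewrite E_F eqxx c_diag -/x; ring.
rewrite !G_lin.
have -> : qp (- (2 * ip j i)) = N by rewrite ip_sym.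
have -> : qp (- (2 * ip i i)) = x ^+ 2.
  by rewrite (_ : - (2 * _) = (- ip i i) *+ 2) ?qpX // mulr2n; ring.
rewrite kE !G_S kE; case: s IH kE => [|s] IH kE; first by rewrite /= !expr0 -rtE; ring.
rewrite [s.+1.-1]/= [s.+2.-1]/= !(G_S i j s f).
rewrite [slco x N s.+2]/= -/(slco x N s.+1).
have kE' : qp (- (c i j + ip i i *+ s)) = qp (- c i j) * x ^+ s.
  by rewrite opprD qpD -mulNrn qpX.
rewrite !kE' -[N]rtE.
have -> : x ^+ 2 ^+ s.+1 = (x * x ^+ s) ^+ 2 by rewrite -exprS -!exprM mulnC.
have -> : x ^+ s.+1 = x * x ^+ s by rewrite exprS.
have -> : x ^+ s.+2 = x * (x * x ^+ s) by rewrite !exprS.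
set xs := x ^+ s.
set X1 := F i (G i j s.+1 _) w; set X2 := G i j s.+1 _ w; set X3 := G i j s.+1 _ w.
ring.
Qed.

(** The commutator of [E j] and [F j] is 1 minus a torus element. The two products record what the
    [s] adjoint steps do to 1 and to this torus element. *)
Lemma E_G_j i j s f w : i != j ->
  E j (G i j s f) w =
    qp (- c i j) ^+ s * qp (- ip j j) * G i j s (E j f) w +
    (\prod_(k < s) (qp (- c i j) * (1 - qp (- ip i i) ^+ k))) * iter s (F i) f w -
    (\prod_(k < s) (qp (- c i j) * (1 - qp (- ip i i) ^+ k * qp (- (2 * ip i j))))) *
      iter s (F i) (Kop j f) w.
Proof.
move=> /negPf ij; elim: s f w => [|s IH] f w.
  by rewrite [LHS]E_F eqxx c_diag !big_ord0 expr0 /=; ring.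
have -> : E j (G i j s.+1 f) w = E j (F i (G i j s f)) w -
  qp (- (c i j + ip i i *+ s)) * E j (G i j s (F i f)) w by [].
rewrite E_F ij addr0 (F_ext _ (IH f)) IH.
rewrite opprD qpD -mulNrn qpX !big_ord_recr G_S opprD qpD -mulNrn qpX /= exprS.
set x := qp (- ip i i); set N := qp (- (2 * ip i j)); set r := qp (- c i j).
rewrite (@F_ext i _ (fun v => r ^+ s * qp (- ip j j) * G i j s (E j f) v +
   (\prod_(k < s) (r * (1 - x ^+ k)) * iter s (F i) f v +
    (- \prod_(k < s) (r * (1 - x ^+ k * N))) * iter s (F i) (Kop j f) v)));
  last by move=> v; ring.
rewrite (F_lin i _ _ (fun v => _ + _)) (F_lin i _ _ (fun v => _ * _)) F_scale.
rewrite (@G_ext i j s (E j (F i f)) (fun v => r * F i (E j f) v));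
  last by move=> v; rewrite E_F ij addr0.
rewrite G_scale (F_iter_ext i s (h := fun v => N * F i (Kop j f) v) (K_F j i f)).
rewrite F_iter_scale -!iterSr !iterS.
ring.
Qed.

(* Every raising operator commutes with [G i j (1 - a_ij)] up to a scalar. *)
Lemma G_serre i j a f w : i != j -> cartan i j = - a%:Z -> G i j a.+1 f w = 0.
Proof.
move=> ij aE.
(* As [a] is minus the Cartan entry, 2 (alpha_i, alpha_j) = - a (alpha_i, alpha_i). This ends the
   string exactly at [a.+1]. *)
have NE : qp (- ip i i) ^+ a * qp (- (2 * ip i j)) = 1.
  rewrite -qpX -qpD -qp0; congr qp; rewrite (ip_cartan i j) aE -mulr_natl mulrNz -pmulrn.
  by field.
elim: w f => [|l w IH] f.
  elim: a.+1 f {aE NE} => [//|s IHs] f; rewrite G_S IHs mulr0 subr0.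
  by [].
rewrite -[LHS]/(E l (G i j a.+1 f) w).
have [->|li] := eqVneq l i.
  rewrite E_G_i // IH mulr0 add0r (eqP (_ : slco _ _ _ == 0)) ?mul0r //.
  by rewrite slco_eq0 ?oppr_eq0 ?ip_neq0 // mulrC NE.
have [->|lj] := eqVneq l j; last by rewrite E_G_other // IH mulr0.
(* The first product has a zero factor at [k = 0], the second one at [k = a] by [NE]. *)
rewrite E_G_j // IH big_ord_recl expr0 subrr !mulr0 !mul0r add0r sub0r.
by rewrite big_ord_recr /= NE subrr !mulr0 mul0r oppr0.
Qed.

Lemma F_iter_lin i k a f h w :
  iter k (F i) (fun v => a * f v + h v) w = a * iter k (F i) f w + iter k (F i) h w.
Proof. by elim: k w => [|k IH] w //=; rewrite (F_ext _ IH) F_lin. Qed.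

(** * Integrability and stability of the weights under reflections *)

Definition vanishes f := f =1 (fun _ => 0).
Definition nilpotent_on i f := exists k, vanishes (iter k (F i) f).

(** The Serre relation bounds how far [F i] can be moved past [F j], so that local nilpotency
    spreads from the highest weight vector to all of L. *)
Lemma nilpotent_F i j f : nilpotent_on i f -> nilpotent_on i (F j f).
Proof.
move=> [k fk]; have [<-|ij] := eqVneq i j.
  by exists k; move=> w; rewrite -iterSr; apply: (F_zero _ fk).
have aE : cartan i j = - `|cartan i j|%N%:Z by have := cartan_le0 ij; lia.
set a := `|cartan i j|%N in aE.
(* Descending induction on [s], starting at the vanishing operator [G i j a.+1]. In each step [F i]
   of [G i j s f] is [G i j s.+1 f] plus a multiple of [G i j s (F i f)], whence an inner induction
   on [k]. *)
suff H d s : (d + s)%N = a.+1 -> forall k f, vanishes (iter k (F i) f) ->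
    vanishes (iter (k + d) (F i) (G i j s f)).
  by exists (k + a.+1)%N; apply: (H _ 0%N) => //; rewrite addn0.
elim: d s {k f fk} => [|d IHd] s ds k f fk.
  by apply: F_iter_zero => w; rewrite -[s]add0n ds G_serre.
elim: k f fk => [|k IHk] f fk; first by apply: F_iter_zero; apply: G_zero.
move=> w; rewrite addnS iterSr.
pose kap := qp (- (c i j + ip i i *+ s)).
rewrite (F_iter_ext _ _ (h := fun v => kap * G i j s (F i f) v + G i j s.+1 f v));
  last by move=> v; rewrite G_S -/kap; ring.
rewrite F_iter_lin (IHd s.+1) ?addnS // addSnnS IHk ?mulr0 ?addr0 //.
by move=> v; rewrite -iterSr; apply: fk.
Qed.

Definition homogeneous n f := forall w, f w != 0 -> deg w = n.

Lemma hom_E n l f : homogeneous n f -> homogeneous (n - sroot l) (E l f).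
Proof. by move=> fn w /fn; rewrite deg_cons => <-; rewrite addrC addKr. Qed.

Lemma hom_F n j f : homogeneous n f -> homogeneous (n + sroot j) (F j f).
Proof.
move=> fn w; elim: w n f fn => [|l w IH] n f fn; first by rewrite /= eqxx.
rewrite /= deg_cons; have [F0|F0] := eqVneq (F j (E l f) w) 0.
  rewrite F0 mulr0 add0r; case: (eqVneq j l) => [->|_]; last by rewrite eqxx.
  by rewrite mulf_eq0 negb_or => /andP[_ /fn ->]; rewrite addrC.
by move=> _; rewrite (IH _ _ (hom_E (l := l) fn)) // addrA [sroot l + _]addrC subrK.
Qed.

Lemma hom_K n i f w : homogeneous n f -> Kop i f w = qp (2 * wt n i) * f w.
Proof.
move=> fn; rewrite /Kop; have [->|/fn ->] := eqVneq (f w) 0; by rewrite ?mulr0.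
Qed.

Lemma hom_F_iter n i k f : homogeneous n f ->
  homogeneous (n + sroot i *+ k) (iter k (F i) f).
Proof.
move=> fn; elim: k => [|k IH] /=; first by rewrite mulr0n addr0.
by rewrite mulrSr addrA; apply: hom_F.
Qed.

Lemma hom_E_iter n i k f : homogeneous n f ->
  homogeneous (n - sroot i *+ k) (iter k (E i) f).
Proof.
move=> fn; elim: k => [|k IH] /=; first by rewrite mulr0n subr0.
by rewrite mulrSr opprD addrA; apply: hom_E.
Qed.

Lemma wtDn n j i k : wt (n + sroot j *+ k) i = wt n i - ip j i *+ k.
Proof.
elim: k => [|k IH]; first by rewrite !mulr0n addr0 subr0.
by rewrite !mulrSr addrA wtD IH opprD addrA.
Qed.

Lemma wtBn n j i k : wt (n - sroot j *+ k) i = wt n i + ip j i *+ k.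
Proof.
by rewrite -{2}[n](subrK (sroot j *+ k)) wtDn subrK.
Qed.

Lemma qp_wtDn n i k :
  qp (2 * wt (n + sroot i *+ k) i) = qp (2 * wt n i) * qp (- ip i i) ^+ k ^+ 2.
Proof.
rewrite wtDn -(qpX (- ip i i)) -(qpX (- ip i i *+ k)) -qpD; congr qp; ring.
Qed.

Lemma qp_wtBn n i k :
  qp (2 * wt (n - sroot i *+ k) i) = qp (2 * wt n i) * qp (ip i i) ^+ k ^+ 2.
Proof.
rewrite wtBn -(qpX (ip i i)) -(qpX (ip i i *+ k)) -qpD; congr qp; ring.
Qed.

Lemma E_F_iter n i k f w : homogeneous n f -> vanishes (E i f) ->
  E i (iter k (F i) f) w =
    slco (qp (- ip i i)) (qp (2 * wt n i)) k * iter k.-1 (F i) f w.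
Proof.
move=> fn f0; elim: k w => [|k IH] w; first by rewrite [LHS]f0 mul0r.
rewrite iterS E_F eqxx c_diag (F_ext _ IH) F_scale.
rewrite (hom_K _ _ (hom_F_iter fn)) qp_wtDn.
case: k IH => [|k] IH; rewrite -?iterS /=; ring.
Qed.

Lemma F_E_iter n i k f w : homogeneous n f -> vanishes (F i f) ->
  F i (iter k (E i) f) w =
    - qp (ip i i) * slco (qp (ip i i)) (qp (2 * wt n i)) k * iter k.-1 (E i) f w.
Proof.
move=> fn f0; elim: k w => [|k IH] w; first by rewrite [LHS]f0 /= mulr0 mul0r.
have := E_F i i (iter k (E i) f) w.
rewrite eqxx c_diag qpN [in LHS]/E IH (hom_K _ _ (hom_E_iter fn)) qp_wtBn.
have q0 := qp_neq0 (ip i i).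
move=> h; apply: (mulfI (invr_neq0 q0)).
rewrite iterS -[LHS](addrK (iter k (E i) f w -
  qp (2 * wt n i) * qp (ip i i) ^+ k ^+ 2 * iter k (E i) f w)) -h.
case: k IH h => [|k] IH h; rewrite /= /E; field; exact: q0.
Qed.

Definition vac : seq g -> K := fun w => (w == [::])%:R.

Lemma hom_vac : homogeneous 0 vac.
Proof.
by case=> [|l w]; rewrite /vac ?eqxx //= => _; rewrite /deg big_nil.
Qed.

Lemma wt0 i : wt 0 i = (lam i)%:R * ip i i / 2.
Proof. by rewrite /wt big1 ?subr0 // => k _; rewrite ffunE mul0r. Qed.

Lemma nilpotent_vac i : nilpotent_on i vac.
Proof.
exists (lam i).+1; elim=> [//|l w IH].
rewrite -[LHS]/(E l (iter (lam i).+1 (F i) vac) w).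
have [->|li] := eqVneq l i.
  rewrite (E_F_iter _ _ hom_vac) // (eqP (_ : slco _ _ _ == 0)) ?mul0r //.
  rewrite slco_eq0 ?oppr_eq0 ?ip_neq0 // wt0 -(qpX (- ip i i)) -qpD -qp0; apply/eqP.
  by congr qp; rewrite -mulr_natr; field.
elim: (lam i).+1 (w) => [//|k IHk] v; rewrite iterS E_F eq_sym (negPf li) addr0.
by rewrite (F_zero _ IHk) mulr0.
Qed.

(* The simple highest weight module, graded by the difference of the highest
   weight and the weight. *)
Inductive inL : {ffun g -> int} -> (seq g -> K) -> Prop :=
| inL_vac : inL 0 vac
| inL_F n j f : inL n f -> inL (n + sroot j) (F j f)
| inL_lin n a f h : inL n f -> inL n h -> inL n (fun w => a * f w + h w)
| inL_zero n f : vanishes f -> inL n f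
| inL_ext n f h : inL n f -> f =1 h -> inL n h.

Lemma inL_hom n f : inL n f -> homogeneous n f.
Proof.
elim=> {n f} [|n j f _ IH|n a f h _ IHf _ IHh|n f f0|n f h _ IH fh] w.
- exact: hom_vac.
- exact: hom_F.
- have [f0|/IHf //] := eqVneq (f w) 0.
  by rewrite f0 mulr0 add0r; apply: IHh.
- by rewrite f0 eqxx.
- by rewrite -fh; apply: IH.
Qed.

Lemma inL_nilpotent n f i : inL n f -> nilpotent_on i f.
Proof.
have mono f' k m : (k <= m)%N -> vanishes (iter k (F i) f') -> vanishes (iter m (F i) f').
  by move=> /subnK <- h; rewrite iterD; apply: F_iter_zero.
elim=> {n f} [|n j f _ IH|n a f h _ [k fk] _ [m hm]|n f f0|n f h _ [k fk] fh].
- exact: nilpotent_vac.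
- exact: nilpotent_F.
- exists (maxn k m) => w; rewrite F_iter_lin (mono _ _ _ (leq_maxl k m) fk).
  by rewrite (mono _ _ _ (leq_maxr k m) hm) mulr0 addr0.
- by exists 0%N.
- by exists k => w; rewrite -(F_iter_ext _ _ fh) fk.
Qed.

Lemma inL_scale n a f : inL n f -> inL n (fun w => a * f w).
Proof.
move=> fL; apply: inL_ext (inL_lin a fL (inL_zero n (f := fun _ => 0) _)) _ => //.
by move=> w; rewrite addr0.
Qed.

Lemma inL_E n l f : inL n f -> inL (n - sroot l) (E l f).
Proof.
elim=> {n f} [|n j f fL IH|n a f h _ IHf _ IHh|n f f0|n f h _ IH fh].
- by apply: inL_zero.
- apply: inL_ext (fun w => esym (E_F l j f w)).
  apply: inL_lin; first by rewrite addrAC; apply: inL_F.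
  case: (eqVneq j l) => [->|_]; last exact: inL_zero.
  rewrite addrK; apply: inL_ext (inL_scale (1 - qp (2 * wt n l)) fL) _ => w.
  by rewrite (hom_K _ _ (inL_hom fL)); ring.
- exact: inL_lin.
- by apply: inL_zero => w; rewrite /E f0.
- by apply: inL_ext IH _ => w; rewrite /E fh.
Qed.

Lemma inL_F_iter n i k f : inL n f -> inL (n + sroot i *+ k) (iter k (F i) f).
Proof.
move=> fn; elim: k => [|k IH] /=; first by rewrite mulr0n addr0.
by rewrite mulrSr addrA; apply: inL_F.
Qed.

Lemma inL_E_iter n i k f : inL n f -> inL (n - sroot i *+ k) (iter k (E i) f).
Proof.
move=> fn; elim: k => [|k IH] /=; first by rewrite mulr0n subr0.
by rewrite mulrSr opprD addrA; apply: inL_E.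
Qed.

Lemma last_nonvanishing (h : nat -> seq g -> K) : ~ vanishes (h 0%N) ->
  (exists k, vanishes (h k)) -> exists2 t, ~ vanishes (h t) & vanishes (h t.+1).
Proof.
move=> h0 [k hk]; elim: k hk => [//|k IH] hk.
by have [/IH //|nk] := classic (vanishes (h k)); exists k.
Qed.

Definition is_weight n := exists2 f, inL n f & ~ vanishes f.

Lemma is_weight_ge0 n j : is_weight n -> 0 <= n j.
Proof.
move=> [f fL nf]; have [w /eqP fw] := not_all_ex_not _ _ nf.
by rewrite -(inL_hom fL fw) deg_ge0.
Qed.

Definition cowt n i : int := (lam i)%:Z - copair i n.

Lemma wt_cowt n i : wt n i = (cowt n i)%:~R * ip i i / 2.
Proof.
rewrite /wt /cowt /copair intrD mulrNz rmorph_sum !mulrDl -pmulrn; congr (_ + _).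
rewrite !mulNr; congr (- _); rewrite !mulr_suml; apply: eq_bigr => k _.
by rewrite /= intrM ip_sym ip_cartan; ring.
Qed.

(** The simple reflection in the coordinate [n]: the weight [lam - affr i n] is the reflection of
    [lam - n]. *)
Definition affr i n := n + sroot i *~ cowt n i.

(** Go to an end of the [i]-string of a nonzero vector, then walk back to the mirror image: the
    string coefficients vanish nowhere on the way. The sign of [cowt n i] decides which end is
    used. *)
Lemma is_weight_affr n i : is_weight n -> is_weight (affr i n).
Proof.
move=> [f fL nf]; have fn := inL_hom fL.
have [m0|m0] := leP 0 (cowt n i).
  have [t yt yt1] : exists2 t, ~ vanishes (iter t (E i) f) & vanishes (iter t.+1 (E i) f).
    apply: (last_nonvanishing (h := fun t => iter t (E i) f)) => //.
    (* So many raisings would make the [i]-th coordinate of a degree negative. *)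
    exists `|n i|%N.+1 => w; apply/eqP/negPn/negP => /(hom_E_iter fn) wE.
    have := deg_ge0 w i; rewrite wE !ffunE ffunMnE !ffunE eqxx -mulrnA mul1n natz.
    by rewrite subr_ge0 => h; have := le_trans h (ler_norm _); rewrite -abszE lez_nat ltnn.
  set y := iter t _ _ in yt yt1; have yh : homogeneous _ y := hom_E_iter fn.
  have [k kE] : exists k : nat, cowt n i = k by exists `|cowt n i|%N; lia.
  (* Each of the [t] raisings adds 2 to the coroot value [k], so the string below [y] has length
     [k + t.*2]. The mirror image of [n] lies at depth [k + t]. *)
  have H r : (r <= k + t.*2)%N -> ~ vanishes (iter r (F i) y).
    elim: r => [//|r IH] rk h; apply: (IH (ltnW rk)) => w.
    apply/eqP; have := E_F_iter r.+1 w yh yt1.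
    rewrite [LHS]h => /esym/eqP; rewrite mulf_eq0 => /orP[|//].
    rewrite slco_eq0 ?oppr_eq0 ?ip_neq0 // wtBn wt_cowt kE -(qpX (- ip i i)) -qpD.
    move=> /eqP/qp_eq1; rewrite (_ : _ + _ = ip i i * ((k + t.*2)%N%:R - r%:R)).
      move=> /eqP; rewrite mulf_eq0 (negPf (ip_neq0 i)) subr_eq0 eqr_nat /=.
      by move=> /eqP rE; rewrite -rE ltnn in rk.
    by rewrite natrD -muln2 natrM -pmulrn; field.
  exists (iter (k + t) (F i) y); last by apply: H; rewrite leq_add2l -addnn leq_addl.
  rewrite (_ : affr i n = n - sroot i *+ t + sroot i *+ (k + t)).
    by apply: inL_F_iter; apply: inL_E_iter.
  by rewrite /affr kE -pmulrn mulrnDr [_ *+ k + _]addrC addrA subrK.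
have [t yt yt1] : exists2 t, ~ vanishes (iter t (F i) f) & vanishes (iter t.+1 (F i) f).
  apply: (last_nonvanishing (h := fun t => iter t (F i) f)) => //.
  exact: inL_nilpotent fL.
set y := iter t _ _ in yt yt1; have yh : homogeneous _ y := hom_F_iter fn.
have [k kE] : exists k : nat, cowt n i = - k%:Z by exists `|cowt n i|%N; lia.
have H r : (r <= k + t.*2)%N -> ~ vanishes (iter r (E i) y).
  elim: r => [//|r IH] rk h; apply: (IH (ltnW rk)) => w.
  apply/eqP; have := F_E_iter r.+1 w yh yt1.
  rewrite (F_zero _ h) => /esym/eqP; rewrite mulf_eq0 => /orP[|//].
  rewrite mulf_eq0 oppr_eq0 (negPf (qp_neq0 _)) /=.
  rewrite slco_eq0 ?ip_neq0 // wtDn wt_cowt kE -(qpX (ip i i)) -qpD.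
  move=> /eqP/qp_eq1; rewrite (_ : _ + _ = ip i i * (r%:R - (k + t.*2)%N%:R)).
    move=> /eqP; rewrite mulf_eq0 (negPf (ip_neq0 i)) subr_eq0 eqr_nat /=.
    by move=> /eqP rE; rewrite rE ltnn in rk.
  by rewrite natrD -muln2 natrM mulrNz -pmulrn; field.
exists (iter (k + t) (E i) y); last by apply: H; rewrite leq_add2l -addnn leq_addl.
rewrite (_ : affr i n = n + sroot i *+ t - sroot i *+ (k + t)).
  by apply: inL_E_iter; apply: inL_F_iter.
by rewrite /affr kE mulrNz -pmulrn mulrnDr opprD [- _ - _]addrC addrA addrK.
Qed.

End QuantumModule.

(** * Signs of the roots and the exchange condition *)

Section WeylGroup.

Variables (g : simple_type).
Implicit Types (i j l : g) (n x y : {ffun g -> int}) (w v u : seq g).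

Definition affw (lam : g -> nat) w n := foldr (affr lam) n w.

Lemma affrD lam i n y m : affr lam i (n + y *~ m) = affr lam i n + reflection i y *~ m.
Proof.
rewrite /affr /cowt copairDM reflectionE mulrzBl -mulrzA addrACA -mulrNz -mulrzDr.
by congr (_ + _ *~ _); ring.
Qed.

Lemma affwD lam w n y m : affw lam w (n + y *~ m) = affw lam w n + weyl_elt w y *~ m.
Proof. by elim: w => [//|i w IH] /=; rewrite IH affrD. Qed.

Lemma affrK lam i : involutive (@affr g lam i).
Proof.
move=> n; have h : cowt lam (affr lam i n) i = - cowt lam n i.
  by rewrite /affr /cowt copairDM copair_sroot; ring.
by rewrite /affr -/(affr lam i n) h mulrNz addrK.
Qed.

Lemma affw_revK lam w n : affw lam (rev w) (affw lam w n) = n.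
Proof.
elim: w n => [//|i w IH] n.
by rewrite rev_cons -cats1 /affw foldr_cat /= affrK -/(affw _ _ _) IH.
Qed.

Definition lamform (lam : g -> nat) x : rat :=
  \sum_j (x j)%:~R * ((lam j)%:R * ip j j / 2).

Lemma lamform_sroot lam i : lamform lam (sroot i) = (lam i)%:R * ip i i / 2.
Proof.
rewrite /lamform (bigD1 i) //= big1 ?addr0 => [|k /negPf ki].
  by rewrite ffunE eqxx mul1r.
by rewrite ffunE ki mul0r.
Qed.

Lemma lamformDM lam x y m : lamform lam (x + y *~ m) = lamform lam x + m%:~R * lamform lam y.
Proof.
rewrite /lamform mulr_sumr -big_split; apply: eq_bigr => k _ /=.
by rewrite ffunE ffunMzE mulrzz intrD intrM; ring.
Qed.

(** Invariance of the inner product: [rev w] acts as the inverse of [w], and [w] sends [lam] to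
    [lam - affw lam w 0]. *)
Lemma lamform_weyl lam w x :
  lamform lam (weyl_elt (rev w) x) = lamform lam x - lform (affw lam w 0) x.
Proof.
elim: w x => [|i w IH] x; first by rewrite lform0l subr0.
rewrite rev_cons -cats1 weyl_elt_cat /= IH reflectionE -mulrNz lamformDM lformDMr.
rewrite /affr lformDMl lamform_sroot copairE.
rewrite /cowt [lform _ (sroot i)]lform_sym copairE intrD !mulrNz -pmulrn; ring.
Qed.

Section Signs.

Variables (K : fieldType) (qp : rat -> K).
Hypothesis qp0 : qp 0 = 1.
Hypothesis qpD : forall r s, qp (r + s) = qp r * qp s.
Hypothesis qp_eq1 : forall r, qp r = 1 -> r = 0.

Lemma is_weight_affw c lam w (cP : forall i j, c i j + c j i = 2 * ip i j) n :
  is_weight qp c lam n -> is_weight qp c lam (affw lam w n).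
Proof.
move=> n0; elim: w => [//|i w IH] /=; exact: (is_weight_affr qp0 qpD qp_eq1 cP).
Qed.

Lemma is_weight0 c lam : @is_weight g K qp c lam 0.
Proof.
exists (@vac g K); first exact: inL_vac.
by move=> /(_ [::])/eqP; rewrite oner_eq0.
Qed.

(* The weights of the simple module of highest weight [lam] are stable under the
   Weyl group and at most [lam].  As the reflection along the root [y] subtracts
   from [lam] a multiple of [y] whose sign is that of [(lam, y)], the root [y] has
   coordinates of that sign, and every fundamental weight may be used as [lam]. *)
Lemma weyl_sroot_sign w i j k : 0 <= weyl_elt w (sroot i) j * weyl_elt w (sroot i) k.
Proof.
set y := weyl_elt w (sroot i); pose lam l : nat := (l == j).
pose n1 := affw lam (rev w) 0; pose m1 := cowt lam n1 i.
(* Only the weights of the module matter here, so the symmetric form serves as [c]. *)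
have cP : forall i j : g, ip i j + ip j i = 2 * ip i j.
  by move=> i' j'; rewrite [ip j' i']ip_sym; ring.
(* This word acts as the reflection along the root [y]; it sends [lam] to [lam] minus [m1] times
   [y]. *)
have /(is_weight_ge0 k) := is_weight_affw (w ++ i :: rev w) cP (is_weight0 (@ip g) lam).
rewrite {1}/affw foldr_cat /= -/(affw lam (rev w) 0) -/n1 /affr -/m1.
rewrite -/(affw lam w _) affwD -/y {1}/n1.
rewrite -{1}[w]revK affw_revK add0r ffunMzE mulrzz => ym.
have yjE : (y j)%:~R * ip j j = m1%:~R * ip i i.
  have := lamform_weyl lam (rev w) (sroot i); rewrite revK -/y -/n1 lamform_sroot.
  rewrite lform_sym copairE /lamform (bigD1 j) //= big1 ?addr0 => [|l /negPf lj].
    by rewrite /m1 /cowt intrD mulrNz -pmulrn /lam eqxx mul1r; lra.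
  by rewrite /lam lj !mul0r mulr0.
rewrite -(@ler0z rat) intrM -(pmulr_rge0 _ (ip_gt0 j)) mulrA [ip j j * _]mulrC yjE.
rewrite mulrAC -intrM mulrC pmulr_rge0 ?ip_gt0 // ler0z mulrC //.
Qed.

Lemma weyl_sroot_signs w i :
  (forall k, 0 <= weyl_elt w (sroot i) k) \/ (forall k, weyl_elt w (sroot i) k <= 0).
Proof.
set y := weyl_elt w (sroot i).
have [[j yj]|ny] := classic (exists j, y j < 0).
  right=> k; have := weyl_sroot_sign w i j k; rewrite -/y.
  by rewrite nmulr_rge0.
by left=> k; rewrite leNgt; apply/negP => yk; case: ny; exists k.
Qed.

(** Find the letter [i] of [u] whose reflection turns the root [y] from positive to negative. It
    changes only the coordinate [i], so all the others are both nonnegative and nonpositive and [y]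
    is a multiple of the simple root [i]. Reflecting along [y] or along that simple root is then the
    same, and the letters [i] and [l] cancel. *)
Lemma exchange u l : ~ (forall k, 0 <= weyl_elt u (sroot l) k) ->
  exists2 v, weyl_elt v =1 weyl_elt (rcons u l) & size u = (size v).+1.
Proof.
elim: u => [|i u IH] neg; first by case: neg => k; rewrite /= ffunE.
have [ypos|yneg] := classic (forall k, 0 <= weyl_elt u (sroot l) k); last first.
  by have [v vE uE] := IH yneg; exists (i :: v); [move=> x /=; rewrite vE|rewrite /= uE].
exists u => // x; set y := weyl_elt u (sroot l) in ypos *.
have yneg : forall k, reflection i y k <= 0.
  by have [//|] := weyl_sroot_signs (i :: u) l.
have yE : y = sroot i *~ y i.
  apply/ffunP => k; rewrite ffunMzE ffunE mulrzz; have [->|ki] := eqVneq k i.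
    by rewrite mul1r.
  apply/eqP; rewrite mul0r eq_le ypos andbT; move: (yneg k).
  by rewrite ffunE (negPf ki) mulr0n subr0.
set t := y i in yE.
(* Equality of lengths is all that has to be known about [t] to identify the two reflections. *)
have tE : t%:~R ^+ 2 * ip i i = ip l l :> rat.
  rewrite -(lform_sroot2 l l) -(lform_weyl u) -/y yE -[sroot i *~ t]add0r.
  by rewrite lformDMl !lformDMr lform_sroot2 !lform0l !lform0r; ring.
have t0 : t%:~R != 0 :> rat.
  apply/eqP => h; move: tE; rewrite h expr0n mul0r => /esym/eqP.
  by rewrite (negPf (ip_neq0 l)).
rewrite -cats1 -[_ :: _]cat1s -catA weyl_elt_cat weyl_elt_cat.
rewrite -[RHS]/(reflection i (weyl_elt u (reflection l x))) [reflection l x]reflectionE.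
rewrite -mulrNz weyl_eltD -/y reflection_additive.
have -> : reflection i y = - (sroot i *~ t).
  by rewrite reflectionE yE copairM copair_sroot -mulrzBr -mulrNz; congr (_ *~ _); ring.
set z := weyl_elt u x.
have zE : (copair l x)%:~R = t%:~R * (copair i z)%:~R * ip i i / ip l l :> rat.
  apply: (mulIf (ip_neq0 l)); rewrite divfK ?ip_neq0 //.
  have := copairE l x; rewrite -(lform_weyl u) -/y yE -/z -[sroot i *~ t]add0r.
  rewrite lformDMl lform0l copairE; lra.
have copairE' : copair i z = t * copair l x.
  apply: (@intr_inj rat); rewrite intrM zE -tE; field; rewrite t0 ip_neq0 //.
by rewrite reflectionE -/z copairE' mulNrz mulrNz opprK -mulrzA subrK.
Qed.

Lemma reduced_weyl_sroot u l : reduced (rcons u l) ->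
  forall k, 0 <= weyl_elt u (sroot l) k.
Proof.
move=> red k; apply/negPn/negP => neg.
have [v vE uE] : exists2 v, weyl_elt v =1 weyl_elt (rcons u l) & size u = (size v).+1.
  by apply: exchange => /(_ k) h; rewrite h in neg.
by have := red _ vE; rewrite size_rcons uE ltnNge leqW.
Qed.

End Signs.

End WeylGroup.

(** * Families that q-commute as in Feigin's homomorphism *)

Section Realization.

Variables (g : simple_type) (K : fieldType) (qp : rat -> K).
Hypothesis qp0 : qp 0 = 1.
Hypothesis qpD : forall r s, qp (r + s) = qp r * qp s.
Hypothesis qp_eq1 : forall r, qp r = 1 -> r = 0.
Variable c : g -> g -> rat.
Hypothesis cP : forall i j, c i j + c j i = 2 * ip i j.
Variable lam : g -> nat.
Variable D : unitAlgType K.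

Implicit Types (i j l : g) (n : {ffun g -> int}) (f h : seq g -> K).
Implicit Types (z : g -> D) (a x y : D) (ws : seq (g * D)).

Local Notation F := (F qp c lam).
Local Notation inL := (inL qp c lam).

Definition cl j n : rat := \sum_k (n k)%:~R * c j k.
Definition cr n l : rat := \sum_k (n k)%:~R * c k l.

Lemma cl_add j n l k : cl j (n + sroot l *~ k) = cl j n + k%:~R * c j l.
Proof.
rewrite /cl -[c j l]mul1r -[1 * c j l]addr0.
rewrite [in RHS](_ : 1 * c j l + 0 = \sum_m (sroot l m)%:~R * c j m).
  rewrite mulr_sumr -big_split; apply: eq_bigr => m _ /=.
  by rewrite !ffunE ffunMzE mulrzz ffunE intrD intrM; ring.
rewrite (bigD1 l) //= ffunE eqxx big1 // => m /negPf ml.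
by rewrite ffunE ml mul0r.
Qed.

Lemma cr_add n l j k : cr (n + sroot l *~ k) j = cr n j + k%:~R * c l j.
Proof.
rewrite /cr -[c l j]mul1r -[1 * c l j]addr0.
rewrite [in RHS](_ : 1 * c l j + 0 = \sum_m (sroot l m)%:~R * c m j).
  rewrite mulr_sumr -big_split; apply: eq_bigr => m _ /=.
  by rewrite !ffunE ffunMzE mulrzz ffunE intrD intrM; ring.
rewrite (bigD1 l) //= ffunE eqxx big1 // => m /negPf ml.
by rewrite ffunE ml mul0r.
Qed.

Lemma cl_cr n l : (lam l)%:R * ip l l - cl l n - cr n l = 2 * wt lam n l.
Proof.
rewrite /wt /cl /cr -addrA -opprD -big_split /=.
rewrite (eq_bigr (fun k => 2 * ((n k)%:~R * ip k l))).
  by rewrite -mulr_sumr; field.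
by move=> k _; rewrite -mulrDr cP ip_sym; ring.
Qed.

(** Chosen so that replacing [z l] by [z l + a] in [FD] adds [1 - qp (2 * wt lam n l)] times
    [x * a], the coefficient in the commutator of [E l] and [F l] (see [cl_cr]). *)
Definition theta j n : K := qp ((lam j)%:R * ip j j - cl j n).

Definition FD z j n x : D := x * z j - theta j n *: (z j * x).

(** A relation and not a function, since one vector arises from the lowering operators in many ways.
    That its image depends only on the vector is a theorem about Feigin families,
    [realizes_uniq]. *)
Inductive realizes z : {ffun g -> int} -> (seq g -> K) -> D -> Prop :=
| realizes_vac : realizes z 0 (@vac g K) 1
| realizes_F n j f x :
    realizes z n f x -> realizes z (n + sroot j) (F j f) (FD z j n x)
| realizes_lin n b f h x y : realizes z n f x -> realizes z n h y ->
    realizes z n (fun w => b * f w + h w) (b *: x + y)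
| realizes_zero n f : vanishes f -> realizes z n f 0
| realizes_ext n f h x : realizes z n f x -> f =1 h -> realizes z n h x.

Lemma realizes_inL z n f x : realizes z n f x -> inL n f.
Proof.
elim=> {n f x} [|n j f x _|n b f h x y _ fL _|n f|n f h x _ fL fh].
- exact: inL_vac.
- exact: inL_F.
- exact: inL_lin.
- exact: inL_zero.
- exact: inL_ext fL fh.
Qed.

Lemma inL_realizes z n f : inL n f -> exists x, realizes z n f x.
Proof.
elim=> {n f} [|n j f _ [x fx]|n b f h _ [x fx] _ [y hy]|n f f0|n f h _ [x fx] fh].
- by exists 1; apply: realizes_vac.
- by exists (FD z j n x); apply: realizes_F.
- by exists (b *: x + y); apply: realizes_lin.
- by exists 0; apply: realizes_zero.
- by exists x; apply: realizes_ext fh.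
Qed.

Lemma realizes_scale z n b f x :
  realizes z n f x -> realizes z n (fun w => b * f w) (b *: x).
Proof.
move=> fx; rewrite -[b *: x]addr0.
apply: realizes_ext (realizes_lin b fx (realizes_zero z n (f := fun _ => 0) _)) _ => //.
by move=> w; rewrite addr0.
Qed.

Lemma realizes_comm z n f x a l :
  (forall j, z j * a = qp (c j l) *: (a * z j)) ->
  realizes z n f x -> x * a = qp (cr n l) *: (a * x).
Proof.
move=> za; elim=> {n f x} [|n j f x _ IH|n b f h x y _ IHx _ IHy|n f _|n f h x _ IH _] //.
- by rewrite mul1r mulr1 /cr big1 ?qp0 ?scale1r // => k _; rewrite ffunE mul0r.
- have xz : x * z j * a = qp (cr n l + c j l) *: (a * (x * z j)).
    rewrite -mulrA za -scalerAr [x * (_ * _)]mulrA IH -scalerAl scalerA mulrA.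
    by rewrite qpD [qp (c j l) * _]mulrC.
  have zx : z j * x * a = qp (cr n l + c j l) *: (a * (z j * x)).
    by rewrite -mulrA IH -scalerAr [z j * (_ * _)]mulrA za -scalerAl scalerA mulrA -qpD.
  rewrite /FD -[sroot j]mulr1z cr_add mul1r mulrBl -scalerAl xz zx.
  by rewrite mulrBr -scalerAr scalerBr !scalerA [theta _ _ * _]mulrC.
- by rewrite mulrDl mulrDr -scalerAl -scalerAr IHx IHy scalerDr !scalerA mulrC.
- by rewrite mul0r mulr0 scaler0.
Qed.

Fixpoint fsum ws j : D :=
  if ws is (l, a) :: ws' then fsum ws' j + (if l == j then a else 0) else 0.

(* The letters are listed from the last one to the first one. *)
Fixpoint feigin ws : Prop :=
  if ws is (l, a) :: ws' then
    (forall j, fsum ws' j * a = qp (c j l) *: (a * fsum ws' j)) /\ feigin ws'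
  else True.

Lemma realizes_nil n f x : realizes (fsum [::]) n f x -> x = (f [::])%:A.
Proof.
elim=> {n f x} [|n j f x _ _|n b f h x y _ -> _ ->|n f f0|n f h x _ -> fh].
- by rewrite /vac eqxx scale1r.
- by rewrite /FD mulr0 mul0r scaler0 subrr scale0r.
- by rewrite scalerDl scalerA.
- by rewrite f0 scale0r.
- by rewrite fh.
Qed.

(** * Taylor expansion in the last letter *)

Let xi l : K := qp (- ip l l).

(** The quantum factorial of [s] at [xi l]: with [N = 0], [slco] is the quantum integer. *)
Definition qfact l s : K := \prod_(k < s) slco (xi l) 0 k.+1.

Lemma qint_neq0 l s : slco (xi l) 0 s.+1 != 0.
Proof.
by rewrite (slco_eq0 qp0 qpD qp_eq1) ?oppr_eq0 ?ip_neq0 // mul0r eq_sym oner_eq0.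
Qed.

Lemma qfactS l s : qfact l s.+1 = qfact l s * slco (xi l) 0 s.+1.
Proof. by rewrite /qfact big_ord_recr. Qed.

Lemma E_iter_F l j s n f w : homogeneous n f ->
  iter s.+1 (E l) (F j f) w = qp (- c j l) ^+ s.+1 * F j (iter s.+1 (E l) f) w +
    (if j == l then slco (xi l) 0 s.+1 * (1 - qp (2 * wt lam n l + ip l l *+ s)) *
       iter s (E l) f w else 0).
Proof.
elim: s n f w => [|s IH] n f w fn.
  rewrite /= mulr0n addr0 expr1 mulr0 add0r mul0r subr0 mul1r.
  by rewrite E_F; case: eqP => // _; rewrite (hom_K _ _ _ _ fn); ring.
have E_ext k f' h' : f' =1 h' -> iter k (E l) f' =1 iter k (E l) h'.
  by elim: k => [|k IHk] fh v //=; rewrite /E IHk.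
have E_lin k b f' h' v : iter k (E l) (fun v => b * f' v + h' v) v =
    b * iter k (E l) f' v + iter k (E l) h' v.
  by elim: k v => [|k IHk] v //=; rewrite /E IHk.
have E0 k v : iter k (E l) (fun _ => 0) v = 0.
  by elim: k v => [|k IHk] v //=; rewrite /E IHk.
rewrite iterSr (E_ext _ _ (fun v => qp (- c j l) * F j (E l f) v +
   (if j == l then (1 - qp (2 * wt lam n l)) * f v + 0 else 0))); last first.
  by move=> v; rewrite E_F; case: eqP => // _; rewrite (hom_K _ _ _ _ fn); ring.
rewrite E_lin (IH _ _ _ (hom_E (l := l) fn)) -!iterSr [in RHS]exprS mulrDr mulrA -addrA.
congr (_ + _); case: (eqVneq j l) => [->|_]; last by rewrite mulr0 E0 addr0.
rewrite (E_lin s.+1 _ f (fun _ => 0)) E0 addr0 c_diag // mulrA -mulrDl.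
congr (_ * _); rewrite wtB.
have q0 := qp_neq0 qp0 qpD (ip l l).
have xE : qp (- ip l l) = (qp (ip l l))^-1 by rewrite qpN.
have xn1 : 1 - qp (- ip l l) != 0.
  by rewrite subr_eq0 eq_sym -[qp _]expr1 (qp_exp_neq1 qp0 qpD) ?oppr_eq0 ?ip_neq0.
(* Multiplying by [1 - xi l] replaces quantum integers by differences [1 - xi l ^+ k], after which
   the identity is rational in two variables. *)
apply: (mulfI xn1).
have S1 := slcoE (xi l) 0 s; rewrite mul0r subr0 mulr1 in S1.
have -> : slco (xi l) 0 s.+2 = xi l * slco (xi l) 0 s.+1 + 1.
  by rewrite [slco _ _ s.+2]/= -/(slco (xi l) 0 s.+1) mul0r subr0.
have -> : qp (2 * (wt lam n l + ip l l) + ip l l *+ s) =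
    qp (2 * wt lam n l) * qp (ip l l) ^+ 2 * qp (ip l l) ^+ s.
  by rewrite -!(qpX qp0 qpD (ip l l)) -!qpD; congr qp; ring.
have -> : qp (2 * wt lam n l + ip l l *+ s.+1) =
    qp (2 * wt lam n l) * qp (ip l l) * qp (ip l l) ^+ s.
  by rewrite -(qpX qp0 qpD (ip l l)) -!qpD; congr qp; ring.
rewrite /xi in S1 *; set S := slco _ _ _ in S1 *.
set x := qp (- ip l l) in xE S1 *; set u := 1 - _ * _ ^+ 2 * _; set v := 1 - _ * _ * _.
have -> : (1 - x) * (x * (S * u) + (1 - qp (2 * wt lam n l))) =
    x * ((1 - x) * S) * u + (1 - x) * (1 - qp (2 * wt lam n l)) by ring.
have -> : (1 - x) * ((x * S + 1) * v) = (x * ((1 - x) * S) + (1 - x)) * v by ring.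
rewrite S1 /u /v.
rewrite exprS xE exprVn; set y := qp (ip l l) ^+ s.
by have y0 : y != 0 := expf_neq0 s q0; field; rewrite y0 q0.
Qed.

Lemma qcomm_exp z a l j s : z j * a = qp (c j l) *: (a * z j) ->
  a ^+ s * z j = qp (- c j l) ^+ s *: (z j * a ^+ s).
Proof.
move=> za; elim: s => [|s IH]; first by rewrite !expr0 mul1r mulr1 scale1r.
have az : a * z j = qp (- c j l) *: (z j * a).
  by rewrite za scalerA -qpD addNr qp0 scale1r.
rewrite exprSr -mulrA az -scalerAr [a ^+ s * (_ * _)]mulrA IH -scalerAl scalerA -exprS.
by rewrite mulrA.
Qed.

Lemma FD0 z j n : FD z j n 0 = 0.
Proof. by rewrite /FD mul0r mulr0 scaler0 subr0. Qed.

Lemma sum_ord_widen (B B' : nat) (G : nat -> D) : (B <= B')%N ->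
  (forall s, (B <= s)%N -> G s = 0) -> \sum_(s < B') G s = \sum_(s < B) G s.
Proof.
move=> BB G0; rewrite (big_ord_widen _ G BB) [RHS]big_mkcond /=.
by apply: eq_bigr => s _; case: ltnP => // /G0.
Qed.

(** The [s]-th divided coefficient in the last letter is the image, for the shorter word, of [E l]
    applied [s] times. The powers of [a] obey under [FD] the same recursion as [E_iter_F], so the
    raising operator acts as a quantum derivative in [a]. The bound [B] makes the sum finite. *)
Lemma realizes_taylor ws l a n f x :
  (forall j, fsum ws j * a = qp (c j l) *: (a * fsum ws j)) ->
  realizes (fsum ((l, a) :: ws)) n f x ->
  exists (B : nat) (xs : nat -> D), [/\ forall s, (B <= s)%N -> xs s = 0,
    forall s, realizes (fsum ws) (n - sroot l *+ s) (iter s (E l) f) (xs s) &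
    x = \sum_(s < B) (qfact l s)^-1 *: (xs s * a ^+ s)].
Proof.
move=> za; elim=> {n f x}.
- exists 1%N, (fun s => if s is 0 then 1 else 0); split; first by case.
    case=> [|s]; first by rewrite mulr0n subr0; apply: realizes_vac.
    by apply: realizes_zero => w /=; elim: s w => [//|s IH] w; apply: IH.
  by rewrite big_ord1 /qfact big_ord0 expr0 mulr1 invr1 scale1r.
- move=> n j f x fx [B [xs [xB fxs ->]]].
  have fh := inL_hom (realizes_inL fx).
  pose cf s := slco (xi l) 0 s.+1 * (1 - qp (2 * wt lam n l + ip l l *+ s)).
  (* These coefficients are dictated by [E_iter_F]. *)
  pose ys s := qp (- c j l) ^+ s *: FD (fsum ws) j (n - sroot l *+ s) (xs s) +
    (if s is s'.+1 then if l == j then cf s' *: xs s' else 0 else 0).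
  exists B.+1, ys; split.
  + move=> [//|s] Bs; rewrite /ys !xB ?FD0 ?scaler0 ?if_same ?addr0 //; exact: leqW.
  + move=> s; rewrite /ys.
    have Fs : realizes (fsum ws) (n + sroot j - sroot l *+ s) (F j (iter s (E l) f))
        (FD (fsum ws) j (n - sroot l *+ s) (xs s)).
      by rewrite addrAC; apply: realizes_F.
    case: s Fs => [|s] Fs.
      by rewrite expr0 scale1r addr0.
    apply: realizes_ext _ (fun w => esym (E_iter_F l j s w fh)).
    apply: realizes_lin => //; rewrite eq_sym.
    have [->|lj] := eqVneq j l; last exact: realizes_zero.
    rewrite mulrSr opprD addrACA addrN addr0.
    exact: realizes_scale.
  (* [A] collects what the shorter word contributes to [FD], and [R] what the last letter
     contributes; the latter raises the power of [a] by one, hence the shift of index below. *)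
  + pose A s := (qfact l s)^-1 *:
      (qp (- c j l) ^+ s *: FD (fsum ws) j (n - sroot l *+ s) (xs s) * a ^+ s).
    pose R s := if l == j then
      (qfact l s)^-1 *: ((1 - qp (2 * wt lam n l + ip l l *+ s)) *: (xs s * a ^+ s.+1))
      else 0.
    transitivity (\sum_(s < B.+1) A s + \sum_(s < B) R s).
      rewrite big_ord_recr {2}/A /= xB // FD0 scaler0 mul0r scaler0 addr0 -big_split /=.
      rewrite /FD mulr_suml mulr_sumr scaler_sumr -sumrB; apply: eq_bigr => s _.
      have xa := realizes_comm za (fxs s).
      have := qcomm_exp s (za j); rewrite /A /R /=.
      set y := xs s in xa *; set k := _^-1 => az.
      have thE : qp (- c j l) ^+ s * theta j (n - sroot l *+ s) = theta j n.
        rewrite /theta -(qpX qp0 qpD) -qpD; congr qp.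
        by rewrite [sroot l *+ s]pmulrn -mulrNz cl_add; ring.
      rewrite mulrDr mulrDl scalerDr opprD addrACA; congr (_ + _).
        rewrite -!scalerAl -scalerAr -mulrA az -scalerAr mulrBl scalerBr -!scalerAl.
        rewrite !scalerBr !scalerA !mulrA; congr (_ - _ *: _).
        by rewrite -mulrA thE mulrC.
      case: (eqVneq l j) => [lj|_]; last by rewrite mulr0 mul0r scaler0 subrr.
      rewrite -scalerAl -scalerAr -mulrA -exprSr [a * _]mulrA.
      have -> : a * y = qp (- cr (n - sroot l *+ s) l) *: (y * a).
        by rewrite xa scalerA -qpD addNr qp0 scale1r.
      rewrite -scalerAl -mulrA -exprS !scalerA -scalerBl; congr (_ *: _).
      rewrite mulrBr mulr1 [theta _ _ * _]mulrC -mulrA -qpD -cl_cr -lj.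
      congr (_ - _ * qp _).
      by rewrite [sroot l *+ s]pmulrn -mulrNz cr_add c_diag //; ring.
    rewrite [in RHS](eq_bigr (fun s : 'I_B.+1 => A s + (qfact l s)^-1 *: ((if nat_of_ord s is s'.+1 then
        if l == j then cf s' *: xs s' else 0 else 0) * a ^+ s))); last first.
      by move=> s _; rewrite /ys mulrDl scalerDr.
    rewrite big_split [X in _ = _ + X]big_ord_recl /= mul0r scaler0 add0r; congr (_ + _).
    apply: eq_bigr => s _; rewrite /R add0n.
    case: eqP => _; last by rewrite mul0r scaler0.
    by rewrite -scalerAl !scalerA /cf qfactS invfM -mulrA mulKf ?qint_neq0.
- move=> n b f h x y _ [B [xs [xB fxs ->]]] _ [B' [ys [yB hys ->]]].
  exists (maxn B B'), (fun s => b *: xs s + ys s); split.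
  + by move=> s; rewrite geq_max => /andP[/xB-> /yB->]; rewrite scaler0 addr0.
  + move=> s; apply: realizes_ext (realizes_lin b (fxs s) (hys s)) _ => w.
    by elim: s w => [//|s IH] w; apply: IH.
  + rewrite -(sum_ord_widen (G := fun s => (qfact l s)^-1 *: (xs s * a ^+ s)) (leq_maxl B B'));
      last by move=> s /xB->; rewrite mul0r scaler0.
    rewrite -(sum_ord_widen (G := fun s => (qfact l s)^-1 *: (ys s * a ^+ s)) (leq_maxr B B'));
      last by move=> s /yB->; rewrite mul0r scaler0.
    rewrite scaler_sumr -big_split; apply: eq_bigr => s _ /=.
    by rewrite mulrDl scalerDr -scalerAl !scalerA mulrC.
- move=> n f f0; exists 0%N, (fun _ => 0); split=> //; last by rewrite big_ord0.
  by move=> s; apply: realizes_zero; elim: s => [//|s IH] w; apply: IH.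
- move=> n f h x _ [B [xs [xB fxs ->]]] fh; exists B, xs; split=> // s.
  by apply: realizes_ext (fxs s) _; elim: s => [//|s IH] w; apply: IH.
Qed.

(** All Taylor coefficients are images of zero vectors for a shorter word. For the empty word the
    image is the coefficient of the vector at the empty word. *)
Lemma realizes_vanish ws n f x : feigin ws -> realizes (fsum ws) n f x ->
  vanishes f -> x = 0.
Proof.
elim: ws n f x => [|[l a] ws IH] n f x /=.
  by move=> _ /realizes_nil-> ->; rewrite scale0r.
move=> [za fws] /(realizes_taylor za)[B [xs [_ fxs ->]]] f0.
apply: big1 => s _; rewrite (IH _ _ _ fws (fxs s)) ?mul0r ?scaler0 //.
by elim: {xs fxs} (nat_of_ord s) => [//|k IHk] w; apply: IHk.
Qed.

Lemma realizes_uniq ws n f x y : feigin ws -> realizes (fsum ws) n f x ->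
  realizes (fsum ws) n f y -> x = y.
Proof.
move=> fws fx fy; apply/eqP; rewrite -subr_eq0 addrC -scaleN1r; apply/eqP.
by apply: (realizes_vanish fws (realizes_lin (-1) fy fx)) => w; ring.
Qed.

(** Only the constant Taylor coefficient survives, so the new letter is invisible. *)
Lemma realizes_extend ws l a n f x : feigin ((l, a) :: ws) -> vanishes (E l f) ->
  realizes (fsum ws) n f x -> realizes (fsum ((l, a) :: ws)) n f x.
Proof.
move=> /= [za fws] Ef0 fx.
have [y fy] := inL_realizes (fsum ((l, a) :: ws)) (realizes_inL fx).
have [B [xs [xB fxs yE]]] := realizes_taylor za fy.
have xs0 s : xs s.+1 = 0.
  apply: (realizes_vanish fws (fxs s.+1)).
  by elim: s {fxs} => [|s IH] w; [apply: Ef0|apply: IH].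
suff <- : y = x by [].
rewrite (realizes_uniq fws fx (y := xs 0%N)); last first.
  by have := fxs 0%N; rewrite mulr0n subr0.
rewrite yE; case: B xB {yE} => [|B] xB; first by rewrite big_ord0 xB.
rewrite big_ord_recl big1 => [|s _]; last by rewrite /= xs0 mul0r scaler0.
by rewrite expr0 mulr1 addr0 /qfact big_ord0 invr1 scale1r.
Qed.

Lemma realizes_fixed (mu : {lrmorphism D -> D}) z n f x :
  (forall j, mu (z j) = z j) -> realizes z n f x -> mu x = x.
Proof.
have muZ b y : mu (b *: y) = b *: mu y by exact: linearZ.
move=> muz; elim=> {n f x} [|n j f x _ IH|n b f h x y _ IHx _ IHy|n f _|//].
- exact: rmorph1.
- by rewrite /FD rmorphB /= muZ !rmorphM /= IH muz.
- by rewrite rmorphD /= muZ IHx IHy.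
- exact: rmorph0.
Qed.

(** * Images of extremal vectors and recovery of the letters *)

Lemma unitr_scale b x : b != 0 -> x \is a GRing.unit -> b *: x \is a GRing.unit.
Proof.
move=> b0 xU; apply/unitrP; exists (b^-1 *: x^-1).
by rewrite -!scalerAl -!scalerAr !scalerA (mulVr xU) (mulrV xU) mulVf // mulfV // !scale1r.
Qed.

Lemma theta_add j n l k : theta j (n + sroot l *+ k) = theta j n * qp (- c j l) ^+ k.
Proof.
rewrite /theta -(qpX qp0 qpD) -qpD; congr qp.
by rewrite [sroot l *+ k]pmulrn cl_add; ring.
Qed.

(** Because [x] commutes with the shorter sums by exactly [theta], these drop out of [FD]. Each
    lowering just multiplies by [a], with factor [1 - qp (ip l l) ^+ (m - k)], nonzero before the
    end of the string. *)
Lemma realizes_string ws l a n f x m : feigin ((l, a) :: ws) ->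
  realizes (fsum ws) n f x -> realizes (fsum ((l, a) :: ws)) n f x ->
  (forall j, x * fsum ws j = theta j n *: (fsum ws j * x)) -> cowt lam n l = m%:Z ->
  forall k, (k <= m)%N -> exists2 b, b != 0 &
    realizes (fsum ((l, a) :: ws)) (n + sroot l *+ k) (iter k (F l) f) (b *: (x * a ^+ k)).
Proof.
move=> /= [za fws] fx fx' xz nm; elim=> [|k IH] km.
  by exists 1; rewrite ?oner_eq0 // mulr0n addr0 scale1r expr0 mulr1.
have [b b0 fk] := IH (ltnW km).
exists (b * (1 - qp (ip l l) ^+ (m - k))).
  rewrite mulf_neq0 // subr_eq0 eq_sym -(subnSK km).
  by rewrite (qp_exp_neq1 qp0 qpD) ?ip_neq0.
have := realizes_F l fk; rewrite mulrSr addrA iterS; congr realizes.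
have xa := realizes_comm za fx.
have az := qcomm_exp k (za l).
rewrite /FD -scalerAl -scalerAr scalerA mulrC -scalerA -scalerBr -scalerA.
congr (_ *: _); rewrite mulrDr mulrDl eqxx scalerDr opprD addrACA.
have -> : x * a ^+ k * fsum ws l =
    theta l (n + sroot l *+ k) *: (fsum ws l * (x * a ^+ k)).
  rewrite -mulrA az -scalerAr [x * (_ * _)]mulrA xz -scalerAl scalerA mulrA.
  by rewrite theta_add mulrC.
rewrite subrr add0r [a * _]mulrA.
have -> : a * x = qp (- cr n l) *: (x * a) by rewrite xa scalerA -qpD addNr qp0 scale1r.
rewrite -scalerAl scalerA -!mulrA -exprSr -exprS -[X in X - _]scale1r -scalerBl.
congr ((1 - _) *: _); rewrite theta_add c_diag // mulrAC -qpD cl_cr wt_cowt nm.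
rewrite -!(qpX qp0 qpD) -qpD; congr qp.
by rewrite mulrnBr ?(ltnW km) // -pmulrn; field.
Qed.

(** Otherwise moving the weight of [E l f] back by [rev w] would give a weight strictly above the
    highest one. *)
Lemma extremal_E w l f : (forall k, 0 <= weyl_elt (rev w) (sroot l) k) ->
  inL (affw lam w 0) f -> vanishes (E l f).
Proof.
move=> wpos fL; apply: NNPP => nE; set y := weyl_elt _ _ in wpos.
have /(is_weight_affw qp0 qpD qp_eq1 (rev w) cP) :
    is_weight qp c lam (affw lam w 0 + sroot l *~ (-1)).
  by exists (E l f) => //; rewrite mulrNz mulr1z; apply: inL_E.
rewrite affwD affw_revK add0r mulrNz mulr1z -/y => yneg.
have /eqP : y = 0.
  apply/ffunP => k; apply/eqP; rewrite ffunE eq_le wpos andbT.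
  by have := is_weight_ge0 k yneg; rewrite ffunE oppr_ge0.
by rewrite (negPf (weyl_sroot_neq0 _ _)).
Qed.

(** What reducedness of [rev w] provides letter by letter; the list runs from the last letter to the
    first. *)
Fixpoint positive_word (w : seq g) : Prop :=
  if w is l :: w' then
    (forall k, 0 <= weyl_elt (rev w') (sroot l) k) /\ positive_word w'
  else True.

(** Up to the factor (alpha_l, alpha_l) / 2 this is the inner product of rho with a positive root,
    hence positive because rho is positive on every simple root. *)
Lemma cowt_gt0 w l : (forall i, lam i = 1%N) ->
  (forall k, 0 <= weyl_elt (rev w) (sroot l) k) ->
  exists2 m, (0 < m)%N & cowt lam (affw lam w 0) l = m%:Z.
Proof.
move=> lam1 wpos; set n := affw lam w 0.
suff h : 0 < cowt lam n l by exists `|cowt lam n l|%N; lia.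
rewrite -(@ltr0z rat) -(pmulr_lgt0 _ (_ : 0 < ip l l / 2)) ?divr_gt0 ?ip_gt0 //.
have := lamform_weyl lam w (sroot l); rewrite lamform_sroot lform_sym copairE -/n.
rewrite mulrA /cowt intrD mulrNz -pmulrn !mulrBl => <-.
rewrite /lamform; set y := weyl_elt _ _ in wpos *.
have [k yk] : exists k, y k != 0.
  apply: NNPP => h; have /eqP := weyl_sroot_neq0 (rev w) l; apply.
  apply/ffunP => k; rewrite ffunE; apply/eqP/negPn/negP => yk.
  by apply: h; exists k.
have ge0 j : 0 <= (y j)%:~R * ((lam j)%:R * ip j j / 2).
  by rewrite mulr_ge0 ?ler0z ?lam1 ?mul1r ?divr_ge0 // ltW ?ip_gt0.
rewrite (bigD1 k) //= ltr_wpDr ?sumr_ge0 // lam1 mul1r.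
by rewrite mulr_gt0 ?divr_gt0 ?ip_gt0 // ltr0z lt_neqAle eq_sym yk wpos.
Qed.

(* [f] is the extremal vector of weight [w^-1 lam]. *)
Lemma extremal ws : (forall i, lam i = 1%N) -> feigin ws ->
  (forall p, p \in ws -> p.2 \is a GRing.unit) -> positive_word (map fst ws) ->
  exists f x, [/\ realizes (fsum ws) (affw lam (map fst ws) 0) f x,
    x \is a GRing.unit &
    forall j, x * fsum ws j = theta j (affw lam (map fst ws) 0) *: (fsum ws j * x)].
Proof.
move=> lam1; elim: ws => [|[l a] ws IH].
  move=> _ _ _; exists (@vac g K), 1; split; [exact: realizes_vac|exact: unitr1|].
  by move=> j; rewrite mulr0 mul0r scaler0.
move=> fws aU [lpos wpos].
have [||f [x [fx xU xz]]] := IH _ _ wpos; first by case: fws.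
  by move=> p pws; apply: aU; rewrite in_cons pws orbT.
have fx' := realizes_extend fws (extremal_E lpos (realizes_inL fx)) fx.
have [m m0 nm] := cowt_gt0 lam1 lpos.
have [b b0 fm] := realizes_string fws fx fx' xz nm (leqnn m).
set n := affw lam _ 0 in nm xz fm fx.
exists (iter m (F l) f), (b *: (x * a ^+ m)).
have nE : affw lam (map fst ((l, a) :: ws)) 0 = n + sroot l *+ m.
  by rewrite /= /affr -/n nm -pmulrn.
have aU' : a \is a GRing.unit by apply: (aU (l, a)); rewrite mem_head.
rewrite nE; split=> //; first by apply: unitr_scale => //; rewrite unitrMr ?unitrX.
move=> j; have [za _] := fws.
rewrite -scalerAl -scalerAr scalerA [_ * b]mulrC -scalerA; congr (_ *: _) => /=.
rewrite mulrDr mulrDl scalerDr; congr (_ + _).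
  rewrite -mulrA (qcomm_exp _ (za j)) -scalerAr [x * (_ * _)]mulrA xz -scalerAl.
  by rewrite scalerA mulrA theta_add mulrC.
case: (eqVneq l j) => [<-|_]; last by rewrite mulr0 mul0r scaler0.
rewrite -mulrA -exprSr exprS mulrA (realizes_comm za fx) -scalerAl -mulrA.
congr (_ *: _); rewrite theta_add c_diag // /theta -(qpX qp0 qpD) -qpD; congr qp.
have := cl_cr n l; rewrite wt_cowt nm -pmulrn mulNrn -[ip l l *+ m]mulr_natl; lra.
Qed.

Lemma feigin_fixed ws (mu : {lrmorphism D -> D}) : (forall i, lam i = 1%N) ->
  feigin ws -> (forall p, p \in ws -> p.2 \is a GRing.unit) ->
  positive_word (map fst ws) -> (forall j, mu (fsum ws j) = fsum ws j) ->
  forall p, p \in ws -> mu p.2 = p.2.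
Proof.
have muZ b y : mu (b *: y) = b *: mu y by exact: linearZ.
move=> lam1; elim: ws => [//|[l a] ws IH] fws aU [lpos wpos] muE.
have fws' : feigin ws by case: fws.
have aU' p : p \in ws -> p.2 \is a GRing.unit.
  by move=> pws; apply: aU; rewrite in_cons pws orbT.
have [f [x [fx xU xz]]] := extremal lam1 fws' aU' wpos.
have fx' := realizes_extend fws (extremal_E lpos (realizes_inL fx)) fx.
have [m m0 nm] := cowt_gt0 lam1 lpos.
have [b b0 fm] := realizes_string fws fx fx' xz nm (leqnn m).
have mux := realizes_fixed muE fx'.
have aun : a \is a GRing.unit by apply: (aU (l, a)); rewrite mem_head.
have mua_m : mu (a ^+ m) = a ^+ m.
  have := realizes_fixed muE fm; rewrite muZ => /(scalerI b0).
  by rewrite rmorphM /= mux => /(mulrI xU).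
have [za _] := fws.
set r := qp (- c l l) ^+ m.
have r1 : 1 - r != 0.
  by rewrite subr_eq0 eq_sym /r -(prednK m0) (qp_exp_neq1 qp0 qpD) ?oppr_eq0 ?c_diag ?ip_neq0.
(* The terms of the shorter word pass [a ^+ m] with the factor [r] and cancel, whereas [a] commutes
   with its power. As [m > 0], [r] is not 1. *)
have aE : (1 - r) *: (a * a ^+ m) =
    a ^+ m * fsum ((l, a) :: ws) l - r *: (fsum ((l, a) :: ws) l * a ^+ m).
  rewrite /= eqxx mulrDr mulrDl scalerDr (qcomm_exp m (za l)) -/r opprD addrACA.
  by rewrite subrr add0r -exprS -exprSr scalerBl scale1r.
have mua : mu a = a.
  have := congr1 mu aE; rewrite muZ rmorphB /= muZ !rmorphM /= mua_m muE -aE.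
  by move=> /(scalerI r1)/(mulIr (unitrX m aun)).
move=> p; rewrite in_cons => /orP[/eqP->//|]; apply: IH => // j.
have := muE j; rewrite /= rmorphD /=; case: eqP => _; last by rewrite rmorph0 !addr0.
by rewrite mua => /addIr.
Qed.

End Realization.

(** * Quantum tori and mutations *)

Section LatticeForm.

Variable Q : seed.
Implicit Types (x y z : {ffun vertex Q -> int}) (u v : vertex Q).

Lemma lattice_form_skew x y : lattice_form x y = - lattice_form y x.
Proof.
rewrite /lattice_form exchange_big -sumrN; apply: eq_bigr => u _.
by rewrite -sumrN; apply: eq_bigr => v _; rewrite weight_skew; ring.
Qed.

Lemma lattice_formDl x y z : lattice_form (x + y) z = lattice_form x z + lattice_form y z.
Proof.
rewrite /lattice_form -big_split; apply: eq_bigr => u _ /=.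
by rewrite -big_split; apply: eq_bigr => v _ /=; rewrite ffunE intrD; ring.
Qed.

Lemma lattice_formDr x y z : lattice_form z (x + y) = lattice_form z x + lattice_form z y.
Proof. by rewrite lattice_form_skew lattice_formDl opprD -!lattice_form_skew. Qed.

Lemma lattice_form0l x : lattice_form 0 x = 0.
Proof. by apply: (addrI (lattice_form 0 x)); rewrite -lattice_formDl !addr0. Qed.

Lemma lattice_form0r x : lattice_form x 0 = 0.
Proof. by rewrite lattice_form_skew lattice_form0l oppr0. Qed.

Lemma lattice_formNl x y : lattice_form (- x) y = - lattice_form x y.
Proof.
by apply: (addrI (lattice_form x y)); rewrite -lattice_formDl !subrr lattice_form0l.
Qed.

Lemma lattice_formNr x y : lattice_form x (- y) = - lattice_form x y.
Proof. by rewrite lattice_form_skew lattice_formNl -lattice_form_skew. Qed.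

Lemma lattice_form_xx x : lattice_form x x = 0.
Proof. by have := lattice_form_skew x x; lra. Qed.

Lemma lattice_form_basisl v x :
  lattice_form (basis_vec v) x = \sum_u (x u)%:~R * weight v u.
Proof.
rewrite /lattice_form (bigD1 v) //= [X in _ + X]big1 ?addr0 => [|u /negPf uv].
  by apply: eq_bigr => u _; rewrite ffunE eqxx mul1r.
by rewrite big1 // => s _; rewrite ffunE uv !mul0r.
Qed.

Lemma lattice_form_basis u v : lattice_form (basis_vec u) (basis_vec v) = weight u v.
Proof.
rewrite lattice_form_basisl (bigD1 v) //= big1 ?addr0 => [|s /negPf sv].
  by rewrite ffunE eqxx mul1r.
by rewrite ffunE sv mul0r.
Qed.

End LatticeForm.

(** * Quantum tori and a normal form for mutated monomials *)

Section QuantumTorus.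

Variables (K : fieldType) (qpow : rat -> K).
Hypothesis q0 : qpow 0 = 1.
Hypothesis qD : forall r s, qpow (r + s) = qpow r * qpow s.
Hypothesis q1 : forall r, qpow r = 1 -> r = 0.

Lemma qpow_inj r s : qpow r = qpow s -> r = s.
Proof.
move=> h; apply/eqP; rewrite -subr_eq0; apply/eqP/q1.
by rewrite qD h -qD subrr.
Qed.

Lemma qpow_neq0 r : qpow r != 0.
Proof. exact: qp_neq0. Qed.

Section OneTorus.

Variables (Q : seed) (T : quantum_field qpow Q).
Implicit Types (x y z : {ffun vertex Q -> int}) (u v : vertex Q).

Lemma qX_mul x y : qX T x * qX T y = qpow (- lattice_form x y) *: qX T (x + y).
Proof. by rewrite -qXM scalerA -qD addNr q0 scale1r. Qed.

Lemma qX_comm x y : qX T x * qX T y = qpow (- (2 * lattice_form x y)) *: (qX T y * qX T x).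
Proof.
rewrite !qX_mul [y + x]addrC scalerA -qD; congr (qpow _ *: _).
by rewrite [lattice_form y x]lattice_form_skew; ring.
Qed.

Lemma qX_mulN x : qX T x * qX T (- x) = 1.
Proof. by rewrite qX_mul lattice_formNr lattice_form_xx !oppr0 q0 scale1r subrr qX0. Qed.

Lemma qX_mulNl x : qX T (- x) * qX T x = 1.
Proof. by rewrite -{2}[x]opprK qX_mulN. Qed.

Lemma qX_unit x : qX T x \is a GRing.unit.
Proof. by apply/unitrP; exists (qX T (- x)); rewrite qX_mulN qX_mulNl. Qed.

Lemma qXN x : qX T (- x) = (qX T x)^-1.
Proof. by apply: (mulrI (qX_unit x)); rewrite qX_mulN mulrV ?qX_unit. Qed.

Lemma qX_exp x k : qX T x ^+ k = qX T (x *+ k).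
Proof.
elim: k => [|k IH]; first by rewrite expr0 mulr0n qX0.
rewrite exprS IH qX_mul mulrS; suff -> : lattice_form x (x *+ k) = 0 by rewrite oppr0 q0 scale1r.
elim: k {IH} => [|k IH]; first by rewrite mulr0n lattice_form0r.
by rewrite mulrS lattice_formDr lattice_form_xx IH addr0.
Qed.

End OneTorus.

Section Morphism.

Variables (Q Q' : seed) (T : quantum_field qpow Q) (T' : quantum_field qpow Q').
Variable f : {lrmorphism T' -> T}.

Lemma lrZ b a : f (b *: a) = b *: f a.
Proof. exact: linearZ. Qed.

(* The form on the source lattice is read off the commutation of the images. *)
Lemma morphism_qX_add x y A B r : f (qX T' x) = A -> f (qX T' y) = B ->
  A * B = qpow (- (2 * r)) *: (B * A) -> f (qX T' (x + y)) = qpow r *: (A * B).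
Proof.
move=> fx fy AB; suff <- : lattice_form x y = r by rewrite -qXM lrZ rmorphM /= fx fy.
have := congr1 f (qX_comm T' x y); rewrite lrZ !rmorphM /= fx fy AB => /eqP.
rewrite -subr_eq0 -scalerBl scaler_eq0 => /orP[|/eqP BA].
  by rewrite subr_eq0 => /eqP/qpow_inj; lra.
have : B * A \is a GRing.unit by rewrite unitrMl -?fx -?fy ?rmorph_unit ?qX_unit.
by rewrite BA unitr0.
Qed.

Lemma morphism_qXN x : f (qX T' (- x)) = (f (qX T' x))^-1.
Proof. by rewrite qXN rmorphV ?qX_unit. Qed.

End Morphism.

Lemma relabeling_sum (Q Q' : seed) (sigma : vertex Q -> vertex Q') (T : quantum_field qpow Q)
    (T' : quantum_field qpow Q') (f : {lrmorphism T' -> T}) (vs : seq (vertex Q)) :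
  is_relabeling sigma f ->
  f (qX T' (\sum_(v <- vs) basis_vec (sigma v))) = qX T (\sum_(v <- vs) basis_vec v).
Proof.
move=> fs; elim: vs => [|v vs IH]; first by rewrite !big_nil !qX0 rmorph1.
rewrite !big_cons (morphism_qX_add (fs v) IH (qX_comm _ _ _)).
by rewrite /qXv qXM.
Qed.

Section Mutation.

Variables (Q : seed) (k : vertex Q) (T : quantum_field qpow Q).
Variables (T' : quantum_field qpow (mutate k)) (m : {lrmorphism T' -> T}).
Hypothesis mP : is_quantum_mutation m.
Implicit Types (x y z : {ffun vertex Q -> int}) (u v : vertex Q).

Let X : T := qX T (basis_vec k).
Let d : rat := mult k.

Let d0 : d != 0.
Proof. by rewrite gt_eqF // mult_gt0. Qed.

Definition phi (s : int) : T := 1 + qpow (d * s%:~R) *: X.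

Lemma phi_comm s t : GRing.comm (phi s) (phi t).
Proof.
have XX : GRing.comm (qpow (d * s%:~R) *: X) (qpow (d * t%:~R) *: X).
  by rewrite /GRing.comm -!scalerAl -!scalerAr !scalerA mulrC.
apply: commrD (commr1 _) (commr_sym _); exact: commrD (commr1 _) (commr_sym XX).
Qed.

(** Nonzero because monomials are linearly independent, hence invertible in the division algebra. *)
Lemma phi_unit s : phi s \is a GRing.unit.
Proof.
apply: q_unit; apply/eqP => h; pose b x := if x == 0 then 1 else qpow (d * s%:~R).
have ek0 : basis_vec k != 0 :> {ffun vertex Q -> int}.
  by apply/eqP => /ffunP/(_ k); rewrite !ffunE eqxx.
have := @qX_free _ _ _ T [:: 0; basis_vec k] b; rewrite big_cons big_seq1 /=.
rewrite inE eq_sym ek0 /b eqxx (negPf ek0) qX0 scale1r => /(_ erefl h 0).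
by rewrite mem_head eqxx => /(_ erefl)/eqP; rewrite oner_eq0.
Qed.

(* With [x = X k] and [q = q_k], this is the product of the [1 + q^s x] for [s] odd
   between [t] and [t + 2 n], inverted for [n < 0]. *)
Definition Phi (t n : int) : T :=
  match n with
  | Posz a => \prod_(r < a) phi (t + 2 * r%:Z + 1)
  | Negz a => \prod_(r < a.+1) (phi (t - 2 * r%:Z - 1))^-1
  end.

Lemma Phi0 t : Phi t 0 = 1.
Proof. exact: big_ord0. Qed.

Lemma PhiS t n : Phi t (n + 1) = Phi t n * phi (t + 2 * n + 1).
Proof.
case: n => [a|[|a]].
- by rewrite (_ : Posz a + 1 = a.+1) ?[LHS]big_ord_recr //; lia.
- rewrite (_ : Negz 0 + 1 = 0) // Phi0 /Phi big_ord1 (_ : _ - 1 = t + 2 * Negz 0 + 1).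
    by rewrite mulVr ?phi_unit.
  by rewrite NegzE /= mulr0; lia.
- rewrite (_ : Negz a.+1 + 1 = Negz a); last by rewrite !NegzE; lia.
  rewrite [in RHS]/Phi big_ord_recr /= (_ : t - _ - 1 = t + 2 * Negz a.+1 + 1).
    by rewrite divrK ?phi_unit.
  by rewrite NegzE; lia.
Qed.

Lemma PhiB t n : Phi t (n - 1) = Phi t n * (phi (t + 2 * n - 1))^-1.
Proof.
rewrite -{2}[n](subrK 1) PhiS (_ : _ + 1 = t + 2 * n - 1) ?mulrK ?phi_unit //.
lia.
Qed.

Lemma Phi1 t : Phi t 1 = phi (t + 1).
Proof. by rewrite -[1]add0r PhiS Phi0 mul1r mulr0 addr0. Qed.

Lemma Phi2 t : Phi t 2 = phi (t + 1) * phi (t + 3).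
Proof. by rewrite (_ : Phi t 2 = Phi t (1 + 1)) // PhiS Phi1; congr (_ * phi _); lia. Qed.

Lemma PhiN1 t : Phi t (-1) = (phi (t - 1))^-1.
Proof. by rewrite -[-1]add0r PhiB Phi0 mul1r mulr0 addr0. Qed.

Lemma PhiN2 t : Phi t (-2) = (phi (t - 3) * phi (t - 1))^-1.
Proof.
rewrite (_ : Phi t (-2) = Phi t (-1 - 1)) // PhiB PhiN1 invrM ?phi_unit //.
by congr (_ * (phi _)^-1); lia.
Qed.

Lemma int_updown (P : int -> Prop) : P 0 -> (forall n, P n -> P (n + 1)) ->
  (forall n, P n -> P (n - 1)) -> forall n, P n.
Proof.
move=> P0 Pu Pd; elim/int_rect => [//|n Pn|n Pn].
  by rewrite intS addrC; apply: Pu.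
by rewrite intS opprD addrC; apply: Pd.
Qed.

Lemma phi_Phi s t n : GRing.comm (phi s) (Phi t n).
Proof.
elim/int_updown: n => [|n IH|n IH]; rewrite ?Phi0 ?PhiS ?PhiB; first exact: commr1.
  exact: commrM IH (phi_comm _ _).
exact: commrM IH (commrV (phi_comm _ _)).
Qed.

(** Adjacent ranges of odd exponents concatenate; for opposite signs the common factors cancel. *)
Lemma Phi_cocycle t n l : Phi (t + 2 * l) n * Phi t l = Phi t (n + l).
Proof.
elim/int_updown: n => [|n IH|n IH]; first by rewrite Phi0 mul1r add0r.
  rewrite addrAC !PhiS -IH -!mulrA phi_Phi; congr (_ * (_ * phi _)); lia.
rewrite addrAC !PhiB -IH -!mulrA (commr_sym (commrV (commr_sym (phi_Phi _ _ _)))).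
by congr (_ * (_ * (phi _)^-1)); lia.
Qed.

Lemma phi_shift s y (p : int) : lattice_form (basis_vec k) y = d * p%:~R ->
  phi s * qX T y = qX T y * phi (s - 2 * p).
Proof.
move=> yp; rewrite /phi mulrDl mulrDr mul1r mulr1; congr (_ + _).
rewrite -scalerAl -scalerAr qX_comm scalerA -qD yp; congr (qpow _ *: _).
by rewrite intrD mulrNz intrM; ring.
Qed.

Lemma Phi_shift t n y (p : int) : lattice_form (basis_vec k) y = d * p%:~R ->
  Phi t n * qX T y = qX T y * Phi (t - 2 * p) n.
Proof.
move=> yp; elim/int_updown: n => [|n IH|n IH]; rewrite ?Phi0 ?mul1r ?mulr1 //.
  by rewrite !PhiS -mulrA (phi_shift _ yp) mulrA IH -mulrA; congr (_ * (_ * phi _)); lia.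
rewrite !PhiB -mulrA.
have -> : (phi (t + 2 * n - 1))^-1 * qX T y = qX T y * (phi (t - 2 * p + 2 * n - 1))^-1.
  apply: (mulrI (phi_unit (t + 2 * n - 1))); rewrite mulVKr ?phi_unit // mulrA.
  rewrite (phi_shift _ yp) (_ : t + 2 * n - 1 - 2 * p = t - 2 * p + 2 * n - 1); last lia.
  by rewrite mulrK ?phi_unit.
by rewrite mulrA IH mulrA.
Qed.

(** A normal form, a monomial times consecutive factors whose number is fixed by the pairing of [y']
    with the mutated vertex. The single integer [p] is then additive under multiplication of
    monomials. *)
Definition mutates y y' (p : int) :=
  m (qX T' y) = qX T y' * Phi 0 (- p) /\ lattice_form (basis_vec k) y' = d * p%:~R.

Lemma mutates_add y y' p z z' r : mutates y y' p -> mutates z z' r ->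
  mutates (y + z) (y' + z') (p + r).
Proof.
move=> [my yp] [mz zr]; split; last by rewrite lattice_formDr yp zr intrD mulrDr.
have AB : qX T y' * Phi 0 (- p) * (qX T z' * Phi 0 (- r)) =
    qX T y' * qX T z' * Phi 0 (- (p + r)).
  rewrite -mulrA [Phi 0 _ * (_ * _)]mulrA (Phi_shift _ _ zr) -mulrA.
  by rewrite -mulrN Phi_cocycle opprD mulrA.
have BA : qX T z' * Phi 0 (- r) * (qX T y' * Phi 0 (- p)) =
    qX T z' * qX T y' * Phi 0 (- (p + r)).
  rewrite -mulrA [Phi 0 _ * (_ * _)]mulrA (Phi_shift _ _ yp) -mulrA.
  by rewrite -mulrN Phi_cocycle [p + r]addrC opprD mulrA.
rewrite (morphism_qX_add (r := lattice_form y' z') my mz).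
  by rewrite AB scalerAl qXM.
by rewrite AB BA qX_comm -scalerAl.
Qed.

Lemma mutates0 : mutates 0 0 0.
Proof. by split; rewrite ?lattice_form0r ?mulr0 // !qX0 rmorph1 oppr0 Phi0 mulr1. Qed.

Lemma mutates_k : mutates (basis_vec k) (- basis_vec k) 0.
Proof.
split; last by rewrite lattice_formNr lattice_form_xx oppr0 mulr0.
by case: mP => _ -> _ _; rewrite oppr0 Phi0 mulr1 qXN.
Qed.

Lemma mutates_le v (b : nat) : v != k -> exch k v = - b%:R ->
  mutates (basis_vec v) (basis_vec v) (- b%:Z).
Proof.
move=> vk bE; have dE : weight k v = d * exch k v by rewrite /exch mulrC divfK.
split; last by rewrite lattice_form_basis dE bE mulrNz -pmulrn.
have [_ _ mle _] := mP.
rewrite mle //; last by rewrite bE oppr_le0 ler0n.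
rewrite bE -[b%:R]/(b%:Z%:~R) -mulrNz numq_int abszN opprK; rewrite /qXv; congr (_ * _).
rewrite big_add1 /= big_mkord; apply: eq_bigr => r _.
by rewrite /phi add0r !intrD intrM -pmulrn -natr1; congr (1 + qpow _ *: _); rewrite /d; ring.
Qed.

(** Each inverted factor in the inverse of [X] yields a factor [X] and an inverted factor in [X].
    The scalars collected in this way are the normalization of the monomial
    [basis_vec v + basis_vec k *+ b]. *)
Lemma mutates_ge v (b : nat) : v != k -> exch k v = b%:R ->
  mutates (basis_vec v) (basis_vec v + basis_vec k *+ b) b.
Proof.
move=> vk bE; have dE : weight k v = d * exch k v by rewrite /exch mulrC divfK.
have kv : lattice_form (basis_vec k) (basis_vec v) = d * b%:R.
  by rewrite lattice_form_basis dE bE.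
have kk j : lattice_form (basis_vec k) (basis_vec k *+ j) = 0.
  elim: j => [|j IH]; first by rewrite mulr0n lattice_form0r.
  by rewrite mulrS lattice_formDr lattice_form_xx IH addr0.
split; last by rewrite lattice_formDr kk addr0 kv -pmulrn.
have [_ _ _ mge] := mP; rewrite mge //; last by rewrite bE ler0n.
rewrite bE -[b%:R]/(b%:Z%:~R) numq_int absz_nat -/X.
have -> : \prod_(1 <= r < b.+1) (1 + qpow (mult k * (2 * r%:R - 1)) *: X^-1)^-1 =
    qpow (- (d * b%:R ^+ 2)) *: (X ^+ b * Phi 0 (- b%:Z)).
  rewrite big_add1 /= big_mkord; elim: b {bE kv} => [|b IH].
    by rewrite big_ord0 expr0 oppr0 Phi0 mulr1 expr0n mulr0 oppr0 q0 scale1r.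
  rewrite big_ord_recr [LHS]/= IH (_ : - b.+1%:Z = - b%:Z - 1) ?PhiB ?add0r; last lia.
  have XU : X \is a GRing.unit := qX_unit _ _.
  have -> : 1 + qpow (mult k * (2 * b.+1%:R - 1)) *: X^-1 =
      qpow (d * (2 * b.+1%:R - 1)) *: (phi (2 * - b%:Z - 1) * X^-1).
    rewrite /phi [(1 + _) / X]mulrDl mul1r -scalerAl mulrV // scalerDr scalerA -qD addrC.
    congr (_ + _); rewrite -[LHS](scale1r (1 : T)) -q0; congr (qpow _ *: _).
    by rewrite intrD mulrNz intrM mulrNz -!pmulrn -natr1; ring.
  set s := 2 * - b%:Z - 1.
  have -> : (qpow (d * (2 * b.+1%:R - 1)) *: (phi s * X^-1))^-1 =
      qpow (- (d * (2 * b.+1%:R - 1))) *: (X * (phi s)^-1).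
    apply: (mulIr (unitr_scale (qpow_neq0 (d * (2 * b.+1%:R - 1)))
       (_ : phi s * X^-1 \is a GRing.unit))); first by rewrite unitrMr ?unitrV ?phi_unit.
    rewrite mulVr; last by apply: unitr_scale (qpow_neq0 _) _; rewrite unitrMr ?unitrV ?phi_unit.
    rewrite -scalerAl -scalerAr scalerA -qD addNr q0 scale1r mulrA divrK ?phi_unit //.
    by rewrite mulrV.
  rewrite -scalerAl -scalerAr scalerA -qD -mulrA; congr (qpow _ *: _).
    by rewrite -natr1; ring.
  have XP : GRing.comm (Phi 0 (- b%:Z)) X.
    have : GRing.comm (Phi 0 (- b%:Z)) (phi 0 - 1).
      by apply: commrB; [apply: commr_sym; apply: phi_Phi|apply: commr1].
    by rewrite /phi mulr0 q0 scale1r addrC addKr.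
  by rewrite [_ * (X * _)]mulrA XP exprSr !mulrA.
rewrite -scalerAr [qXv T v * _]mulrA scalerAl; congr (_ * _).
rewrite (qX_exp T (basis_vec k) b) /qXv qX_mul scalerA -qD -[RHS]scale1r -q0; congr (qpow _ *: _).
rewrite lattice_form_skew.
have kv' j : lattice_form (basis_vec k *+ j) (basis_vec v) = d * b%:R *+ j.
  elim: j => [|j IH]; first by rewrite !mulr0n lattice_form0l.
  by rewrite !mulrS lattice_formDl kv IH.
by rewrite kv' -mulr_natr; ring.
Qed.

Lemma qX_shift y (p : int) : lattice_form (basis_vec k) y = d * p%:~R ->
  qX T (basis_vec k - y) = qpow (- (d * p%:~R)) *: (X * qX T (- y)).
Proof. by move=> yp; rewrite -qXM lattice_formNr yp. Qed.

Lemma qX_shift2 y (p : int) : lattice_form (basis_vec k) y = d * p%:~R ->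
  qX T (basis_vec k *+ 2 - y) = qpow (- (d * p%:~R) *+ 2) *: (X * X * qX T (- y)).
Proof.
move=> yp; rewrite mulr2n -addrA -qXM lattice_formDr lattice_form_xx add0r lattice_formNr yp.
by rewrite (qX_shift yp) -scalerAr scalerA -qD mulrA mulr2n.
Qed.

Definition q2 : K := qpow d + qpow (- d).

Lemma phi13 s : phi (s + 1) * phi (s + 3) =
  1 + (q2 * qpow (d * (s + 2)%:~R)) *: X + qpow (d * (s + 2)%:~R *+ 2) *: (X * X).
Proof.
have phiM b c : (1 + b *: X) * (1 + c *: X) = 1 + (b + c) *: X + (b * c) *: (X * X).
  rewrite mulrDl mul1r mulrDr mulr1 -scalerAl -scalerAr scalerA scalerDl.
  by rewrite -!addrA; congr (1 + _); rewrite addrCA.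
rewrite /phi phiM /q2 mulrDl -!qD mulr2n -!mulrDr.
congr (1 + _ *: _ + qpow _ *: _).
  by rewrite addrC; congr (qpow _ + qpow _); rewrite !intrD; ring.
by rewrite !intrD; ring.
Qed.

Lemma mutatesN0 y y' : mutates y y' 0 -> m (qX T' (- y)) = qX T (- y').
Proof. by move=> [my _]; rewrite morphism_qXN my oppr0 Phi0 mulr1 qXN. Qed.

(** For [p > 0] inversion turns the inverted factors into a polynomial, so the inverse monomial
    splits into several: hence the use of inverse coordinates. *)
Lemma mutatesN1 y y' : mutates y y' 1 ->
  m (qX T' (- y)) = qX T (- y') + qX T (basis_vec k - y').
Proof.
move=> [my yp]; rewrite morphism_qXN my PhiN1 add0r invrM ?qX_unit ?unitrV ?phi_unit //.
by rewrite invrK -qXN (qX_shift yp) /phi mulrDl mul1r mulrNz mulrN scalerAl.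
Qed.

Lemma mutatesN2 y y' : mutates y y' 2 -> m (qX T' (- y)) =
  qX T (- y') + q2 *: qX T (basis_vec k - y') + qX T (basis_vec k *+ 2 - y').
Proof.
move=> [my yp]; rewrite morphism_qXN my PhiN2 invrM ?qX_unit ?unitrV ?unitrMr ?phi_unit //.
rewrite invrK -qXN (qX_shift yp) (qX_shift2 yp) scalerA.
have := phi13 (- 4); rewrite (_ : - 4 + 1 = 0 - 3 :> int) // (_ : - 4 + 3 = 0 - 1 :> int) // => ->.
rewrite [(1 + _ + _) * _]mulrDl [(1 + _) * _]mulrDl mul1r -!scalerAl.
congr (_ + (_ * qpow _) *: _ + qpow _ *: _).
  by rewrite -mulrN -mulrNz.
by rewrite -mulrN -mulrNz.
Qed.

Lemma mutatesN_add y y' p : mutates y y' p ->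
  mutates (y + basis_vec k) (y' - basis_vec k) p.
Proof. by move=> yp; rewrite -[p]addr0; apply: mutates_add mutates_k. Qed.

(** The converse of splitting: both images carry the inverse of [phi 1] on the left, and their
    numerators add up to [phi 1] times a monomial. *)
Lemma mutates_collapse1 y y' : mutates y y' (-1) ->
  m (qX T' (- y)) + m (qX T' (- (y + basis_vec k))) = qX T (- y').
Proof.
move=> yp; have [my1 _] := mutatesN_add yp; case: yp => my yp.
rewrite !morphism_qXN my my1 opprK Phi1 add0r !invrM ?qX_unit ?phi_unit // -!qXN opprB.
rewrite (qX_shift yp) -mulrDr -[X in X + _]mul1r scalerAl -mulrDl -[X in _ = X]mul1r.
rewrite mulrA; congr (_ * _); rewrite (_ : 1 + _ = phi 1) ?mulVr ?phi_unit //.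
by rewrite /phi mulrNz mulrN opprK.
Qed.

Lemma mutates_collapse2 y y' : mutates y y' (-2) ->
  m (qX T' (- y)) + q2 *: m (qX T' (- (y + basis_vec k))) +
    m (qX T' (- (y + basis_vec k *+ 2))) = qX T (- y').
Proof.
move=> yp; have y1 := mutatesN_add yp; have [my2 _] := mutatesN_add y1.
case: y1 => my1 _; case: yp => my yp.
rewrite mulr2n [y + (_ + _)]addrA.
rewrite !morphism_qXN my my1 my2 opprK Phi2.
rewrite !invrM ?qX_unit ?unitrMr ?phi_unit // -!qXN !opprB.
rewrite [basis_vec k + (_ - _)]addrA -mulr2n (qX_shift yp) (qX_shift2 yp) -invrM ?phi_unit //.
rewrite scalerAr -!mulrDr -[X in X + _ + _]mul1r scalerA !scalerAl -!mulrDl.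
rewrite mulrA -[X in _ = X]mul1r; congr (_ * _).
rewrite (_ : 1 + _ + _ = phi 1 * phi 3) ?mulVr ?unitrMr ?phi_unit //.
have := phi13 0; rewrite !add0r => ->.
rewrite -[_ *: X * X]scalerAl.
by congr (1 + (_ * qpow _) *: _ + qpow (_ *+ 2) *: _); rewrite mulrNz mulrN opprK.
Qed.

End Mutation.

End QuantumTorus.

(** * The quiver of a word *)

Section WordQuiver.

Variables (g : simple_type) (H : rel g) (w : seq g).
Implicit Types (a b i j : g) (l t r k p : nat) (x y : {ffun wvertex w -> int}).

Local Notation Q := (tilde_quiver H w).
Local Notation cnt a := (count_mem a w).
Local Notation cntk a k := (count_mem a (take k w)).

Lemma count_take_le a k : (cntk a k <= cnt a)%N.
Proof. by rewrite -{2}[w](cat_take_drop k) count_cat leq_addr. Qed.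

Lemma node_eq a t (v : wvertex w) : (t <= cnt a)%N ->
  (v == node w a t) = (tag v == a) && (tagged v == t :> nat).
Proof.
case: v => j i ta; rewrite /node -tag_eqE /tag_eq /=; case: eqP => // ja.
by subst j; rewrite tagged_asE -val_eqE /= inordK.
Qed.

Definition level_sum a l : {ffun vertex Q -> int} :=
  \sum_(l <= t < (cnt a).+1) basis_vec (node w a t : vertex Q).

Lemma level_sumE a l (v : wvertex w) :
  level_sum a l v = ((tag v == a) && (l <= tagged v)%N)%:R.
Proof.
rewrite /level_sum sum_ffunE (eq_big_nat _ _ (F2 := fun t =>
    ((tag v == a) && (tagged v == t :> nat))%:R)); last first.
  by move=> t /andP[_ ta]; rewrite ffunE node_eq.
case: eqP => [va|_]; last by rewrite big1.
rewrite /=; have vn : (tagged v < (cnt a).+1)%N by rewrite -va ltn_ord.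
case: leqP => [lv|vl].
  rewrite (bigD1_seq (tagged v : nat)) ?mem_index_iota ?lv ?iota_uniq //= eqxx.
  by rewrite big1 ?addr0 // => t; rewrite eq_sym => /negPf->.
rewrite big_nat big1 // => t /andP[lt _].
by rewrite ltn_eqF // (leq_trans vl).
Qed.

(** Gluing pushes the weights forward, so the form is a sum over the elementary quivers of the
    pulled-back vectors. *)
Lemma basic_formE x y :
  \sum_u \sum_v (x u)%:~R * (y v)%:~R * basic_weight u v =
  \sum_(k < size w) \sum_o \sum_o' (x (glue k o))%:~R * (y (glue k o'))%:~R *
    elem_weight (tnth (in_tuple w) k) o o'.
Proof.
have fiber (k : 'I_(size w)) (F : wvertex w -> option g -> rat) :
    \sum_u \sum_(o | glue k o == u) F u o = \sum_o F (glue k o) o.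
  rewrite [RHS](partition_big (glue k) xpredT) //=; apply: eq_bigr => u _.
  by apply: eq_bigr => o /eqP->.
pose el (k : 'I_(size w)) := elem_weight (tnth (in_tuple w) k).
transitivity (\sum_(k < size w) \sum_u \sum_(o | glue k o == u)
    \sum_v \sum_(o' | glue k o' == v) (x u)%:~R * (y v)%:~R * el k o o'); last first.
  apply: eq_bigr => k _.
  rewrite (fiber k (fun u o => \sum_v \sum_(o' | glue k o' == v)
    (x u)%:~R * (y v)%:~R * el k o o')).
  apply: eq_bigr => o _.
  exact: (fiber k (fun v o' => (x (glue k o))%:~R * (y v)%:~R * el k o o')).
rewrite [RHS]exchange_big; apply: eq_bigr => u _ /=.
under [RHS]eq_bigr do rewrite exchange_big /=.
rewrite [RHS]exchange_big; apply: eq_bigr => v _ /=.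
rewrite /basic_weight mulr_sumr; apply: eq_bigr => k _.
rewrite mulr_sumr; apply: eq_bigr => o _.
by rewrite mulr_sumr; apply: eq_bigr.
Qed.

Lemma glue_some_tagged (k : 'I_(size w)) j : tagged (glue k (Some j)) = cntk j k :> nat.
Proof. by rewrite /= inordK // ltnS count_take_le. Qed.

Lemma cntkS j (k : 'I_(size w)) :
  cntk j k.+1 = (cntk j k + (tnth (in_tuple w) k == j))%N.
Proof.
have kw := ltn_ord k; rewrite (tnth_nth (tnth (in_tuple w) k)) /=.
by rewrite (take_nth (tnth (in_tuple w) k) kw) -cats1 count_cat /= addn0.
Qed.

Lemma glue_none_tagged (k : 'I_(size w)) :
  tagged (glue k None) = (cntk (tnth (in_tuple w) k) k).+1 :> nat.
Proof.
rewrite /= inordK // ltnS; have := count_take_le (tnth (in_tuple w) k) k.+1.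
by rewrite cntkS eqxx addn1.
Qed.

Lemma level_sum_some (k : 'I_(size w)) a l j :
  level_sum a l (glue k (Some j)) = ((j == a) && (l <= cntk j k)%N)%:R.
Proof. by rewrite level_sumE glue_some_tagged. Qed.

Lemma level_sum_none (k : 'I_(size w)) a l :
  level_sum a l (glue k None) =
    ((tnth (in_tuple w) k == a) && (l <= cntk a k.+1)%N)%:R.
Proof.
rewrite level_sumE glue_none_tagged cntkS -[tag _]/(tnth (in_tuple w) k).
by case: eqP => [<-|_] //; rewrite addn1.
Qed.

Lemma sum_level_option (k : 'I_(size w)) a l (F : option g -> rat) :
  \sum_o (level_sum a l (glue k o))%:~R * F o =
    (l <= cntk a k)%:R * F (Some a) +
    ((tnth (in_tuple w) k == a) && (l <= cntk a k.+1)%N)%:R * F None.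
Proof.
rewrite (bigD1 None) //= (bigD1 (Some a)) //= big1 ?addr0.
  by rewrite level_sum_none level_sum_some eqxx addrC !mulrz_nat.
case=> [j|] //= /eqP ja; rewrite level_sum_some; case: eqP => [je|_]; last by rewrite mul0r.
by case: ja; rewrite je.
Qed.

(** On level sums the contribution of one letter is a discrete Wronskian of two step functions of
    the position, which can be summed over all letters. *)
Lemma elem_form (k : 'I_(size w)) a b l r :
  \sum_o \sum_o' (level_sum a l (glue k o))%:~R * (level_sum b r (glue k o'))%:~R *
    elem_weight (tnth (in_tuple w) k) o o' =
  ip a b / 2 * ((l <= cntk a k)%:R * (r <= cntk b k.+1)%:R -
                (l <= cntk a k.+1)%:R * (r <= cntk b k)%:R).
Proof.
under eq_bigr => o _.
  under eq_bigr do rewrite -mulrA.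
  rewrite -mulr_sumr (sum_level_option k b r).
over.
rewrite (sum_level_option k a l) !cntkS; set c := tnth _ _.
rewrite /elem_weight /half_elem_weight.
have half d : rmult c * (cartan c d)%:~R / 2 = ip c d / 2.
  by rewrite /rmult cartanE; field; rewrite ip_neq0.
rewrite !half /rmult ![_ == c]eq_sym.
case: (eqVneq c a) => [<-|ca]; case: (eqVneq c b) => [<-|cb] /=;
  rewrite ?addn1 ?addn0 ?eqxx ?(negPf ca) ?(negPf cb) //=.
- ring.
- ring.
- rewrite ip_sym; ring.
- ring.
Qed.

(** The term [k = p] gives [- B p]; the terms after it telescope. *)
Lemma sum_step p N (B : nat -> rat) : (p < N)%N ->
  \sum_(k < N) ((p < k)%N%:R * B k.+1 - (p < k.+1)%N%:R * B k) = B N - B p.+1 - B p.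
Proof.
elim: N => [//|N IH]; rewrite ltnS leq_eqVlt big_ord_recr /= => /orP[/eqP->|pN].
  rewrite big1 ?ltnn ?ltnSn /= ?mul0r ?mul1r; first ring.
  by move=> k _; have kN := ltn_ord k; rewrite ltnNge (ltnW kN) ltnS leqNgt kN !mul0r subr0.
by rewrite IH // pN ltnS (ltnW pN) !mul1r; ring.
Qed.

Lemma cntk_ltn p k a : (p < size w)%N -> nth a w p = a -> (k <= size w)%N ->
  (cntk a p.+1 <= cntk a k)%N = (p < k)%N.
Proof.
move=> pw wp kw; have mono m n : (m <= n)%N -> (cntk a m <= cntk a n)%N.
  by move=> mn; rewrite -(take_takel w mn) -{2}[take n w](cat_take_drop m) count_cat leq_addr.
have -> : cntk a p.+1 = (cntk a p).+1.
  by rewrite (take_nth a pw) -cats1 count_cat /= wp eqxx addn0 addn1.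
case: (ltnP p k) => [pk|kp]; last by rewrite leqNgt ltnS mono.
have := mono _ _ pk; rewrite (take_nth a pw) -cats1 count_cat /= wp eqxx addn0 addn1.
by move=> ->.
Qed.

Lemma half_right_form a b l r : (l <= cnt a)%N ->
  \sum_u \sum_v (level_sum a l u)%:~R * (level_sum b r v)%:~R *
    half_right_weight H u v =
  (r <= cnt b)%:R * (if H a b then rmult a * `|(cartan a b)%:~R| / 2 else 0).
Proof.
move=> la; have top c m (v : wvertex w) : v != node w c (cnt c) ->
    level_sum c m v != 0 -> tagged v != ord_max.
  rewrite node_eq // level_sumE; case: v => c' t /=; case: eqP => [cc|_]; last by rewrite eqxx.
  by subst c' => /= tn _; rewrite -val_eqE.
rewrite (bigD1 (node w a (cnt a))) //= [X in _ + X]big1 ?addr0; last first.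
  move=> u ua; rewrite big1 // => v _; have [->|/(top _ _ _ ua)] := eqVneq (level_sum a l u) 0.
    by rewrite !mul0r.
  by rewrite /half_right_weight => /negPf->; rewrite mulr0.
rewrite (bigD1 (node w b (cnt b))) //= big1 ?addr0; last first.
  move=> v vb; have [->|/(top _ _ _ vb)] := eqVneq (level_sum b r v) 0.
    by rewrite mulr0 mul0r.
  by rewrite /half_right_weight => /negPf->; rewrite andbF mulr0.
rewrite !level_sumE !inordK // la !eqxx /= mul1r mulrz_nat.
by rewrite /half_right_weight /= -!val_eqE /= !inordK // !eqxx.
Qed.

Lemma level_form p a b r : (p < size w)%N -> nth a w p = a ->
  lattice_form (level_sum a (cntk a p.+1)) (level_sum b r) =
  ip a b / 2 * ((r <= cnt b)%:R * (1 - ((H a b)%:R - (H b a)%:R)) -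
    (r <= cntk b p.+1)%:R - (r <= cntk b p)%:R).
Proof.
move=> pw wp; set l := cntk a p.+1.
have la : (l <= cnt a)%N := count_take_le _ _.
rewrite /lattice_form /= /tilde_weight /=.
pose x := level_sum a l : {ffun wvertex w -> int}; pose y := level_sum b r : {ffun wvertex w -> int}.
transitivity (\sum_u \sum_v (x u)%:~R * (y v)%:~R * basic_weight u v +
    (\sum_u \sum_v (x u)%:~R * (y v)%:~R * half_right_weight H u v -
     \sum_u \sum_v (y u)%:~R * (x v)%:~R * half_right_weight H u v)).
  rewrite [X in _ - X]exchange_big -sumrB -big_split; apply: eq_bigr => u _ /=.
  rewrite -sumrB -big_split; apply: eq_bigr => v _ /=.
  rewrite /tilde_weight /= /x /y; ring.
have -> : \sum_u \sum_v (x u)%:~R * (y v)%:~R * half_right_weight H u v =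
    (r <= cnt b)%:R * (if H a b then rmult a * `|(cartan a b)%:~R| / 2 else 0).
  exact: half_right_form.
have -> : \sum_u \sum_v (y u)%:~R * (x v)%:~R * half_right_weight H u v =
    (r <= cnt b)%:R * (if H b a then rmult b * `|(cartan b a)%:~R| / 2 else 0).
  case: (leqP r (cnt b)) => rb; first by rewrite half_right_form // la.
  rewrite mul0r big1 // => u _; rewrite big1 // => v _; rewrite /y level_sumE.
  case: eqP => [ub|_]; last by rewrite !mul0r.
  by rewrite leqNgt (leq_trans (ltn_ord _)) ?ub // !mul0r.
rewrite basic_formE (eq_bigr (fun k : 'I_(size w) => ip a b / 2 * ((p < k)%N%:R *
    (r <= cntk b k.+1)%:R - (p < k.+1)%N%:R * (r <= cntk b k)%:R))); last first.
  by move=> k _; rewrite /x /y elem_form /l !cntk_ltn //; apply: ltnW.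
rewrite -mulr_sumr (sum_step (fun k => (r <= cntk b k)%:R) pw) take_size.
have [ab|ab] := eqVneq a b; first by rewrite ab; ring.
have norm (c d : g) : c != d -> rmult c * `|(cartan c d)%:~R| / 2 = - (ip c d / 2).
  move=> cd; rewrite ler0_norm ?lerz0 ?cartan_le0 // /rmult cartanE.
  by field; rewrite ip_neq0.
have -> : (if H a b then rmult a * `|(cartan a b)%:~R| / 2 else 0) = - (ip a b / 2) * (H a b)%:R.
  by case: (H a b); rewrite ?(norm _ _ ab) ?mulr1n ?mulr1 ?mulr0n ?mulr0.
have -> : (if H b a then rmult b * `|(cartan b a)%:~R| / 2 else 0) = - (ip a b / 2) * (H b a)%:R.
  have ba : b != a by rewrite eq_sym.
  by case: (H b a); rewrite ?(norm _ _ ba) ?[ip b a]ip_sym ?mulr1n ?mulr1 ?mulr0n ?mulr0.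
ring.
Qed.

Lemma basis_node a t : (t <= cnt a)%N ->
  basis_vec (node w a t : vertex Q) = level_sum a t - level_sum a t.+1.
Proof. by move=> ta; rewrite /level_sum [X in X - _]big_ltn // addrK. Qed.

(* [p] and [p2] are the positions of the two consecutive letters [a] between which
   the vertex lies. *)
Lemma exch_table p p2 a b t : (p < size w)%N -> (p2 < size w)%N ->
  nth a w p = a -> nth a w p2 = a -> cntk a p2.+1 = (cntk a p.+1).+1 ->
  (t <= cnt b)%N ->
  exch (node w a (cntk a p.+1) : vertex Q) (node w b t) =
  (cartan a b)%:~R / 2 * ((t == cntk b p2.+1)%:R + (t == cntk b p2)%:R -
    (t == cntk b p.+1)%:R - (t == cntk b p)%:R).
Proof.
move=> pw p2w wp wp2 p12 tb.
have eqE m : (t <= m)%N%:R - (t.+1 <= m)%N%:R = (t == m)%:R :> rat.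
  by case: (ltngtP t m) => h /=; ring.
rewrite /exch -lattice_form_basis !basis_node ?count_take_le // -p12.
rewrite lattice_formDl lattice_formNl !lattice_formDr !lattice_formNr !level_form //.
rewrite -!eqE /= /wmult /= /rmult cartanE; field; exact: ip_neq0.
Qed.

(** A level sum contains all three of the mutated vertex and its two neighbours, or none of them,
    except the two starting at [u.+1] and [u.+2]. Only the total of these two has to be
    preserved. *)
Lemma level_transport (V : zmodType) (img X : {ffun wvertex w -> int} -> V) a u :
  (u.+2 <= cnt a)%N ->
  (forall r : seq nat, (forall t, t \in r -> (t <= cnt a)%N && (t \notin [:: u; u.+1; u.+2])) ->
    let v t := basis_vec (node w a t : vertex Q) in let Z := \sum_(t <- r) v t in
    [/\ img (- Z) = X (- Z),
        img (- (Z + v u.+2)) + img (- (Z + v u.+2 + v u.+1)) =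
          X (- (Z + v u.+2)) + X (- (Z + v u.+2 + v u.+1)) &
        img (- (Z + v u + v u.+1 + v u.+2)) = X (- (Z + v u + v u.+1 + v u.+2))]) ->
  \sum_(1 <= l < (cnt a).+1) img (- level_sum a l) =
  \sum_(1 <= l < (cnt a).+1) X (- level_sum a l).
Proof.
set n := cnt a => un tr.
have low l : (1 <= l < u.+1)%N -> img (- level_sum a l) = X (- level_sum a l).
  move=> /andP[_ lu]; have [|_ _] := tr (index_iota l u ++ index_iota u.+3 n.+1).
    by move=> t; rewrite mem_cat !mem_index_iota !inE; lia.
  rewrite big_cat /= (_ : _ + _ + _ + _ + _ = level_sum a l) //.
  rewrite /level_sum [RHS](@big_cat_nat _ _ _ u) /=; [|exact: lu|by rewrite leqW // ltnW // ltnW].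
  have -> : \sum_(u <= t < n.+1) basis_vec (node w a t : vertex Q) =
      basis_vec (node w a u : vertex Q) + (basis_vec (node w a u.+1 : vertex Q) +
        (basis_vec (node w a u.+2 : vertex Q) +
          \sum_(u.+3 <= t < n.+1) basis_vec (node w a t : vertex Q))).
    have h1 : (u < n.+1)%N by rewrite ltnW // ltnW.
    have h2 : (u.+1 < n.+1)%N by rewrite ltnW.
    by rewrite (big_ltn h1) (big_ltn h2) big_ltn.
  by rewrite [LHS](AC (2*1*1*1) (1*(3*(4*(5*2))))).
have high l : (u.+3 <= l < n.+1)%N -> img (- level_sum a l) = X (- level_sum a l).
  move=> /andP[ul _]; have [|h _ _] := tr (index_iota l n.+1); last exact: h.
  by move=> t; rewrite mem_index_iota !inE; lia.
have mid : img (- level_sum a u.+1) + img (- level_sum a u.+2) =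
    X (- level_sum a u.+1) + X (- level_sum a u.+2).
  have [|_ + _] := tr (index_iota u.+3 n.+1).
    by move=> t; rewrite mem_index_iota !inE; lia.
  have -> : \sum_(t <- index_iota u.+3 n.+1) basis_vec (node w a t : vertex Q) +
      basis_vec (node w a u.+2 : vertex Q) = level_sum a u.+2.
    by rewrite /level_sum [RHS]big_ltn // addrC.
  have -> : level_sum a u.+2 + basis_vec (node w a u.+1 : vertex Q) = level_sum a u.+1.
    by rewrite /level_sum [RHS]big_ltn 1?addrC //; lia.
  by rewrite addrC => ->; rewrite addrC.
have split F : \sum_(1 <= l < n.+1) F l = \sum_(1 <= l < u.+1) F l +
    (F u.+1 + F u.+2) + \sum_(u.+3 <= l < n.+1) F l :> V.
  rewrite (@big_cat_nat _ _ _ u.+1) //=; last lia.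
  by rewrite [X in _ + X]big_ltn 1?[X in _ + (_ + X)]big_ltn ?addrA //; lia.
by rewrite !split mid (eq_big_nat _ _ low) (eq_big_nat _ _ high).
Qed.

End WordQuiver.

(** * Coxeter moves *)

Ltac vec := by apply/ffunP => ?; rewrite !(ffunE, ffunMnE); ring.

Lemma exch_mutate (Q : seed) (k u v : vertex Q) :
  @exch (mutate k) u v =
  if (u == k) || (v == k) then - exch u v
  else exch u v + (exch u k * `|exch k v| + `|exch u k| * exch k v) / 2.
Proof. by rewrite {1}/exch /= /mutated_weight mulrC mulKf // gt_eqF // mult_gt0. Qed.

(** * The three mutations of a four-letter move *)

Section MoveFour.

Variables (K : fieldType) (qpow : rat -> K).
Hypothesis q0 : qpow 0 = 1.
Hypothesis qD : forall r s, qpow (r + s) = qpow r * qpow s.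
Hypothesis q1 : forall r, qpow r = 1 -> r = 0.
Variable T : forall Q, quantum_field qpow Q.

Lemma mutates_conv (Q : seed) (k : vertex Q) (m : {lrmorphism T (mutate k) -> T Q})
  (y y' z z' : {ffun vertex Q -> int}) (p r : int) :
  mutates m y y' p -> y = z -> y' = z' -> p = r -> mutates m z z' r.
Proof. by move=> h <- <- <-. Qed.

Lemma mutates_basis0 (Q : seed) (k : vertex Q) (m : {lrmorphism T (mutate k) -> T Q}) v :
  is_quantum_mutation m -> v != k -> exch k v = 0 ->
  mutates m (basis_vec v) (basis_vec v) 0.
Proof.
move=> mP vk e.
exact: (mutates_conv (mutates_le mP (b := 0%N) vk (etrans e (esym (oppr0 _))))).
Qed.

Section Expansions.

Variables (Q : seed) (k : vertex Q) (m : {lrmorphism T (mutate k) -> T Q}).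
Implicit Types y : {ffun vertex Q -> int}.

Lemma expand1 y y' : mutates m y (y' + basis_vec k) 1 ->
  m (qX (T (mutate k)) (- y)) = qX (T Q) (- (y' + basis_vec k)) + qX (T Q) (- y').
Proof. by move=> h; rewrite (mutatesN1 q0 qD h) opprD addrCA subrr addr0. Qed.

Lemma expand2 y y' : mutates m y (y' + basis_vec k + basis_vec k) 2 ->
  m (qX (T (mutate k)) (- y)) = qX (T Q) (- (y' + basis_vec k + basis_vec k)) +
    q2 qpow k *: qX (T Q) (- (y' + basis_vec k)) + qX (T Q) (- y').
Proof.
move=> h; rewrite (mutatesN2 q0 qD h); congr (_ + _ *: qX _ _ + qX _ _); vec.
Qed.

Lemma collapse2 y y' : is_quantum_mutation m -> mutates m y y' (-2) ->
  m (qX (T (mutate k)) (- (y + basis_vec k + basis_vec k))) +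
    q2 qpow k *: m (qX (T (mutate k)) (- (y + basis_vec k))) +
    m (qX (T (mutate k)) (- y)) = qX (T Q) (- y').
Proof.
move=> mP /(mutates_collapse2 q0 qD q1 mP) <-.
by rewrite [LHS]addrC [X in _ + X = _]addrC [LHS]addrA mulr2n [y + (_ + _)]addrA.
Qed.

End Expansions.

Variables (Q : seed) (ki kj vi vj pi pj : vertex Q).
Let Q1 := @mutate Q ki.
Let Q2 := @mutate Q1 kj.
Let Q3 := @mutate Q2 ki.
Variables (m1 : {lrmorphism T Q1 -> T Q}) (m2 : {lrmorphism T Q2 -> T Q1})
  (m3 : {lrmorphism T Q3 -> T Q2}).
Hypotheses (m1P : is_quantum_mutation m1) (m2P : is_quantum_mutation m2)
  (m3P : is_quantum_mutation m3).

Local Notation "[ v ]" := (basis_vec v : {ffun vertex Q -> int}).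

Hypothesis kij : ki != kj.

Definition neutral (Z : {ffun vertex Q -> int}) :=
  [/\ mutates m1 Z Z 0, mutates m2 Z Z 0 & mutates m3 Z Z 0].

Lemma neutral_image Z : neutral Z -> m1 (m2 (m3 (qX (T Q3) (- Z)))) = qX (T Q) (- Z).
Proof.
case=> h1 h2 h3.
by rewrite (mutatesN0 q0 qD h3) (mutatesN0 q0 qD h2) (mutatesN0 q0 qD h1).
Qed.

Lemma neutral_basis v : v != ki -> v != kj -> exch ki v = 0 -> exch kj v = 0 ->
  neutral [v].
Proof.
move=> vi0 vj0 ei ej.
have e1i : @exch Q1 ki v = 0 by rewrite exch_mutate eqxx ei oppr0.
have e1j : @exch Q1 kj v = 0.
  by rewrite exch_mutate eq_sym (negPf kij) (negPf vi0) /= ej ei normr0; field.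
have e2i : @exch Q2 ki v = 0.
  by rewrite exch_mutate (negPf kij) (negPf vj0) /= e1j e1i normr0; field.
split.
- exact: (mutates_basis0 m1P vi0 ei).
- exact: (mutates_basis0 m2P vj0 e1j).
- exact: (mutates_basis0 m3P vi0 e2i).
Qed.

Lemma neutral_sum (r : seq nat) (V : nat -> vertex Q) :
  (forall t, t \in r -> neutral [V t]) -> neutral (\sum_(t <- r) [V t]).
Proof.
elim: r => [|t r IH] rV.
  by rewrite big_nil; split; apply: mutates0.
have [h1 h2 h3] := rV t (mem_head _ _).
have [|k1 k2 k3] := IH; first by move=> s sr; apply: rV; rewrite in_cons sr orbT.
rewrite big_cons; split.
- exact: (mutates_conv (mutates_add q0 qD q1 h1 k1)).
- exact: (mutates_conv (mutates_add q0 qD q1 h2 k2)).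
- exact: (mutates_conv (mutates_add q0 qD q1 h3 k3)).
Qed.

Hypotheses (vi_i : vi != ki) (vi_j : vi != kj) (vj_i : vj != ki) (vj_j : vj != kj).
Hypotheses (pi_i : pi != ki) (pi_j : pi != kj) (pj_i : pj != ki) (pj_j : pj != kj).

Local Notation madd := (mutates_add q0 qD q1).
Local Notation mk := (mutates_k q0 qD).
Local Notation mge := (mutates_ge q0 qD).
Local Notation mle := mutates_le.
Local Notation image x := (m1 (m2 (m3 (qX (T Q3) x)))).

Ltac conv h := by apply: (mutates_conv h); first [by [] | vec].

(** [m3] merges the two monomials into one, [m2] leaves it alone, and [m1] splits it again. *)
Lemma level_i_pair Z : exch ki vi = 1 -> @exch Q1 kj vi = 0 -> @exch Q2 ki vi = -1 ->
  neutral Z ->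
  image (- (Z + [vi])) + image (- (Z + [vi] + [ki])) =
  qX (T Q) (- (Z + [vi])) + qX (T Q) (- (Z + [vi] + [ki])).
Proof.
move=> e1 e2 e3 [n1 n2 n3]; set y := Z + [vi].
have h3 : mutates m3 y y (-1) by conv (madd n3 (mle m3P (b := 1%N) vi_i e3)).
have h2 : mutates m2 y y 0 by conv (madd n2 (mutates_basis0 m2P vi_j e2)).
have h1 : mutates m1 y (y + [ki]) 1 by rewrite /y; conv (madd n1 (mge m1P (b := 1%N) vi_i e1)).
rewrite -rmorphD -rmorphD /= (mutates_collapse1 q0 qD q1 m3P h3).
by rewrite (mutatesN0 q0 qD h2) (expand1 h1) addrC.
Qed.

(** The two neighbours of [ki] have opposite exchange numbers, so the image stays a single monomial
    at every stage. *)
Lemma level_i_left Z : exch ki pi = -1 -> @exch Q1 kj pi = 0 -> @exch Q2 ki pi = 1 ->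
  exch ki vi = 1 -> @exch Q1 kj vi = 0 -> @exch Q2 ki vi = -1 -> neutral Z ->
  image (- (Z + [pi] + [ki] + [vi])) = qX (T Q) (- (Z + [pi] + [ki] + [vi])).
Proof.
move=> p1 p2 p3 e1 e2 e3 [n1 n2 n3].
have h3 : mutates m3 (Z + [pi] + [ki] + [vi]) (Z + [pi] + [vi]) 0.
  conv (madd (madd (madd n3 (mge m3P (b := 1%N) pi_i p3)) (mk m3P))
    (mle m3P (b := 1%N) vi_i e3)).
have h2 : mutates m2 (Z + [pi] + [vi]) (Z + [pi] + [vi]) 0.
  conv (madd (madd n2 (mutates_basis0 m2P pi_j p2)) (mutates_basis0 m2P vi_j e2)).
have h1 : mutates m1 (Z + [pi] + [vi]) (Z + [pi] + [ki] + [vi]) 0.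
  conv (madd (madd n1 (mle m1P (b := 1%N) pi_i p1)) (mge m1P (b := 1%N) vi_i e1)).
by rewrite (mutatesN0 q0 qD h3) (mutatesN0 q0 qD h2) (mutatesN0 q0 qD h1).
Qed.

Section MoveIJIJ.

(* The values for the move from [i, j, i, j] to [j, i, j, i]. *)
Hypotheses (kivi : exch ki vi = 1) (kivj : exch ki vj = 0) (kikj : exch ki kj = -2)
  (kipi : exch ki pi = -1) (kipj : exch ki pj = 2).
Hypotheses (kjvj : exch kj vj = 1) (kjvi : exch kj vi = -1) (kjki : exch kj ki = 1)
  (kjpj : exch kj pj = -1) (kjpi : exch kj pi = 0).

Let norms := (normrN, normr0, normr1, normr_nat).

Let e1i v : @exch Q1 ki v = - exch ki v.
Proof. by rewrite exch_mutate eqxx. Qed.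

Let e1jki : @exch Q1 kj ki = -1.
Proof. by rewrite exch_mutate eqxx orbT kjki. Qed.

Let e1j v : v != ki -> @exch Q1 kj v = exch kj v + (`|exch ki v| + exch ki v) / 2.
Proof.
by move=> vi0; rewrite exch_mutate eq_sym (negPf kij) (negPf vi0) /= kjki normr1 !mul1r.
Qed.

Let e2i v : v != kj -> @exch Q2 ki v = - exch ki v + (`|@exch Q1 kj v| + @exch Q1 kj v).
Proof.
move=> vj0; rewrite exch_mutate (negPf kij) (negPf vj0) /= !e1i kikj opprK normr_nat.
by rewrite -mulrDr mulrC mulKf.
Qed.

Let e2ikj : @exch Q2 ki kj = -2.
Proof. by rewrite exch_mutate eqxx orbT e1i kikj opprK. Qed.

Lemma move2_e1 : [/\ @exch Q1 kj vi = 0, @exch Q1 kj vj = 1, @exch Q1 kj pi = 0 &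
  @exch Q1 kj pj = 1].
Proof.
by split; rewrite e1j // ?kivi ?kivj ?kipi ?kipj ?kjvj ?kjvi ?kjpj ?kjpi ?norms; field.
Qed.

Lemma move2_e2 : [/\ @exch Q2 ki vi = -1, @exch Q2 ki vj = 2, @exch Q2 ki pi = 1 &
  @exch Q2 ki pj = 0].
Proof.
have [f1 f2 f3 f4] := move2_e1.
by split; rewrite e2i // ?f1 ?f2 ?f3 ?f4 ?kivi ?kivj ?kipi ?kipj ?norms; ring.
Qed.

(** [m3] splits the first monomial into three, with middle coefficient [q2]. Under [m2] one of these
    merges with the image of the second monomial, while another splits in two. Finally [m1] merges a
    triple with coefficients 1, [q2], 1 and fixes the remaining term. *)
Lemma move2_j_pair Z : neutral Z ->
  image (- (Z + [vj])) + image (- (Z + [vj] + [kj])) =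
  qX (T Q) (- (Z + [vj])) + qX (T Q) (- (Z + [vj] + [kj])).
Proof.
have [f1 f2 f3 f4] := move2_e1; have [f1' f2' f3' f4'] := move2_e2.
move=> [n1 n2 n3]; set y := Z + [vj].
have jki : kj != ki by rewrite eq_sym.
have a3 : mutates m3 y (y + [ki] + [ki]) 2.
  by rewrite /y; conv (madd n3 (mge m3P (b := 2%N) vj_i f2')).
have b3 : mutates m3 (y + [kj]) (y + [ki] + [ki] + [kj]) 0.
  conv (madd a3 (mle m3P (b := 2%N) jki e2ikj)).
have ki2 := mle m2P (b := 1%N) kij e1jki.
have a2 : mutates m2 y (y + [kj]) 1 by rewrite /y; conv (madd n2 (mge m2P (b := 1%N) vj_j f2)).
have b2 : mutates m2 (y + [ki]) (y + [kj] + [ki]) 0 by conv (madd a2 ki2).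
have c2 : mutates m2 (y + [ki] + [ki]) (y + [kj] + [ki] + [ki]) (-1) by conv (madd b2 ki2).
have a1 : mutates m1 y y 0 by conv (madd n1 (mutates_basis0 m1P vj_i kivj)).
have b1 : mutates m1 (y + [kj]) (y + [kj]) (-2).
  conv (madd a1 (mle m1P (b := 2%N) jki kikj)).
rewrite (expand2 a3) (mutatesN0 q0 qD b3).
rewrite !rmorphD /= !lrZ (expand1 a2) (mutatesN0 q0 qD b2).
rewrite rmorphD /= [LHS](AC (2*2*1) ((1*5)*2*3*4)) /= -rmorphD /=.
rewrite (mutates_collapse1 q0 qD q1 m2P c2) (collapse2 m1P b1) (mutatesN0 q0 qD a1).
exact: addrC.
Qed.

Lemma move2_j_left Z : neutral Z ->
  image (- (Z + [pj] + [kj] + [vj])) = qX (T Q) (- (Z + [pj] + [kj] + [vj])).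
Proof.
have [f1 f2 f3 f4] := move2_e1; have [f1' f2' f3' f4'] := move2_e2.
move=> [n1 n2 n3]; have jki : kj != ki by rewrite eq_sym.
set y := Z + [pj] + [kj] + [vj].
have h3 : mutates m3 y (y + [ki] + [ki]) 0.
  rewrite /y; conv (madd (madd (madd n3 (mutates_basis0 m3P pj_i f4')) (mle m3P (b := 2%N) jki e2ikj))
    (mge m3P (b := 2%N) vj_i f2')).
have ki2 := mle m2P (b := 1%N) kij e1jki.
have h2 : mutates m2 (y + [ki] + [ki]) (y + [ki] + [ki]) 0.
  rewrite /y; conv (madd (madd (madd (madd (madd n2 (mge m2P (b := 1%N) pj_j f4)) (mk m2P))
    (mge m2P (b := 1%N) vj_j f2)) ki2) ki2).
have h1 : mutates m1 (y + [ki] + [ki]) y 0.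
  rewrite /y; conv (madd (madd (madd (madd (madd n1 (mge m1P (b := 2%N) pj_i kipj))
    (mle m1P (b := 2%N) jki kikj)) (mutates_basis0 m1P vj_i kivj)) (mk m1P)) (mk m1P)).
by rewrite (mutatesN0 q0 qD h3) (mutatesN0 q0 qD h2) (mutatesN0 q0 qD h1).
Qed.

Lemma move2_i_pair Z : neutral Z ->
  image (- (Z + [vi])) + image (- (Z + [vi] + [ki])) =
  qX (T Q) (- (Z + [vi])) + qX (T Q) (- (Z + [vi] + [ki])).
Proof. by have [? _ _ _] := move2_e1; have [? _ _ _] := move2_e2; apply: level_i_pair. Qed.

Lemma move2_i_left Z : neutral Z ->
  image (- (Z + [pi] + [ki] + [vi])) = qX (T Q) (- (Z + [pi] + [ki] + [vi])).
Proof. by have [? _ ? _] := move2_e1; have [? _ ? _] := move2_e2; apply: level_i_left. Qed.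

End MoveIJIJ.

Section MoveJIJI.

(* The values for the move from [j, i, j, i] to [i, j, i, j]. *)
Hypotheses (kivi : exch ki vi = 1) (kivj : exch ki vj = -2) (kikj : exch ki kj = 2)
  (kipi : exch ki pi = -1) (kipj : exch ki pj = 0).
Hypotheses (kjvj : exch kj vj = 1) (kjvi : exch kj vi = 0) (kjki : exch kj ki = -1)
  (kjpj : exch kj pj = -1) (kjpi : exch kj pi = 1).

Let norms := (normrN, normr0, normr1, normr_nat).

Let e1i v : @exch Q1 ki v = - exch ki v.
Proof. by rewrite exch_mutate eqxx. Qed.

Let e1jki : @exch Q1 kj ki = 1.
Proof. by rewrite exch_mutate eqxx orbT kjki opprK. Qed.

Let e1j v : v != ki -> @exch Q1 kj v = exch kj v + (exch ki v - `|exch ki v|) / 2.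
Proof.
move=> vi0; rewrite exch_mutate eq_sym (negPf kij) (negPf vi0) /= kjki normrN normr1.
by rewrite mulN1r mul1r addrC [- _ + _]addrC [LHS]addrC.
Qed.

Let e2i v : v != kj -> @exch Q2 ki v = - exch ki v + (@exch Q1 kj v - `|@exch Q1 kj v|).
Proof.
move=> vj0; rewrite exch_mutate (negPf kij) (negPf vj0) /= !e1i kikj normrN normr_nat.
by field.
Qed.

Let e2ikj : @exch Q2 ki kj = 2.
Proof. by rewrite exch_mutate eqxx orbT e1i kikj opprK. Qed.

Lemma move2inv_e1 : [/\ @exch Q1 kj vi = 0, @exch Q1 kj vj = -1, @exch Q1 kj pi = 0 &
  @exch Q1 kj pj = -1].
Proof.
by split; rewrite e1j // ?kivi ?kivj ?kipi ?kipj ?kjvj ?kjvi ?kjpj ?kjpi ?norms; field.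
Qed.

Lemma move2inv_e2 : [/\ @exch Q2 ki vi = -1, @exch Q2 ki vj = 0, @exch Q2 ki pi = 1 &
  @exch Q2 ki pj = -2].
Proof.
have [f1 f2 f3 f4] := move2inv_e1.
by split; rewrite e2i // ?f1 ?f2 ?f3 ?f4 ?kivi ?kivj ?kipi ?kipj ?norms; ring.
Qed.

(** As for the opposite move, but here [m3] splits the second monomial and the term split by [m2] is
    one of its three. *)
Lemma move2inv_j_pair Z : neutral Z ->
  image (- (Z + [vj])) + image (- (Z + [vj] + [kj])) =
  qX (T Q) (- (Z + [vj])) + qX (T Q) (- (Z + [vj] + [kj])).
Proof.
have [f1 f2 f3 f4] := move2inv_e1; have [f1' f2' f3' f4'] := move2inv_e2.
move=> [n1 n2 n3]; set y := Z + [vj].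
have jki : kj != ki by rewrite eq_sym.
have a3 : mutates m3 y y 0 by rewrite /y; conv (madd n3 (mutates_basis0 m3P vj_i f2')).
have b3 : mutates m3 (y + [kj]) (y + [kj] + [ki] + [ki]) 2.
  conv (madd a3 (mge m3P (b := 2%N) jki e2ikj)).
have ki2 := mge m2P (b := 1%N) kij e1jki.
have a2 : mutates m2 y y (-1) by rewrite /y; conv (madd n2 (mle m2P (b := 1%N) vj_j f2)).
have b2 : mutates m2 (y + [kj] + [ki]) (y + [ki]) 0.
  conv (madd (madd a2 (mk m2P)) ki2).
have c2 : mutates m2 (y + [kj] + [ki] + [ki]) (y + [ki] + [ki] + [kj]) 1.
  conv (madd b2 ki2).
have a1 : mutates m1 y y (-2) by rewrite /y; conv (madd n1 (mle m1P (b := 2%N) vj_i kivj)).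
have b1 : mutates m1 (y + [ki] + [ki] + [kj]) (y + [kj]) 0.
  conv (madd (madd (madd a1 (mk m1P)) (mk m1P)) (mge m1P (b := 2%N) jki kikj)).
rewrite (mutatesN0 q0 qD a3) (expand2 b3) !rmorphD /= !lrZ (mutatesN0 q0 qD b2).
rewrite (expand1 c2) rmorphD /= (mutatesN0 q0 qD b1).
rewrite [LHS](AC (1*((2*1)*1)) ((3*4*(1*5))*2)) /= -rmorphD /=.
by rewrite (mutates_collapse1 q0 qD q1 m2P a2) (collapse2 m1P a1).
Qed.

Lemma move2inv_j_left Z : neutral Z ->
  image (- (Z + [pj] + [kj] + [vj])) = qX (T Q) (- (Z + [pj] + [kj] + [vj])).
Proof.
have [f1 f2 f3 f4] := move2inv_e1; have [f1' f2' f3' f4'] := move2inv_e2.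
move=> [n1 n2 n3]; have jki : kj != ki by rewrite eq_sym.
set y := Z + [pj] + [kj] + [vj].
have h3 : mutates m3 y (y + [ki] + [ki]) 0.
  rewrite /y; conv (madd (madd (madd n3 (mle m3P (b := 2%N) pj_i f4'))
    (mge m3P (b := 2%N) jki e2ikj)) (mutates_basis0 m3P vj_i f2')).
have ki2 := mge m2P (b := 1%N) kij e1jki.
have h2 : mutates m2 (y + [ki] + [ki]) (y + [ki] + [ki]) 0.
  rewrite /y; conv (madd (madd (madd (madd (madd n2 (mle m2P (b := 1%N) pj_j f4)) (mk m2P))
    (mle m2P (b := 1%N) vj_j f2)) ki2) ki2).
have h1 : mutates m1 (y + [ki] + [ki]) y 0.
  rewrite /y; conv (madd (madd (madd (madd (madd n1 (mutates_basis0 m1P pj_i kipj))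
    (mge m1P (b := 2%N) jki kikj)) (mle m1P (b := 2%N) vj_i kivj)) (mk m1P)) (mk m1P)).
by rewrite (mutatesN0 q0 qD h3) (mutatesN0 q0 qD h2) (mutatesN0 q0 qD h1).
Qed.

Lemma move2inv_i_pair Z : neutral Z ->
  image (- (Z + [vi])) + image (- (Z + [vi] + [ki])) =
  qX (T Q) (- (Z + [vi])) + qX (T Q) (- (Z + [vi] + [ki])).
Proof. by have [? _ _ _] := move2inv_e1; have [? _ _ _] := move2inv_e2; apply: level_i_pair. Qed.

Lemma move2inv_i_left Z : neutral Z ->
  image (- (Z + [pi] + [ki] + [vi])) = qX (T Q) (- (Z + [pi] + [ki] + [vi])).
Proof. by have [? _ ? _] := move2inv_e1; have [? _ ? _] := move2inv_e2; apply: level_i_left. Qed.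

End MoveJIJI.

End MoveFour.

(** * Exchange numbers at the mutated vertices *)

Section Tables.

Variables (g : simple_type) (H : rel g).
Implicit Types (a b x : g) (pre mid suf : seq g) (t d e : nat).

Lemma count_take_mid x pre mid suf d : (d <= size mid)%N ->
  count_mem x (take (size pre + d) (pre ++ mid ++ suf)) =
  (count_mem x pre + count_mem x (take d mid))%N.
Proof.
move=> dm; rewrite take_cat ltnNge leq_addr /= addKn count_cat take_cat.
by case: ltngtP dm => // ->; rewrite subnn take0 cats0 take_size.
Qed.

Lemma exch_mid w k pre mid suf d e a x t : w = pre ++ mid ++ suf ->
  k = (count_mem a pre + count_mem a (take d.+1 mid))%N -> (d < size mid)%N -> (e < size mid)%N ->
  nth a mid d = a -> nth a mid e = a ->
  count_mem a (take e.+1 mid) = (count_mem a (take d.+1 mid)).+1 ->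
  let N s := (count_mem x pre + count_mem x (take s mid))%N in
  (t <= count_mem x w)%N ->
  exch (node w a k : vertex (tilde_quiver H w))
    (node w x t) =
  (cartan a x)%:~R / 2 * ((t == N e.+1)%:R + (t == N e)%:R - (t == N d.+1)%:R - (t == N d)%:R).
Proof.
move=> wE -> dm em md me de N tx.
have wnth s : (s < size mid)%N -> nth a w (size pre + s) = nth a mid s.
  by move=> sm; rewrite wE nth_cat ltnNge leq_addr /= addKn nth_cat sm.
have wsize s : (s < size mid)%N -> (size pre + s < size w)%N.
  by move=> sm; rewrite wE !size_cat ltn_add2l ltn_addr.
have := @exch_table g H w (size pre + d) (size pre + e) a x t (wsize _ dm) (wsize _ em).
rewrite !wnth // -!addnS wE !count_take_mid -?wE ?(ltnW dm) ?(ltnW em) // => -> //.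
by rewrite de addnS.
Qed.

Variables (pre suf : seq g) (a b : g).
Hypothesis ab : a != b.
Let u := count_mem a pre.
Let v := count_mem b pre.

Section Three.

Let w := pre ++ [:: a; b; a] ++ suf.

Lemma exch3 x t : (t <= count_mem x w)%N ->
  exch (node w a u.+1 : vertex (tilde_quiver H w)) (node w x t) =
  if x == a then (t == u.+2)%:R - (t == u)%:R
  else if x == b then (cartan a b)%:~R * ((t == v.+1)%:R - (t == v)%:R) else 0.
Proof.
move=> tx; have ba : (b == a) = false by rewrite eq_sym (negPf ab).
rewrite (@exch_mid w _ pre [:: a; b; a] suf 0 2) //=; rewrite ?eqxx ?ba ?addn0 ?addn1 //.
case: (eqVneq x a) => [->|xa].
  rewrite cartan_diag ?eqxx ?ba /= ?addn0 ?addn1 ?addn2 -/u. by field.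
by case: (eqVneq x b) => [->|xb] /=; rewrite ?addn0 ?addn1 -/v; field.
Qed.

End Three.

Section Four.

Let w := pre ++ [:: a; b; a; b] ++ suf.

Lemma exch4_first x t : (t <= count_mem x w)%N ->
  exch (node w a u.+1 : vertex (tilde_quiver H w)) (node w x t) =
  if x == a then (t == u.+2)%:R - (t == u)%:R
  else if x == b then (cartan a b)%:~R * ((t == v.+1)%:R - (t == v)%:R) else 0.
Proof.
move=> tx; have ba : (b == a) = false by rewrite eq_sym (negPf ab).
rewrite (@exch_mid w _ pre [:: a; b; a; b] suf 0 2) //=; rewrite ?eqxx ?ba ?addn0 ?addn1 //.
case: (eqVneq x a) => [->|xa].
  by rewrite cartan_diag ?eqxx ?ba /= ?addn0 ?addn1 ?addn2 -/u; field.
by case: (eqVneq x b) => [->|xb] /=; rewrite ?addn0 ?addn1 -/v; field.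
Qed.

Lemma exch4_second x t : (t <= count_mem x w)%N ->
  exch (node w b v.+1 : vertex (tilde_quiver H w)) (node w x t) =
  if x == b then (t == v.+2)%:R - (t == v)%:R
  else if x == a then (cartan b a)%:~R * ((t == u.+2)%:R - (t == u.+1)%:R) else 0.
Proof.
move=> tx; have ba : (b == a) = false by rewrite eq_sym (negPf ab).
rewrite (@exch_mid w _ pre [:: a; b; a; b] suf 1 3) //=;
  rewrite ?eqxx ?(negPf ab) ?ba ?addn0 ?addn1 //.
case: (eqVneq x b) => [->|xb].
  by rewrite cartan_diag ?eqxx ?(negPf ab) /= ?addn0 ?addn1 ?addn2 -/v; field.
by case: (eqVneq x a) => [->|xa] /=; rewrite ?addn0 ?addn1 ?addn2 -/u; field.
Qed.

End Four.

End Tables.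

Lemma mulz_eq1_npos (x y : int) : x <= 0 -> y <= 0 -> x * y = 1 -> x = -1 /\ y = -1.
Proof.
case: x => [[|x]|x] // _; first by rewrite (mul0r y).
case: y => [[|y]|y] // _.
rewrite !NegzE mulrNN => /eqP; rewrite -PoszM eqz_nat muln_eq1 => /andP[/eqP-> /eqP->].
by [].
Qed.

Lemma mulz_eq2_npos (x y : int) : x <= 0 -> y <= 0 -> x * y = 2 ->
  (x = -2 /\ y = -1) \/ (x = -1 /\ y = -2).
Proof.
case: x => [[|x]|x] // _; first by rewrite (mul0r y).
case: y => [[|y]|y] // _.
rewrite !NegzE mulrNN => /eqP; rewrite -PoszM eqz_nat.
case: x => [|[|x]]; case: y => [|[|y]] //=; rewrite ?mulnS ?mulSn //=; auto.
Qed.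

(** * Invariance of the level totals *)

Section FourLetterMoves.

Variables (g : simple_type) (H : rel g) (K : fieldType) (qpow : rat -> K).
Hypothesis q0 : qpow 0 = 1.
Hypothesis qD : forall r s, qpow (r + s) = qpow r * qpow s.
Hypothesis q1 : forall r, qpow r = 1 -> r = 0.
Variable T : forall Q, quantum_field qpow Q.
Implicit Types (a b i j x : g) (w pre suf : seq g).

Definition level_total w a : T (tilde_quiver H w) :=
  \sum_(1 <= l < (count_mem a w).+1) qX (T _) (- level_sum H w a l).

Lemma node_eq_node w a b t s : (t <= count_mem a w)%N -> (s <= count_mem b w)%N ->
  (node w a t == node w b s) = (a == b) && (t == s).
Proof. by move=> ta sb; rewrite node_eq //= inordK. Qed.

Lemma same_label_node w w' a t : (t <= count_mem a w)%N ->
  same_label w' (node w a t) = node w' a t.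
Proof. by move=> ta; rewrite /same_label /= inordK. Qed.

Lemma relabeling_sumN (Q Q' : seed) (sigma : vertex Q -> vertex Q')
    (f : {lrmorphism T Q' -> T Q}) (s : seq nat) (V : nat -> vertex Q) y :
  is_relabeling sigma f -> y = \sum_(t <- s) basis_vec (sigma (V t)) ->
  f (qX (T Q') (- y)) = qX (T Q) (- \sum_(t <- s) basis_vec (V t)).
Proof.
move=> fs ->; rewrite (morphism_qXN q0 qD) (qXN q0 qD); congr (_^-1).
by have := relabeling_sum q0 qD q1 (map V s) fs; rewrite !big_map.
Qed.

(** Symmetrizability puts the entry -2 in the row of the short root. *)
Lemma cartan_prod2 i j : cartan i j * cartan j i = 2 -> rmult i < rmult j ->
  [/\ i != j, cartan i j = -2 & cartan j i = -1].
Proof.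
move=> c2 rij; have ij : i != j.
  by apply/eqP => ij; move: rij; rewrite ij ltxx.
have ji : j != i by rewrite eq_sym.
have := cartan_le0 ij; have := cartan_le0 ji.
have : (cartan j i)%:~R * ip j j = (cartan i j)%:~R * ip i i :> rat.
  by rewrite !cartanE [ip j i]ip_sym; field; rewrite !ip_neq0.
move: rij c2 (ip_gt0 i) (ip_gt0 j); rewrite /rmult.
move: (cartan i j) (cartan j i) => x y rij c2 i0 j0 e y0 x0.
have [[xE yE]|[xE yE]] := mulz_eq2_npos x0 y0 c2.
  by rewrite xE yE.
by move: e; rewrite xE yE !mulrNz; lra.
Qed.

Lemma cartan_prod1 i j : cartan i j * cartan j i = 1 ->
  [/\ i != j, cartan i j = -1 & cartan j i = -1].
Proof.
move=> c1; have ij : i != j by apply/eqP => ij; move: c1; rewrite ij cartan_diag.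
have ji : j != i by rewrite eq_sym.
have := cartan_le0 ij; have := cartan_le0 ji; move: c1.
move: (cartan i j) (cartan j i) => x y c1 y0 x0.
by have [-> ->] := mulz_eq1_npos x0 y0 c1.
Qed.

Section FourLetters.

(* [ki] and [kj] are the vertices of the mutations. *)
Variables (w w' : seq g) (i j : g) (u v : nat).
Hypothesis ww' : forall a, count_mem a w' = count_mem a w.
Hypotheses (ij : i != j) (ui : (u.+2 <= count_mem i w)%N) (vj : (v.+2 <= count_mem j w)%N).

Local Notation Q := (tilde_quiver H w).
Local Notation ki := (node w i u.+1 : vertex Q).
Local Notation kj := (node w j v.+1 : vertex Q).
Local Notation Q1 := (@mutate Q ki).
Local Notation Q2 := (@mutate Q1 kj).
Local Notation Q3 := (@mutate Q2 ki).
Variables (m1 : {lrmorphism T Q1 -> T Q}) (m2 : {lrmorphism T Q2 -> T Q1})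
  (m3 : {lrmorphism T Q3 -> T Q2}) (r : {lrmorphism T (tilde_quiver H w') -> T Q3}).
Hypotheses (m1P : is_quantum_mutation m1) (m2P : is_quantum_mutation m2)
  (m3P : is_quantum_mutation m3).
Hypothesis rP : @is_relabeling K qpow Q3 (tilde_quiver H w') (@same_label g w w') _ _ r.

Let img (y : {ffun wvertex w -> int}) : T Q := m1 (m2 (m3 (qX (T Q3) y))).

Let kij : ki != kj.
Proof. by rewrite node_eq_node ?(negPf ij) // ltnW. Qed.

Let kiE a t : (t <= count_mem a w)%N -> (node w a t == ki) = (a == i) && (t == u.+1).
Proof. by move=> ta; rewrite node_eq_node // ltnW. Qed.

Let kjE a t : (t <= count_mem a w)%N -> (node w a t == kj) = (a == j) && (t == v.+1).
Proof. by move=> ta; rewrite node_eq_node // ltnW. Qed.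

Hypothesis ki_triv : forall a t, (t <= count_mem a w)%N ->
  ~~ ((a == i) && (t \in [:: u; u.+1; u.+2])) -> ~~ ((a == j) && (t \in [:: v; v.+1; v.+2])) ->
  exch ki (node w a t) = 0.
Hypothesis kj_triv : forall a t, (t <= count_mem a w)%N ->
  ~~ ((a == i) && (t \in [:: u; u.+1; u.+2])) -> ~~ ((a == j) && (t \in [:: v; v.+1; v.+2])) ->
  exch kj (node w a t) = 0.

Let neutral_level a (s : seq nat) : (forall t, t \in s -> (t <= count_mem a w)%N &&
    ~~ ((a == i) && (t \in [:: u; u.+1; u.+2])) && ~~ ((a == j) && (t \in [:: v; v.+1; v.+2]))) ->
  neutral m1 m2 m3 (\sum_(t <- s) basis_vec (node w a t : vertex Q)).
Proof.
move=> sP; apply: (neutral_sum q0 qD q1) => t /sP /andP[/andP[ta ti] tj].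
apply: (neutral_basis m1P m2P m3P) => //; rewrite ?ki_triv ?kj_triv // ?kiE ?kjE //.
  by apply: contra ti => /andP[-> /eqP->]; rewrite !inE eqxx orbT.
by apply: contra tj => /andP[-> /eqP->]; rewrite !inE eqxx orbT.
Qed.

Let imgE a l : m1 (m2 (m3 (r (qX (T _) (- level_sum H w' a l))))) = img (- level_sum H w a l).
Proof.
rewrite (@relabeling_sumN Q3 _ _ r (index_iota l (count_mem a w).+1) (node w a) _ rP) //.
rewrite /level_sum ww'; apply: eq_big_nat => t /andP[_ ta].
by rewrite same_label_node.
Qed.

Lemma four_letter_total :
  (forall Z, neutral m1 m2 m3 Z ->
    let vi := basis_vec (node w i u.+2 : vertex Q) in
    img (- (Z + vi)) + img (- (Z + vi + basis_vec ki)) =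
      qX (T Q) (- (Z + vi)) + qX (T Q) (- (Z + vi + basis_vec ki)) /\
    let pi := basis_vec (node w i u : vertex Q) in
    img (- (Z + pi + basis_vec ki + vi)) = qX (T Q) (- (Z + pi + basis_vec ki + vi))) ->
  (forall Z, neutral m1 m2 m3 Z ->
    let vj := basis_vec (node w j v.+2 : vertex Q) in
    img (- (Z + vj)) + img (- (Z + vj + basis_vec kj)) =
      qX (T Q) (- (Z + vj)) + qX (T Q) (- (Z + vj + basis_vec kj)) /\
    let pj := basis_vec (node w j v : vertex Q) in
    img (- (Z + pj + basis_vec kj + vj)) = qX (T Q) (- (Z + pj + basis_vec kj + vj))) ->
  forall a, m1 (m2 (m3 (r (level_total w' a)))) = level_total w a.
Proof.
move=> li lj a; rewrite /level_total ww' !rmorph_sum /=.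
rewrite (eq_bigr _ (fun l _ => imgE a l)).
have [->|ai] := eqVneq a i.
  apply: (level_transport (X := fun y => qX (T Q) y) ui) => s sP.
  have nZ : neutral m1 m2 m3 (\sum_(t <- s) basis_vec (node w i t : vertex Q)).
    apply: neutral_level => t /sP /andP[-> ts] /=.
    by rewrite eqxx ts (negPf ij).
  have [h1 h2] := li _ nZ; split=> //.
  exact: (neutral_image q0 qD).
have [->|aj] := eqVneq a j.
  apply: (level_transport (X := fun y => qX (T Q) y) vj) => s sP.
  have nZ : neutral m1 m2 m3 (\sum_(t <- s) basis_vec (node w j t : vertex Q)).
    apply: neutral_level => t /sP /andP[-> ts] /=.
    by rewrite eqxx ts [j == i]eq_sym (negPf ij).
  have [h1 h2] := lj _ nZ; split=> //.
  exact: (neutral_image q0 qD).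
apply: eq_bigr => l _; apply: (neutral_image q0 qD); apply: neutral_level => t.
by rewrite mem_index_iota (negPf ai) (negPf aj) /= andbT andbT => /andP[_].
Qed.

End FourLetters.

Lemma nat_neqs u : (((u.+1 == u) = false) * ((u.+2 == u) = false) *
  ((u == u.+1) = false) * ((u == u.+2) = false) * ((u.+1 == u.+2) = false) *
  ((u.+2 == u.+1) = false))%type.
Proof. by do !split; apply/eqP; lia. Qed.

Lemma move2_total pre suf i j
    (f : {lrmorphism T (tilde_quiver H (pre ++ [:: j; i; j; i] ++ suf)) ->
          T (tilde_quiver H (pre ++ [:: i; j; i; j] ++ suf))}) :
  cartan i j * cartan j i = 2 -> rmult i < rmult j ->
  move2_morphism pre i j f -> forall a, f (level_total _ a) = level_total _ a.
Proof.
move=> c2 rij [m1 [m2 [m3 [r [m1P m2P m3P rP fE]]]]].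
have [ij cij cji] := cartan_prod2 c2 rij.
set w' := pre ++ [:: j; i; j; i] ++ suf in f r rP fE *.
set w := pre ++ [:: i; j; i; j] ++ suf in f m1 m2 m3 r m1P m2P m3P rP fE *.
set u := count_mem i pre in m1 m2 m3 r m1P m2P m3P rP fE *.
set v := count_mem j pre in m1 m2 m3 r m1P m2P m3P rP fE *.
have ji : (j == i) = false by rewrite eq_sym (negPf ij).
have ww' a : count_mem a w' = count_mem a w by rewrite /w /w' !count_cat /=; lia.
have ui : (u.+2 <= count_mem i w)%N by rewrite /w !count_cat /= eqxx ji -/u; lia.
have vj : (v.+2 <= count_mem j w)%N by rewrite /w !count_cat /= eqxx (negPf ij) -/v; lia.
have u1 := ltnW ui; have u0 := ltnW u1; have v1 := ltnW vj; have v0 := ltnW v1.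
have exi a t := @exch4_first g H pre suf i j ij a t.
have exj a t := @exch4_second g H pre suf i j ij a t.
rewrite -/u -/v -/w in exi exj.
move=> a; rewrite fE /=.
have nd := (node_eq_node, eqxx, nat_neqs, negPf ij, ji).
have kij : node w i u.+1 != node w j v.+1 :> vertex (tilde_quiver H w) by rewrite !nd.
apply: (four_letter_total ww' ij ui vj m1P m2P m3P rP) => [b t tb h1 h2|b t tb h1 h2|Z nZ|Z nZ].
- rewrite exi //; case: eqP h1 => [_|_ _].
    by rewrite !inE !negb_or => /and3P[/negPf-> _ /negPf->]; rewrite subrr.
  case: eqP h2 => //= _; rewrite !inE !negb_or => /and3P[/negPf-> /negPf-> _].
  by rewrite subrr mulr0.
- rewrite exj //; case: eqP h2 => [_|_ _].
    by rewrite !inE !negb_or => /and3P[/negPf-> _ /negPf->]; rewrite subrr.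
  case: eqP h1 => //= _; rewrite !inE !negb_or => /and3P[_ /negPf-> /negPf->].
  by rewrite subrr mulr0.
- split.
    have := @move2_i_pair _ _ q0 qD q1 T (tilde_quiver H w) _ _ (node w i u.+2) (node w j v.+2) (node w i u)
      (node w j v) m1 m2 m3 m1P m2P m3P kij.
    by rewrite !exi // !exj // !nd //= cij cji; apply => //; ring.
  have := @move2_i_left _ _ q0 qD q1 T (tilde_quiver H w) _ _ (node w i u.+2) (node w j v.+2) (node w i u)
    (node w j v) m1 m2 m3 m1P m2P m3P kij.
  by rewrite !exi // !exj // !nd //= cij cji; apply => //; ring.
- split.
    have := @move2_j_pair _ _ q0 qD q1 T (tilde_quiver H w) _ _ (node w i u.+2) (node w j v.+2) (node w i u)
      (node w j v) m1 m2 m3 m1P m2P m3P kij.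
    by rewrite !exi // !exj // !nd //= cij cji; apply => //; ring.
  have := @move2_j_left _ _ q0 qD q1 T (tilde_quiver H w) _ _ (node w i u.+2) (node w j v.+2) (node w i u)
    (node w j v) m1 m2 m3 m1P m2P m3P kij.
  by rewrite !exi // !exj // !nd //= cij cji; apply => //; ring.
Qed.

Lemma move2inv_total pre suf i j
    (f : {lrmorphism T (tilde_quiver H (pre ++ [:: i; j; i; j] ++ suf)) ->
          T (tilde_quiver H (pre ++ [:: j; i; j; i] ++ suf))}) :
  cartan i j * cartan j i = 2 -> rmult i < rmult j ->
  move2_morphism pre i j f -> forall a, f (level_total _ a) = level_total _ a.
Proof.
move=> c2 rij [m1 [m2 [m3 [r [m1P m2P m3P rP fE]]]]].
have [ij cij cji] := cartan_prod2 c2 rij.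
set w' := pre ++ [:: i; j; i; j] ++ suf in f r rP fE *.
set w := pre ++ [:: j; i; j; i] ++ suf in f m1 m2 m3 r m1P m2P m3P rP fE *.
set u := count_mem i pre in m1 m2 m3 r m1P m2P m3P rP fE *.
set v := count_mem j pre in m1 m2 m3 r m1P m2P m3P rP fE *.
have ji' : j != i by rewrite eq_sym.
have ji : (j == i) = false := negPf ji'.
have ww' a : count_mem a w' = count_mem a w by rewrite /w /w' !count_cat /=; lia.
have ui : (u.+2 <= count_mem i w)%N by rewrite /w !count_cat /= eqxx ji -/u; lia.
have vj : (v.+2 <= count_mem j w)%N by rewrite /w !count_cat /= eqxx (negPf ij) -/v; lia.
have u1 := ltnW ui; have u0 := ltnW u1; have v1 := ltnW vj; have v0 := ltnW v1.
have exi a t := @exch4_second g H pre suf j i ji' a t.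
have exj a t := @exch4_first g H pre suf j i ji' a t.
rewrite -/u -/v -/w in exi exj.
move=> a; rewrite fE /=.
have nd := (node_eq_node, eqxx, nat_neqs, negPf ij, ji).
have kij : node w i u.+1 != node w j v.+1 :> vertex (tilde_quiver H w) by rewrite !nd.
apply: (four_letter_total ww' ij ui vj m1P m2P m3P rP) => [b t tb h1 h2|b t tb h1 h2|Z nZ|Z nZ].
- rewrite exi //; case: eqP h1 => [_|_ _].
    by rewrite !inE !negb_or => /and3P[/negPf-> _ /negPf->]; rewrite subrr.
  case: eqP h2 => //= _; rewrite !inE !negb_or => /and3P[_ /negPf-> /negPf->].
  by rewrite subrr mulr0.
- rewrite exj //; case: eqP h2 => [_|_ _].
    by rewrite !inE !negb_or => /and3P[/negPf-> _ /negPf->]; rewrite subrr.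
  case: eqP h1 => //= _; rewrite !inE !negb_or => /and3P[/negPf-> /negPf-> _].
  by rewrite subrr mulr0.
- split.
    have := @move2inv_i_pair _ _ q0 qD q1 T (tilde_quiver H w) _ _ (node w i u.+2) (node w j v.+2) (node w i u)
      (node w j v) m1 m2 m3 m1P m2P m3P kij.
    by rewrite !exi // !exj // !nd //= cij cji; apply => //; ring.
  have := @move2inv_i_left _ _ q0 qD q1 T (tilde_quiver H w) _ _ (node w i u.+2) (node w j v.+2) (node w i u)
    (node w j v) m1 m2 m3 m1P m2P m3P kij.
  by rewrite !exi // !exj // !nd //= cij cji; apply => //; ring.
- split.
    have := @move2inv_j_pair _ _ q0 qD q1 T (tilde_quiver H w) _ _ (node w i u.+2) (node w j v.+2) (node w i u)
      (node w j v) m1 m2 m3 m1P m2P m3P kij.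
    by rewrite !exi // !exj // !nd //= cij cji; apply => //; ring.
  have := @move2inv_j_left _ _ q0 qD q1 T (tilde_quiver H w) _ _ (node w i u.+2) (node w j v.+2) (node w i u)
    (node w j v) m1 m2 m3 m1P m2P m3P kij.
  by rewrite !exi // !exj // !nd //= cij cji; apply => //; ring.
Qed.

(** * The three-letter move *)

Section BraidMove.

Variables (pre suf : seq g) (i j : g).
Hypotheses (cij2 : cartan i j * cartan j i = 1).

Let w := pre ++ [:: i; j; i] ++ suf.
Let w' := pre ++ [:: j; i; j] ++ suf.
Let u := count_mem i pre.
Let v := count_mem j pre.
Let ni := count_mem i w.
Let nj := count_mem j w.
Local Notation Q := (tilde_quiver H w).
Local Notation k := (node w i u.+1 : vertex Q).
Local Notation V a t := (basis_vec (node w a t : vertex Q)).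

Variables (m : {lrmorphism T (@mutate Q k) -> T Q})
  (r : {lrmorphism T (tilde_quiver H w') -> T (@mutate Q k)}).
Hypothesis mP : is_quantum_mutation m.
Hypothesis rP : @is_relabeling K qpow (@mutate Q k) (tilde_quiver H w')
  (@braid_label g w w' pre i j) _ _ r.

Let ij : i != j. Proof. by have [] := cartan_prod1 cij2. Qed.
Let ji : (j == i) = false. Proof. by rewrite eq_sym (negPf ij). Qed.
Let cij : cartan i j = -1. Proof. by have [] := cartan_prod1 cij2. Qed.
Let ui : (u.+2 <= ni)%N.
Proof. by rewrite /ni /w !count_cat /= eqxx ji -/u; lia. Qed.
Let vj : (v.+1 <= nj)%N.
Proof. by rewrite /nj /w !count_cat /= eqxx (negPf ij) -/v; lia. Qed.

Let ni' : ni = (count_mem i w').+1.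
Proof. by rewrite /ni /w /w' !count_cat /= eqxx ji; lia. Qed.
Let nj' : count_mem j w' = nj.+1.
Proof. by rewrite /nj /w /w' !count_cat /= eqxx (negPf ij); lia. Qed.
Let na' a : a != i -> a != j -> count_mem a w' = count_mem a w.
Proof.
move=> ai aj; rewrite /w /w' !count_cat /= ![_ == a]eq_sym (negPf ai) (negPf aj); lia.
Qed.

Let exi a t : (t <= count_mem a w)%N -> exch k (node w a t) =
  if a == i then (t == u.+2)%:R - (t == u)%:R
  else if a == j then (cartan i j)%:~R * ((t == v.+1)%:R - (t == v)%:R) else 0.
Proof. exact: exch3. Qed.

Let label_i t : (t <= ni)%N -> t != u.+1 -> braid_label w' pre i j (node w i t) =
  node w' i (if (t <= u)%N then t else t.-1).
Proof.
move=> tn tu; rewrite /braid_label /= inordK // eqxx -/u (negPf tu).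
have -> : (u.+1 < t)%N = ~~ (t <= u)%N by rewrite ltn_neqAle eq_sym tu -ltnNge.
by case: leqP.
Qed.

Let label_k : braid_label w' pre i j k = node w' j v.+1.
Proof. by rewrite /braid_label /= inordK ?eqxx // ltnS ltnW. Qed.

Let label_j t : (t <= nj)%N -> braid_label w' pre i j (node w j t) =
  node w' j (if (t <= v)%N then t else t.+1).
Proof.
move=> tn; by rewrite /braid_label /= inordK // ji eqxx -/v ltnNge; case: leqP.
Qed.

Let label_other a t : a != i -> a != j -> (t <= count_mem a w)%N ->
  braid_label w' pre i j (node w a t) = node w' a t.
Proof. by move=> ai aj ta; rewrite /braid_label /= inordK // (negPf ai) (negPf aj). Qed.

Let img (y : {ffun wvertex w -> int}) : T Q := m (qX (T (@mutate Q k)) y).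

Let trivial_sum a (s : seq nat) : (forall t, t \in s -> (t <= count_mem a w)%N &&
    ~~ ((a == i) && (t \in [:: u; u.+1; u.+2])) && ~~ ((a == j) && (t \in [:: v; v.+1]))) ->
  mutates m (\sum_(t <- s) V a t) (\sum_(t <- s) V a t) 0.
Proof.
elim: s => [|t s IH] sP; first by rewrite big_nil; apply: mutates0.
rewrite big_cons; apply: (mutates_conv (mutates_add q0 qD q1 (mutates_basis0 mP _ _) (IH _))) => //.
- have /andP[/andP[ta ti] tj] := sP t (mem_head _ _).
  rewrite node_eq_node ?(ltnW ui) //; apply: contra ti => /andP[-> /eqP->].
  by rewrite !inE eqxx orbT.
- have /andP[/andP[ta ti] tj] := sP t (mem_head _ _).
  rewrite exi //; case: eqP ti => [_|_ _].
    by rewrite !inE !negb_or => /and3P[/negPf-> _ /negPf->]; rewrite subrr.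
  case: eqP tj => //= _; rewrite !inE !negb_or => /andP[/negPf-> /negPf->].
  by rewrite subrr mulr0.
- by move=> t' t's; apply: sP; rewrite in_cons t's orbT.
Qed.

Let relabelN y (vs : seq (vertex Q)) :
  y = \sum_(x <- vs) basis_vec (braid_label w' pre i j x : vertex (tilde_quiver H w')) ->
  m (r (qX (T _) (- y))) = img (- \sum_(x <- vs) basis_vec x).
Proof.
move=> ->; rewrite /img; congr (m _); rewrite (morphism_qXN q0 qD) (qXN q0 qD); congr (_^-1).
exact: (@relabeling_sum K qpow q0 qD q1 (@mutate Q k) (tilde_quiver H w') _ _ _ r vs rP).
Qed.

Let nodes a l n : seq (vertex Q) := [seq (node w a t : vertex Q) | t <- index_iota l n].

Let sum_nodes a l n : \sum_(x <- nodes a l n) basis_vec x = \sum_(l <= t < n) V a t.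
Proof. by rewrite big_map. Qed.

Let labels_i_low l n : (n <= u.+1)%N ->
  \sum_(x <- nodes i l n) basis_vec (braid_label w' pre i j x : vertex (tilde_quiver H w')) =
  \sum_(l <= t < n) basis_vec (node w' i t : vertex (tilde_quiver H w')).
Proof.
move=> nu; rewrite big_map; apply: eq_big_nat => t /andP[_ tn].
by rewrite label_i; [case: leqP => //; lia|lia|lia].
Qed.

Let labels_i_high l : (u < l)%N ->
  \sum_(x <- nodes i l.+1 ni.+1) basis_vec (braid_label w' pre i j x : vertex (tilde_quiver H w')) =
  level_sum H w' i l.
Proof.
move=> ul; rewrite big_map /level_sum -ni' [LHS]big_add1 /=.
apply: eq_big_nat => t /andP[lt tn].
by rewrite label_i; [case: leqP => //; lia|lia|lia].
Qed.

Let labels_j_low l n : (n <= v.+1)%N ->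
  \sum_(x <- nodes j l n) basis_vec (braid_label w' pre i j x : vertex (tilde_quiver H w')) =
  \sum_(l <= t < n) basis_vec (node w' j t : vertex (tilde_quiver H w')).
Proof.
move=> nv; rewrite big_map; apply: eq_big_nat => t /andP[_ tn].
by rewrite label_j; [case: leqP => //; lia|lia].
Qed.

Let labels_j_high l : (v < l)%N ->
  \sum_(x <- nodes j l nj.+1) basis_vec (braid_label w' pre i j x : vertex (tilde_quiver H w')) =
  level_sum H w' j l.+1.
Proof.
move=> vl; rewrite big_map /level_sum nj' [RHS]big_add1 /=.
apply: eq_big_nat => t /andP[lt tn].
by rewrite label_j; [case: leqP => //; lia|lia].
Qed.

Let iTriv l n : (u.+2 < l)%N -> (n <= ni.+1)%N ->
  mutates m (\sum_(l <= t < n) V i t) (\sum_(l <= t < n) V i t) 0.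
Proof.
move=> ul nn; apply: trivial_sum => t; rewrite mem_index_iota eqxx (negPf ij) /= andbT.
by rewrite !inE -/ni; lia.
Qed.

Let jTriv l n : (v.+1 < l)%N -> (n <= nj.+1)%N ->
  mutates m (\sum_(l <= t < n) V j t) (\sum_(l <= t < n) V j t) 0.
Proof.
move=> vl nn; apply: trivial_sum => t; rewrite mem_index_iota eqxx ji /= andbT.
by rewrite !inE -/nj; lia.
Qed.

Let iLow l n : (n <= u)%N -> mutates m (\sum_(l <= t < n) V i t) (\sum_(l <= t < n) V i t) 0.
Proof.
move=> nu; apply: trivial_sum => t; rewrite mem_index_iota eqxx (negPf ij) /= andbT.
by rewrite !inE -/ni; lia.
Qed.

Let jLow l n : (n <= v)%N -> mutates m (\sum_(l <= t < n) V j t) (\sum_(l <= t < n) V j t) 0.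
Proof.
move=> nv; apply: trivial_sum => t; rewrite mem_index_iota eqxx ji /= andbT.
by rewrite !inE -/nj; lia.
Qed.

Let nd := (node_eq_node, eqxx, nat_neqs, negPf ij, ji).

Let mvi : mutates m (V i u.+2) (V i u.+2 + V i u.+1) 1.
Proof.
apply: (mutates_conv (mutates_ge q0 qD mP (b := 1%N) _ _)) => //.
- by rewrite !nd // ltnW.
- by rewrite exi // !nd //= subr0.
Qed.

Let mpi : mutates m (V i u) (V i u) (-1).
Proof.
have u1 := ltnW ui.
apply: (mutates_le mP (b := 1%N)); first by rewrite !nd // ltnW.
by rewrite exi ?(ltnW u1) // !nd //= sub0r.
Qed.

Let mvj : mutates m (V j v.+1) (V j v.+1) (-1).
Proof.
apply: (mutates_le mP (b := 1%N)); first by rewrite !nd // ltnW.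
by rewrite exi // !nd //= cij mulrNz; ring.
Qed.

Let mpj : mutates m (V j v) (V j v + V i u.+1) 1.
Proof.
apply: (mutates_conv (mutates_ge q0 qD mP (b := 1%N) _ _)) => //.
- by rewrite !nd // ltnW.
- by rewrite exi ?(ltnW vj) // !nd //= cij mulrNz; ring.
Qed.

(** The new word has one letter [i] fewer: the term at [u.+1] splits into the old terms at [u.+1]
    and [u.+2], and later terms are shifted by one. *)
Let total_i : m (r (level_total w' i)) = level_total w i.
Proof.
have u1 := ltnW ui; have u0 := ltnW u1.
have low l : (1 <= l < u.+1)%N ->
    m (r (qX (T _) (- level_sum H w' i l))) = qX (T Q) (- level_sum H w i l).
  move=> /andP[_ lu].
  rewrite (relabelN (vs := nodes i l u.+1 ++ nodes i u.+2 ni.+1)).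
    rewrite big_cat /= !sum_nodes big_nat_recr //= (@big_ltn _ _ _ u.+2) //.
    have h := mutates_add q0 qD q1 (mutates_add q0 qD q1 (iLow l (leqnn u)) mpi)
      (mutates_add q0 qD q1 mvi (iTriv (leqnn u.+3) (leqnn _))).
    rewrite /img (mutatesN0 q0 qD h); congr (qX _ (- _)).
    rewrite /level_sum -/ni [RHS](@big_cat_nat _ _ _ u.+1) //= ?(leqW u0) ?(ltnW lu) //.
    rewrite (big_nat_recr u) //= (@big_ltn _ _ _ u.+1) ?ltnS // (@big_ltn _ _ _ u.+2) ?ltnS //.
    by rewrite [V i u.+2 + _ + _]addrAC [V i u.+2 + _ + _]addrC.
  rewrite big_cat labels_i_low // labels_i_high // /level_sum -big_cat_nat //; lia.
have mid : m (r (qX (T _) (- level_sum H w' i u.+1))) =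
    qX (T Q) (- level_sum H w i u.+1) + qX (T Q) (- level_sum H w i u.+2).
  rewrite (relabelN (vs := nodes i u.+2 ni.+1)) ?labels_i_high // sum_nodes big_ltn //.
  have h := mutates_add q0 qD q1 mvi (iTriv (leqnn u.+3) (leqnn _)).
  rewrite addrAC in h; rewrite /img (expand1 q0 qD h) /level_sum -/ni.
  congr (qX _ (- _) + qX _ (- _)); last by rewrite [RHS]big_ltn.
  have l1 : (u.+1 < ni.+1)%N by rewrite ltnS.
  have l2 : (u.+2 < ni.+1)%N by rewrite ltnS.
  by rewrite [LHS]addrC (big_ltn l1) (big_ltn l2).
have high l : (u.+2 <= l)%N ->
    m (r (qX (T _) (- level_sum H w' i l))) = qX (T Q) (- level_sum H w i l.+1).
  move=> ul; rewrite (relabelN (vs := nodes i l.+1 ni.+1)) ?labels_i_high ?sum_nodes //.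
    by rewrite /img (mutatesN0 q0 qD (iTriv _ _)).
  exact: ltnW.
rewrite /level_total !rmorph_sum /= -/ni -ni'.
rewrite (@big_cat_nat _ _ _ u.+1) //=.
rewrite (eq_big_nat _ _ low) (@big_ltn _ _ _ u.+1) // mid.
rewrite (eq_big_nat _ _ (F2 := fun l => qX (T Q) (- level_sum H w i l.+1))); last first.
  by move=> l /andP[ul _]; apply: high.
rewrite [RHS](@big_cat_nat _ _ _ u.+1) //=.
rewrite (@big_ltn _ _ _ u.+1 ni.+1) ?ltnS // (@big_ltn _ _ _ u.+2 ni.+1) ?ltnS //.
by rewrite [\sum_(u.+3 <= _ < ni.+1) _]big_add1 /= !addrA.
Qed.

(** The new word has one letter [j] more: the terms at [v.+1] and [v.+2] merge into the old term at
    [v.+1]. *)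
Let total_j : m (r (level_total w' j)) = level_total w j.
Proof.
have u1 := ltnW ui; have u0 := ltnW u1; have v0 := ltnW vj.
have low l : (1 <= l < v.+1)%N ->
    m (r (qX (T _) (- level_sum H w' j l))) = qX (T Q) (- level_sum H w j l).
  move=> /andP[_ lv].
  rewrite (relabelN (vs := nodes j l v.+1 ++ k :: nodes j v.+1 nj.+1)).
    rewrite big_cat big_cons /= !sum_nodes big_nat_recr //= (@big_ltn _ _ _ v.+1) //.
    have h := mutates_add q0 qD q1 (mutates_add q0 qD q1 (jLow l (leqnn v)) mpj)
      (mutates_add q0 qD q1 (mutates_k q0 qD mP)
        (mutates_add q0 qD q1 mvj (jTriv (leqnn v.+2) (leqnn _)))).
    rewrite /img (mutatesN0 q0 qD h); congr (qX _ (- _)).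
    rewrite /level_sum -/nj [RHS](@big_cat_nat _ _ _ v.+1) //= ?(leqW v0) ?(ltnW lv) //.
    rewrite (big_nat_recr v) //= (@big_ltn _ _ _ v.+1) ?ltnS //.
    by rewrite [LHS]addrA; congr (_ + _); rewrite addrA addrK.
  rewrite big_cat big_cons labels_j_low // labels_j_high // label_k /level_sum -big_ltn; last lia.
  rewrite -big_cat_nat //; lia.
have mid : m (r (qX (T _) (- level_sum H w' j v.+1))) +
    m (r (qX (T _) (- level_sum H w' j v.+2))) = qX (T Q) (- level_sum H w j v.+1).
  have h := mutates_add q0 qD q1 mvj (jTriv (leqnn v.+2) (leqnn _)).
  rewrite -big_ltn ?ltnS // in h; rewrite addr0 in h.
  rewrite (relabelN (vs := rcons (nodes j v.+1 nj.+1) k)); last first.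
    rewrite -cats1 big_cat big_seq1 /= labels_j_high // label_k addrC /level_sum -big_ltn //; lia.
  rewrite (relabelN (vs := nodes j v.+1 nj.+1)) ?labels_j_high //.
  rewrite -cats1 big_cat big_seq1 !sum_nodes addrC.
  exact: (mutates_collapse1 q0 qD q1 mP h).
have high l : (v.+2 <= l)%N ->
    m (r (qX (T _) (- level_sum H w' j l.+1))) = qX (T Q) (- level_sum H w j l).
  move=> vl; rewrite (relabelN (vs := nodes j l nj.+1)) ?labels_j_high ?sum_nodes //.
    by rewrite /img (mutatesN0 q0 qD (jTriv _ _)).
  exact: ltnW.
rewrite /level_total !rmorph_sum /= -/nj nj'.
have l1 : (v.+1 < nj.+2)%N by rewrite ltnS leqW // ltnW.
have l2 : (v.+2 < nj.+2)%N by rewrite ltnS.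
rewrite (@big_cat_nat _ _ _ v.+1 1 nj.+2) //=; last exact: ltnW.
rewrite (eq_big_nat _ _ low) (big_ltn l1) (big_ltn l2) [X in _ + X = _]addrA mid.
rewrite [\sum_(v.+3 <= _ < _) _]big_add1 /=.
rewrite [\sum_(v.+2 <= _ < _) _](eq_big_nat _ _
  (F2 := fun l => qX (T Q) (- level_sum H w j l))); last first.
  by move=> l /andP[vl _]; apply: high.
rewrite [RHS](@big_cat_nat _ _ _ v.+1) //=.
by rewrite [in RHS](@big_ltn _ _ _ v.+1 nj.+1).
Qed.

Let total_other a : a != i -> a != j -> m (r (level_total w' a)) = level_total w a.
Proof.
move=> ai aj; rewrite /level_total !rmorph_sum /= na' //; apply: eq_bigr => l _.
rewrite (relabelN (vs := nodes a l (count_mem a w).+1)).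
  rewrite sum_nodes /img /level_sum (mutatesN0 q0 qD (trivial_sum _)) // => t.
  by rewrite mem_index_iota (negPf ai) (negPf aj) /= !andbT => /andP[].
rewrite big_map /level_sum na' //; apply: eq_big_nat => t /andP[_ ta].
by rewrite label_other.
Qed.

Lemma braid_total a : m (r (level_total w' a)) = level_total w a.
Proof.
have [->|ai] := eqVneq a i; first exact: total_i.
by have [->|aj] := eqVneq a j; [exact: total_j|exact: total_other].
Qed.

End BraidMove.

End FourLetterMoves.

(** Clearing the denominator of [r > 0] would make [qpow 1] a root of a polynomial ['X^n - 1] with
    [n > 0]. *)
Lemma qpow_eq1 (K : fieldType) (qpow : rat -> K) :
  formal_parameter qpow -> forall r, qpow r = 1 -> r = 0.
Proof.
move=> [q0 qD qfree].
have qn r n : qpow (r * n%:R) = qpow r ^+ n.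
  elim: n => [|n IH]; first by rewrite mulr0 q0 expr0.
  by rewrite exprS -IH -qD -natr1 mulrDr mulr1 addrC.
have pos r : 0 < r -> qpow r != 1.
  move=> r0; apply/eqP => r1.
  have nE : r * (`|denq r|%N)%:R = (`|numq r|%N)%:R.
    rewrite !natr_absz !gtr0_norm ?numq_gt0 ?denq_gt0 //.
    by rewrite -[X in X * _]divq_num_den mulfVK // intr_eq0 denq_eq0.
  have n0 : (0 < `|numq r|)%N by rewrite absz_gt0 numq_eq0 gt_eqF.
  have := qfree ('X^`|numq r| - 1) _.
  rewrite rmorphB /= map_polyXn rmorph1 hornerD hornerN hornerXn hornerC.
  rewrite -qn mul1r -nE qn r1 expr1n subrr eqxx => /(_ _)/negP; apply=> //.
  by rewrite -size_poly_eq0 size_XnsubC.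
move=> r r1; have [//|r0] := eqVneq r 0; case: (ltgtP r 0) r0 => // rs _.
  have /eqP[] : qpow (- r) != 1 by apply: pos; rewrite oppr_gt0.
  by rewrite -[LHS]mul1r -[X in X * _]r1 -qD subrr q0.
by have := pos _ rs; rewrite r1 eqxx.
Qed.

Lemma reduced_prefix (g : simple_type) (w w' : seq g) : reduced (w ++ w') -> reduced w.
Proof.
move=> red v vE; have := red (v ++ w').
rewrite !size_cat leq_add2r; apply=> x; rewrite /weyl_elt !foldr_cat; exact: vE.
Qed.

(** * From the invariant totals back to the coordinates *)

Section LevelTotals.

Variables (g : simple_type) (H : rel g) (K : fieldType) (qpow : rat -> K).
Hypothesis q0 : qpow 0 = 1.
Hypothesis qD : forall r s, qpow (r + s) = qpow r * qpow s.
Hypothesis q1 : forall r, qpow r = 1 -> r = 0.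
Variable T : forall Q, quantum_field qpow Q.

Lemma move0_total (w w' : seq g) (f : {lrmorphism T (tilde_quiver H w') -> T (tilde_quiver H w)}) a :
  (forall b, count_mem b w' = count_mem b w) -> move0_morphism f ->
  f (level_total H T w' a) = level_total H T w a.
Proof.
move=> ww' fP; rewrite /level_total rmorph_sum ww'; apply: eq_bigr => l _.
apply: (relabeling_sumN q0 qD q1 fP); rewrite /level_sum ww'.
by apply: eq_big_nat => t /andP[_ ta]; rewrite same_label_node.
Qed.

Lemma move_total (w w' : seq g) (C : coxeter_move w w')
    (f : {lrmorphism T (tilde_quiver H w') -> T (tilde_quiver H w)}) a :
  is_move_morphism C f -> f (level_total H T w' a) = level_total H T w a.
Proof.
case: C f => [pre i j suf _|pre i j suf c1|pre i j suf c2 rij|pre i j suf c2 rij] f /=.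
- by apply: move0_total => b; rewrite !count_cat /=; lia.
- by move=> [m [r [mP rP fE]]]; rewrite fE /= (braid_total q0 qD q1 c1 mP rP).
- by move=> fP; exact: (move2_total q0 qD q1 c2 rij fP a).
- by move=> fP; exact: (move2inv_total q0 qD q1 c2 rij fP a).
Qed.

Lemma sequence_total (w w' : seq g) (C : move_sequence w w')
    (f : {lrmorphism T (tilde_quiver H w') -> T (tilde_quiver H w)}) a :
  is_sequence_morphism C f -> f (level_total H T w' a) = level_total H T w a.
Proof.
elim: C f => [v|v v1 v2 C1 C2 IH] f /=; first by move->.
by move=> [f1 [f2 [P1 P2 ->]]] /=; rewrite (IH _ P2) (move_total _ P1).
Qed.

Section Coordinates.

Variables (w : seq g) (l0 : g).

Let letter p := nth l0 w p.
Let ord p := count_mem (letter p) (take p.+1 w).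

Definition inverse_coord p : T (tilde_quiver H w) :=
  qX (T _) (- level_sum H w (letter p) (ord p)).

Fixpoint coord_word n : seq (g * T (tilde_quiver H w)) :=
  if n is p.+1 then (letter p, inverse_coord p) :: coord_word p else [::].

Lemma mem_coord_word n p : (p < n)%N -> (letter p, inverse_coord p) \in coord_word n.
Proof.
elim: n => // n IH; rewrite ltnS leq_eqVlt inE => /predU1P[->|/IH->]; first by rewrite eqxx.
by rewrite orbT.
Qed.

Lemma coord_word_unit n x : x \in coord_word n -> x.2 \is a GRing.unit.
Proof.
elim: n => // n IH; rewrite inE => /predU1P[->|/IH//]; exact: qX_unit.
Qed.

Lemma fsum_coord_word n j : (n <= size w)%N ->
  fsum (coord_word n) j =
  \sum_(1 <= l < (count_mem j (take n w)).+1) qX (T _) (- level_sum H w j l).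
Proof.
elim: n => [|n IH] nw; first by rewrite take0 big_geq.
rewrite /= (IH (ltnW nw)) /inverse_coord /ord (take_nth l0 nw) -cats1 count_cat /= addn0 -/(letter n).
have [<-|nj] := eqVneq (letter n) j; last by rewrite addn0 addr0.
by rewrite count_cat /= eqxx !addn1 [RHS]big_nat_recr.
Qed.

(** For an edge oriented from [i] to [j] only, the value at [i j] is 0 and the value at [j i] is
    [2 * ip i j]: the orientation decides how the symmetric form is distributed. *)
Definition feigin_exponent (i j : g) : rat := ip i j * (1 - ((H i j)%:R - (H j i)%:R)).

(** The exponent is negated because X_x X_y equals q^(-2 (x, y)) X_y X_x, so the Feigin family lives
    at the inverse of q. *)
Lemma feigin_coord_word n : (n <= size w)%N ->
  feigin (fun r => qpow (- r)) feigin_exponent (coord_word n).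
Proof.
elim: n => // n IH nw; split; last exact: IH (ltnW nw).
move=> j; rewrite (fsum_coord_word _ (ltnW nw)) mulr_suml mulr_sumr scaler_sumr.
apply: eq_big_nat => t /andP[_]; rewrite ltnS => tj.
have tj1 : (t <= count_mem j (take n.+1 w))%N.
  by rewrite (take_nth l0 nw) -cats1 count_cat (leq_trans tj) ?leq_addr.
have tjw : (t <= count_mem j w)%N.
  by rewrite -(cat_take_drop n w) count_cat (leq_trans tj) ?leq_addr.
rewrite /inverse_coord (qX_comm q0 qD); congr (qpow (- _) *: _).
rewrite lattice_formNl lattice_formNr opprK lattice_form_skew.
rewrite (level_form H j t nw (set_nth_default _ _ nw)) tj tj1 tjw.
by rewrite /feigin_exponent [ip j _]ip_sym /= -/(letter n); field.
Qed.

Lemma positive_coord_word n : (n <= size w)%N -> reduced w ->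
  positive_word [seq x.1 | x <- coord_word n].
Proof.
have letters m : (m <= size w)%N -> rev [seq x.1 | x <- coord_word m] = take m w.
  elim: m => [|m IH] mw; first by rewrite take0.
  by rewrite /= rev_cons (IH (ltnW mw)) (take_nth l0 mw).
move=> + red; elim: n => // n IH nw; split; last exact: IH (ltnW nw).
move=> k; rewrite (letters _ (ltnW nw)); apply: (reduced_weyl_sroot q0 qD q1).
by rewrite -(take_nth l0 nw); apply: (@reduced_prefix _ _ (drop n.+1 w)); rewrite cat_take_drop.
Qed.

Lemma inverse_coord_fixed (mu : {lrmorphism T (tilde_quiver H w) -> T (tilde_quiver H w)}) :
  reduced w -> (forall a, mu (level_total H T w a) = level_total H T w a) ->
  forall p, (p < size w)%N -> mu (inverse_coord p) = inverse_coord p.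
Proof.
move=> red muP p pw.
(* The constant function 1 is the weight rho in terms of its values on the simple coroots. *)
apply: (@feigin_fixed g K (fun r => qpow (- r)) _ _ _ feigin_exponent _ (fun=> 1%N) _
  (coord_word (size w)) mu _ _ _ _ _ (letter p, inverse_coord p)) => //.
- by move=> r s; rewrite opprD.
- by move=> r /q1/eqP; rewrite oppr_eq0 => /eqP.
- by move=> i j; rewrite /feigin_exponent [ip j i]ip_sym; ring.
- exact: feigin_coord_word.
- exact: coord_word_unit.
- exact: positive_coord_word.
- by move=> j; rewrite fsum_coord_word // take_size; apply: muP.
- exact: mem_coord_word.
Qed.

End Coordinates.

End LevelTotals.

Theorem corollary3p11 (g : simple_type) (H : rel g) (hH : dynkin_orientation H)
    (K : fieldType) (qpow : rat -> K) (hq : formal_parameter qpow)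
    (T : forall Q : seed, quantum_field qpow Q)
    (i0 : seq g) (hi0 : reduced_longest i0) (C : move_sequence i0 i0)
    (mu : {lrmorphism T (tilde_quiver H i0) -> T (tilde_quiver H i0)})
    (hmu : is_sequence_morphism C mu) (k : 'I_(size i0)) :
  mu (lusztig_coord H T k) = lusztig_coord H T k.
Proof.
have [q0 qD _] := hq; have q1 := qpow_eq1 hq; have [red _] := hi0.
have muP a := sequence_total q0 qD q1 a hmu.
have := inverse_coord_fixed q0 qD q1 (tnth (in_tuple i0) k) red muP (ltn_ord k).
rewrite /inverse_coord -[nth _ _ _](tnth_nth _ (in_tuple i0)) (morphism_qXN q0 qD) (qXN q0 qD).
exact: invr_inj.
Qed.
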